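(* Let $q\ge 1$, let $f\in C^q([-1,1];\mathbb R^2)$ with $f^{(q)}$ absolutely continuous, and let $p,r\in C^q[-1,1]$ be real-valued. For all sufficiently large $N$ let $n_1,\dots,n_{2q}$, $n_s=n_s(N)$, be distinct nonzero integers with $\alpha_0N\le|n_s|\le N$ for $s=1,\dots,2q$, where $0<\alpha_0<1$ is a fixed constant, and suppose that $$\lim_{N\to\infty}\frac{n_s}{N}=c_s\ne0,\qquad s=1,\dots,2q.$$ Let $E=\{s: n_s\text{ is even}\}$ and $O=\{s: n_s\text{ is odd}\}$ (sets not depending on $N$), and suppose that $|E|=|O|=q$, that the numbers $\{c_s:s\in E\}$ are pairwise distinct, and that the numbers $\{c_s:s\in O\}$ are pairwise distinct. Let $\widetilde R_{q,N}(f)=f-\widetilde S_{q,N}(f)$ be the KEG-D error defined in the context. Then $$\lim_{N\to\infty}N^{2q+1}\|\widetilde R_{q,N}(f)\|^2=\frac{2^{2q}}{\pi^{2q+2}}\bigl[(A+B)^2J_E+(A-B)^2J_O\bigr],$$ where $\|\cdot\|$ is the norm of $L_2([-1,1];\mathbb R^2)$, $A:=g_q^+$, $B:=-g_q^-$, and $$J_E:=\int_{-1}^{1}\prod_{s\in E}\Bigl(x-\frac1{c_s}\Bigr)^2dx,\qquad J_O:=\int_{-1}^{1}\prod_{s\in O}\Bigl(x-\frac1{c_s}\Bigr)^2dx.$$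
   Context: Dirac problem. Let $J=\begin{pmatrix}0&1\\-1&0\end{pmatrix}$, $Q(x)=\operatorname{diag}(p(x),r(x))$ and $\mathcal Ay:=Jy'-Qy$. Let $\alpha,\beta\in[0,\pi]$ and consider the self-adjoint eigenvalue problem $\mathcal Ay=\lambda y$ on $[-1,1]$ with boundary conditions $y_2(-1)\cos\alpha+y_1(-1)\sin\alpha=0$, $y_2(1)\cos\beta+y_1(1)\sin\beta=0$. It is assumed that $\lambda=0$ is not an eigenvalue. The eigenvalues $\{\lambda_n\}_{n\in\mathbb Z}$ are indexed in increasing order with the origin of the indexing chosen so that $\lambda_n=\frac{\pi n}{2}-\frac{\widetilde\theta}{2}+O(1/n)$ as $n\to\pm\infty$, where $\widetilde\theta=\beta-\alpha+\frac12\int_{-1}^1(p+r)\,d\tau$. The functions $\{v_n\}$ are the corresponding real orthonormal eigenfunctions in $L_2([-1,1];\mathbb R^2)$, with signs chosen so that, uniformly in $x$, $v_{n,1}(x)=K_0\cos(\xi_n(x)-\alpha)+O(1/n)$ and $v_{n,2}(x)=K_0\sin(\xi_n(x)-\alpha)+O(1/n)$ as $n\to\pm\infty$, where $K_0=1/\sqrt2$ and $\xi_n(x)=\lambda_n(x+1)+\frac12\int_{-1}^x(p+r)\,d\tau$. Put $x_n:=1/\lambda_n$. Real scalars $\kappa_n^{(\pm)}$ are defined by $v_n(1)=\kappa_n^{(+)}\binom{\cos\beta}{-\sin\beta}$, $v_n(-1)=\kappa_n^{(-)}\binom{\cos\alpha}{-\sin\alpha}$. Reduced boundary values. With $\gamma_+=\beta$,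 $\gamma_-=\alpha$, for $k=0,\dots,q$, $$g_k^\pm:=-(\mathcal A^kf)_2(\pm1)\cos\gamma_\pm-(\mathcal A^kf)_1(\pm1)\sin\gamma_\pm.$$ Fourier coefficients: $c_n:=\int_{-1}^1v_n^T(x)f(x)\,dx$ for $n\in\mathbb Z$ (not to be confused with the limits $c_s$ of $n_s/N$). KEG-D system. $\widetilde g_k^\pm=\widetilde g_k^\pm(N)$, $k=0,\dots,q-1$, denote the solution of the $2q\times2q$ linear system $$c_{n_s}=x_{n_s}\sum_{k=0}^{q-1}x_{n_s}^k\bigl[\kappa_{n_s}^{(+)}\widetilde g_k^+-\kappa_{n_s}^{(-)}\widetilde g_k^-\bigr],\qquad s=1,\dots,2q$$ (where $c_{n_s}$ is the Fourier coefficient of index $n_s$). Under the hypotheses of the claim this system is uniquely solvable for all sufficiently large $N$, so the $\widetilde g_k^\pm$ are well defined for such $N$. Approximation. Let $G(x,\xi,\lambda)$ be the Green's matrix of the boundary value problem, i.e. the integral kernel of $(\mathcal A-\lambda)^{-1}$ (formally $\sum_n v_n(x)v_n(\xi)^T/(\lambda_n-\lambda)$), and $G_k(x,\xi,0)=\frac1{k!}\partial_\lambda^kG(x,\xi,\lambda)|_{\lambda=0}$. Put $\widetilde f_k(1):=\widetilde g_k^+\binom{\cos\beta}{-\sin\beta}$, $\widetilde f_k(-1):=\widetilde g_k^-\binom{\cos\alpha}{-\sin\alpha}$, $$\widetilde P(x):=\sum_{k=0}^{q-1}\bigl[G_k(x,1,0)\widetilde f_k(1)-G_k(x,-1,0)\widetilde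 f_k(-1)\bigr],$$ $\widetilde P_n:=\langle\widetilde P,v_n\rangle_{L_2}$ (by the spectral representation, $\widetilde P_n=x_n\sum_{k=0}^{q-1}x_n^k(\kappa_n^{(+)}\widetilde g_k^+-\kappa_n^{(-)}\widetilde g_k^-)$), $\widetilde F_n:=c_n-\widetilde P_n$, and $$\widetilde S_{q,N}(f):=\widetilde P(x)+\sum_{|n|\le N}\widetilde F_nv_n(x).$$ *)

(* Defs.v *)
From HB Require Import structures.
From mathcomp Require Import all_boot all_order all_algebra.
From mathcomp Require Import all_classical all_reals all_analysis.

Set Implicit Arguments.
Unset Strict Implicit.
Unset Printing Implicit Defensive.

Import Order.TTheory GRing.Theory Num.Theory.
Import numFieldNormedType.Exports.

Local Open Scope classical_set_scope.
Local Open Scope ring_scope.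

Definition I11 {R : realType} : set R := `[(-1), 1].

(* Calculus on the closed interval [-1,1]: the difference quotient is only
   taken along points of the interval, so derivatives at the end points are
   one-sided and values outside [-1,1] are irrelevant. *)
Definition diff_quot {R : realType} {V : normedModType R}
    (f : R -> V) (x t : R) : V := (t - x)^-1 *: (f t - f x).

Definition derivable_on {R : realType} {V : normedModType R}
    (f : R -> V) (x : R) : Prop := cvg (diff_quot f x @ within I11 x^').

Definition derive_on {R : realType} {V : normedModType R}
    (f : R -> V) (x : R) : V := lim (diff_quot f x @ within I11 x^').

Definition Ck {R : realType} {V : normedModType R} (k : nat) (f : R -> V)
    : Prop :=
  (forall j, (j <= k)%N -> {within I11, continuous (iter j derive_on f)}) /\
  (forall j, (j < k)%N ->
     forall x, I11 x -> derivable_on (iter j derive_on f) x).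

Definition abs_continuous {R : realType} {V : normedModType R} (f : R -> V)
    : Prop :=
  forall e : R, 0 < e -> exists2 d : R, 0 < d &
    forall (m : nat) (a b : 'I_m -> R),
      (forall i, -1 <= a i /\ a i <= b i /\ b i <= 1) ->
      (forall i j, i != j -> b i <= a j \/ b j <= a i) ->
      \sum_i (b i - a i) < d ->
      \sum_i `|f (b i) - f (a i)| < e.

Definition integral11 {R : realType} (u : R -> R) : R :=
  (\int[@lebesgue_measure R]_(x in I11) u x)%R.

Definition inner {R : realType} (u w : R -> 'cV[R]_2) : R :=
  integral11 (fun x => ((u x)^T *m w x) 0 0).

Definition L2norm {R : realType} (u : R -> 'cV[R]_2) : R :=
  Num.sqrt (inner u u).

Definition Jmx {R : realType} : 'M[R]_2 :=
  \matrix_(i < 2, j < 2) ((i < j)%N%:R - (j < i)%N%:R).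

Definition Qmx {R : realType} (p r : R -> R) (x : R) : 'M[R]_2 :=
  diag_mx (\row_(i < 2) if i == 0 then p x else r x).

Definition dirac_op {R : realType} (p r : R -> R) (y : R -> 'cV[R]_2)
    : R -> 'cV[R]_2 :=
  fun x => Jmx *m derive_on y x - Qmx p r x *m y x.

Definition bdir {R : realType} (gamma : R) : 'cV[R]_2 :=
  \col_(i < 2) if i == 0 then cos gamma else - sin gamma.

Definition bform {R : realType} (gamma : R) (z : 'cV[R]_2) : R :=
  z 1 0 * cos gamma + z 0 0 * sin gamma.

(* As p and r are continuous, every absolutely continuous solution of
   (A - l) y = h with h continuous is C^1, so C^1 functions suffice. *)
Definition in_domain {R : realType} (alpha beta : R) (y : R -> 'cV[R]_2)
    : Prop :=
  [/\ Ck 1 y, bform alpha (y (-1)) = 0 & bform beta (y 1) = 0].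

Definition dirac_eigenfunction {R : realType} (alpha beta : R) (p r : R -> R)
    (l : R) (y : R -> 'cV[R]_2) : Prop :=
  [/\ in_domain alpha beta y,
      (exists2 x, I11 x & y x != 0) &
      forall x, I11 x -> dirac_op p r y x = l *: y x].

Definition dirac_eigenvalue {R : realType} (alpha beta : R) (p r : R -> R)
    (l : R) : Prop := exists y, dirac_eigenfunction alpha beta p r l y.

(* u n t = O(1/n) as n -> +oo and n -> -oo, uniformly in t in D *)
Definition unif_O_inv {R : realType} {T : Type} (D : set T)
    (u : int -> T -> R) : Prop :=
  exists (C : R) (M : nat), forall n : int, (M < `|n|)%N ->
    forall t, D t -> `|u n t| <= C / `|n%:~R|.

Definition half_int {R : realType} (p r : R -> R) (x : R) : R :=
  2^-1 * (\int[@lebesgue_measure R]_(t in `[(-1), x]) (p t + r t))%R.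

Definition theta {R : realType} (alpha beta : R) (p r : R -> R) : R :=
  beta - alpha + half_int p r 1.

Definition xi {R : realType} (p r : R -> R) (l : R) (x : R) : R :=
  l * (x + 1) + half_int p r x.

Definition K0 {R : realType} : R := (Num.sqrt 2)^-1.

Definition eigenvalue_enum {R : realType} (alpha beta : R) (p r : R -> R)
    (lam : int -> R) : Prop :=
  [/\ {homo lam : m n / m < n},
      (forall l, dirac_eigenvalue alpha beta p r l <-> exists n, lam n = l) &
      unif_O_inv [set: unit]
        (fun n _ => lam n - (pi * n%:~R / 2 - theta alpha beta p r / 2))].

Definition eigenfunction_system {R : realType} (alpha beta : R) (p r : R -> R)
    (lam : int -> R) (v : int -> R -> 'cV[R]_2) : Prop :=
  [/\ (forall n, dirac_eigenfunction alpha beta p r (lam n) (v n)),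
      (forall m n, inner (v m) (v n) = (m == n)%:R),
      unif_O_inv I11
        (fun n x => v n x 0 0 - K0 * cos (xi p r (lam n) x - alpha)) &
      unif_O_inv I11
        (fun n x => v n x 1 0 - K0 * sin (xi p r (lam n) x - alpha))].

(* g_k at the end point e, where gamma is the angle of the condition at e *)
Definition bvalue {R : realType} (p r : R -> R) (f : R -> 'cV[R]_2)
    (gamma e : R) (k : nat) : R :=
  - iter k (dirac_op p r) f e 1 0 * cos gamma
  - iter k (dirac_op p r) f e 0 0 * sin gamma.

(* G l x s is the kernel G(x,s,l) of (A - l)^-1 for each l off the spectrum.
   Continuity in s != x fixes the values at s = 1 and s = -1, which an
   integral kernel alone would leave undetermined. *)
Definition green_matrix {R : realType} (alpha beta : R) (p r : R -> R)
    (G : R -> R -> R -> 'M[R]_2) : Prop :=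
  forall l, ~ dirac_eigenvalue alpha beta p r l ->
  [/\ (forall x, I11 x -> {within I11 `\ x, continuous (G l x)}),
      (forall x, I11 x -> forall i j,
         (@lebesgue_measure R).-integrable I11 (fun s => (G l x s i j)%:E)) &
      forall h : R -> 'cV[R]_2, {within I11, continuous h} ->
        let y x := \col_i integral11 (fun s => (G l x s *m h s) i 0) in
        in_domain alpha beta y /\
        (forall x, I11 x -> dirac_op p r y x - l *: y x = h x)].

Definition green_coef {R : realType} (G : R -> R -> R -> 'M[R]_2)
    (k : nat) (x s : R) : 'M[R]_2 :=
  (k`!%:R)^-1 *: derive1n k (fun l => G l x s) 0.

Definition keg_system {R : realType} (q : nat) (lam : int -> R)
    (v : int -> R -> 'cV[R]_2) (kp km : int -> R) (f : R -> 'cV[R]_2)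
    (n : 'I_(2 * q) -> int) : set ('rV[R]_q * 'rV[R]_q) :=
  [set g : 'rV[R]_q * 'rV[R]_q | forall s, inner (v (n s)) f =
     (lam (n s))^-1 * \sum_(k < q)
       (lam (n s))^-1 ^+ k * (kp (n s) * g.1 0 k - km (n s) * g.2 0 k)].

(* the pair (g~^+, g~^-); a junk value if the system has no solution *)
Definition keg_solution {R : realType} (q : nat) (lam : int -> R)
    (v : int -> R -> 'cV[R]_2) (kp km : int -> R) (f : R -> 'cV[R]_2)
    (n : 'I_(2 * q) -> int) : 'rV[R]_q * 'rV[R]_q :=
  xget (0, 0) (keg_system lam v kp km f n).

Definition Ptilde {R : realType} (q : nat) (alpha beta : R)
    (G : R -> R -> R -> 'M[R]_2) (g : 'rV[R]_q * 'rV[R]_q) (x : R)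
    : 'cV[R]_2 :=
  \sum_(k < q) (green_coef G k x 1 *m (g.1 0 k *: bdir beta)
              - green_coef G k x (-1) *m (g.2 0 k *: bdir alpha)).

(* the summation index m stands for n = m - N, so that |n| <= N *)
Definition keg_approx {R : realType} (q : nat) (alpha beta : R)
    (v : int -> R -> 'cV[R]_2) (G : R -> R -> R -> 'M[R]_2)
    (f : R -> 'cV[R]_2) (g : 'rV[R]_q * 'rV[R]_q) (N : nat) (x : R)
    : 'cV[R]_2 :=
  let P := Ptilde alpha beta G g in
  let F n := inner (v n) f - inner P (v n) in
  P x + \sum_(0 <= m < (2 * N).+1) F (m%:Z - N%:Z) *: v (m%:Z - N%:Z) x.

Definition keg_error {R : realType} (q : nat) (alpha beta : R)
    (lam : int -> R) (v : int -> R -> 'cV[R]_2) (kp km : int -> R)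
    (G : R -> R -> R -> 'M[R]_2) (f : R -> 'cV[R]_2)
    (n : 'I_(2 * q) -> int) (N : nat) (x : R) : 'cV[R]_2 :=
  f x - keg_approx alpha beta v G f (keg_solution lam v kp km f n) N x.

Definition Jint {R : realType} (q : nat) (c : 'I_(2 * q) -> R)
    (S : {set 'I_(2 * q)}) : R :=
  integral11 (fun x => \prod_(s in S) (x - (c s)^-1) ^+ 2).

(* Main.v *)
Require Import Defs.
From HB Require Import structures.
From mathcomp Require Import all_boot all_order all_algebra.
From mathcomp Require Import all_classical all_reals all_analysis.
From mathcomp Require Import measurable_realfun.
From mathcomp Require Import ring lra zify.

Set Implicit Arguments.
Unset Strict Implicit.
Unset Printing Implicit Defensive.

Import Order.TTheory GRing.Theory Num.Theory.
Import numFieldNormedType.Exports.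

Local Open Scope classical_set_scope.
Local Open Scope ring_scope.

(** The error of the method is the Fourier remainder of a corrected function.
Away from the end points, Ptilde is a combination Pfun of solutions of the
homogeneous Dirac equation and of their images under powers of the solution
operator, and its coefficients are
  x_n * sum_(k < q) x_n ^ k * (kappa_n^+ * g~_k^+ - kappa_n^- * g~_k^-),
with x_n = 1 / lambda_n. Hence f - Ptilde - (its coefficients up to N) is the
tail of the eigenfunction expansion of the C^1 function f - Pfun, and
Parseval's identity turns the squared norm into the sum of F_n ^ 2 over
|n| > N, where F_n = c_n - P~_n.

Repeated integration by parts gives c_n the same shape with q + 1 terms: the
exact boundary values g_k in place of g~_k, an extra term k = q, and a remainder
o(x_n ^ (q+1)) (coef_expand). For that remainder a Riemann-Lebesgue lemma for
lambda_n <v_n, h> with h merely absolutely continuous is needed; it rests on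
AC_stieltjes, an integration by parts in which the increments of h are compared
with those of a piecewise linear interpolant.

Subtracting the linear system from the expansion at n = n_s and multiplying by
N ^ q leaves a system for the scaled defects N ^ (q - k) * (g_k - g~_k), whose
nodes N * x_(n_s) tend to 2 / (pi c_s). As kappa_n^- tends to K0 and kappa_n^+
to K0 for even n and -K0 for odd n, the limit system splits into one for the
differences (rows E) and one for the sums (rows O) of the defects, each a
Vandermonde system with q distinct nodes. So the solutions converge, and the
polynomials formed with the limits and the known leading coefficients A + B and
A - B are multiples of the product of the x - 2 / (pi c_s), s in E or O
(block_cvg, monic_interp, keg_defect).

Consequently, with u = N / n, the square of N ^ (q+1) * F_n is u ^ 2 times a
quantity uniformly close on |n| > N to a polynomial in u that depends only on
the parity of n. The tail sum divided by N is a Riemann sum, with the points N/n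
of one parity at distance about 2 u ^ 2 / N, and tends to half the integral of
that polynomial over [-1,1] (tail_sum_limit).

Completeness of the eigenfunctions is proved from the solution operator T of
the boundary value problem at 0: on the orthogonal complement of the v_n with
|n| <= N its norm is at most 1 / inf |lambda_n| over |n| > N (T_gap), so Fourier
remainders of functions in the range of T tend to 0, and a C^1 function is
within any distance of that range. The derivatives of the Green matrix at the
end points are found from the power series of the resolvent applied to a source
that concentrates at an end point (integral11_delta, zsol_expand). *)

(** * One-sided calculus on [-1,1] *)

Section Calculus.
Context {R : realType}.
Implicit Types (u v w U : R -> R) (x a b c : R).

Definition C0 u := {within (@I11 R), continuous u}.
(** Differentiation as a relation between functions rather than through the
    operator derive_on: rules for sums and products become closure properties,
    and values outside the interval never matter. *)
Definition HD u u' := forall x, I11 x -> diff_quot u x @ within I11 x^' --> u' x.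

Lemma I11P x : I11 x <-> -1 <= x <= 1.
Proof. by rewrite /I11 /= in_itv. Qed.

Lemma I11_1 : I11 (1 : R). Proof. by apply/I11P; rewrite lexx; lra. Qed.
Lemma I11_N1 : I11 (-1 : R). Proof. by apply/I11P; rewrite lexx; lra. Qed.

Lemma C0P u : C0 u <-> forall x, I11 x -> u @ within I11 (nbhs x) --> u x.
Proof. exact: (@subspace_continuousP). Qed.

Lemma I11_dnbhs_proper x : I11 x -> ProperFilter (within I11 x^').
Proof.
move=> /I11P xI; apply: Build_ProperFilter_ex => A /=.
rewrite /within /= => -[e /= e0 H].
have [x0|x0] := leP x 0.
- exists (x + Num.min (e / 2) 1).
  have m0 : 0 < Num.min (e / 2) 1 :> R by rewrite lt_min ltr01 divr_gt0.
  have m1 : Num.min (e / 2) 1 <= 1 :> R by rewrite ge_min lexx orbT.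
  have me : Num.min (e / 2) 1 <= e / 2 :> R by rewrite ge_min lexx.
  apply: H => /=; last by apply/I11P; lra.
    rewrite opprD addNKr normrN gtr0_norm //; lra.
  by rewrite gt_eqF // ltrDl.
- exists (x - Num.min (e / 2) 1).
  have m0 : 0 < Num.min (e / 2) 1 :> R by rewrite lt_min ltr01 divr_gt0.
  have m1 : Num.min (e / 2) 1 <= 1 :> R by rewrite ge_min lexx orbT.
  have me : Num.min (e / 2) 1 <= e / 2 :> R by rewrite ge_min lexx.
  apply: H => /=; last by apply/I11P; lra.
    rewrite opprB addrC subrK gtr0_norm //; lra.
  by rewrite lt_eqF // gtrDl oppr_lt0.
Qed.

(** The punctured relative neighbourhoods of a point of a nondegenerate
    interval form a proper filter, so limits are unique and HD determines
    derive_on. *)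
Lemma HD_eq_derive_on u u' x : HD u u' -> I11 x -> derive_on u x = u' x.
Proof.
move=> Hu xI; rewrite /derive_on; apply: cvg_lim => //; last exact: Hu.
by have := I11_dnbhs_proper xI.
Qed.

Lemma HD_ext u v u' v' : HD u u' -> (forall x, I11 x -> u x = v x) ->
  (forall x, I11 x -> u' x = v' x) -> HD v v'.
Proof.
move=> H uv uv' x xI; rewrite -uv' //.
apply: cvg_trans (H x xI).
apply: near_eq_cvg; near=> t.
rewrite /diff_quot !uv //.
by near: t; exact: withinT.
Unshelve. all: by end_near. Qed.

Lemma C0_ext u v : C0 u -> (forall x, I11 x -> u x = v x) -> C0 v.
Proof.
move=> /C0P H uv; apply/C0P => x xI; rewrite -uv //.
apply: cvg_trans (H x xI); apply: near_eq_cvg; near=> t.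
by rewrite uv //; near: t; exact: withinT.
Unshelve. all: by end_near. Qed.

Lemma C0D u v : C0 u -> C0 v -> C0 (fun x => u x + v x).
Proof. by move=> /C0P Hu /C0P Hv; apply/C0P => x xI; apply: cvgD; auto. Qed.
Lemma C0M u v : C0 u -> C0 v -> C0 (fun x => u x * v x).
Proof. by move=> /C0P Hu /C0P Hv; apply/C0P => x xI; apply: cvgM; auto. Qed.
Lemma C0c c : C0 (fun=> c).
Proof. by apply/C0P => x xI; apply: cvg_cst. Qed.
Lemma C0_cont u : continuous u -> C0 u.
Proof. by move=> Hu; apply/C0P => x xI; apply: cvg_within_filter; apply: Hu. Qed.
Lemma C0N u : C0 u -> C0 (fun x => - u x).
Proof. by move=> /C0P Hu; apply/C0P => x xI; apply: cvgN; auto. Qed.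
Lemma C0B u v : C0 u -> C0 v -> C0 (fun x => u x - v x).
Proof. by move=> Hu Hv; apply: C0D => //; apply: C0N. Qed.

Lemma HD_C0 u u' : HD u u' -> C0 u.
Proof.
move=> Hu; apply/C0P => x xI.
have Hx := Hu x xI.
have idc : (fun t : R => t - x) @ within I11 x^' --> 0.
  rewrite -(subrr x); apply: cvgB; last exact: cvg_cst.
  apply: cvg_within_filter; apply: cvg_within.
have H1 : u @ within I11 x^' --> u x.
  have : (fun t => (t - x) * diff_quot u x t + u x) @ within I11 x^' --> 0 * u' x + u x.
    by apply: cvgD; [apply: cvgM | apply: cvg_cst].
  rewrite mul0r add0r; apply: cvg_trans; apply: near_eq_cvg; near=> t.
  rewrite /diff_quot /GRing.scale /= mulrA divff ?mul1r ?subrK //.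
  rewrite subr_eq0; near: t; rewrite /within /=.
  by apply: filterS (@nbhs_dnbhs_neq _ x) => t; auto.
move=> A /[dup] /nbhs_singleton Ax /H1 H.
apply: (@filterS _ (nbhs x) _ _ _ _ H) => t /= Ht tI.
have [->//|tx] := eqVneq t x.
exact: Ht.
Unshelve. all: by end_near. Qed.

Lemma HDD u v u' v' : HD u u' -> HD v v' ->
  HD (fun x => u x + v x) (fun x => u' x + v' x).
Proof.
move=> Hu Hv x xI.
rewrite (_ : diff_quot _ _ = fun t => diff_quot u x t + diff_quot v x t).
  by apply: cvgD; [exact: Hu|exact: Hv].
by apply/funext => t; rewrite /diff_quot -scalerDr; congr (_ *: _); ring.
Qed.

Lemma HDM u v u' v' : HD u u' -> HD v v' ->
  HD (fun x => u x * v x) (fun x => u' x * v x + u x * v' x).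
Proof.
move=> Hu Hv x xI.
rewrite (_ : diff_quot _ _ = fun t => diff_quot u x t * v t + u x * diff_quot v x t).
  apply: cvgD.
    apply: cvgM; [exact: Hu|].
    have /C0P/(_ x xI) := HD_C0 Hv; apply: cvg_trans.
    move=> A HA; apply: (@filterS _ (nbhs x) _ _ _ _ HA) => t /=; auto.
  by apply: cvgM; [exact: cvg_cst|exact: Hv].
by apply/funext => t; rewrite /diff_quot /GRing.scale /=; ring.
Qed.

Lemma HDc c : HD (fun=> c) (fun=> 0).
Proof.
move=> x xI; rewrite (_ : diff_quot _ _ = fun=> 0); first exact: cvg_cst.
by apply/funext => t; rewrite /diff_quot subrr scaler0.
Qed.

Lemma HDid : HD id (fun=> 1).
Proof.
move=> x xI; apply: (@cvg_trans _ ((fun=> 1 : R) @ within I11 x^')); last exact: cvg_cst.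
apply: near_eq_cvg; near=> t.
rewrite /diff_quot /GRing.scale /= mulVf // subr_eq0.
near: t; rewrite /within /=.
by apply: filterS (@nbhs_dnbhs_neq _ x) => t; auto.
Unshelve. all: by end_near. Qed.

Lemma HDZ c u u' : HD u u' -> HD (fun x => c * u x) (fun x => c * u' x).
Proof.
move=> Hu; apply: (HD_ext (HDM (HDc c) Hu)) => // x xI; by rewrite mul0r add0r.
Qed.
Arguments HDZ c {u u'}.
Arguments HDc c : clear implicits.
Lemma HDN u u' : HD u u' -> HD (fun x => - u x) (fun x => - u' x).
Proof. move=> Hu; refine (HD_ext (HDZ (-1) Hu) _ _) => x xI; by rewrite mulN1r. Qed.
Lemma HDB u v u' v' : HD u u' -> HD v v' ->
  HD (fun x => u x - v x) (fun x => u' x - v' x).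
Proof. by move=> Hu Hv; apply: HDD => //; apply: HDN. Qed.

(** Bridge from two-sided derivatives, used for exp and trigonometric
    functions. *)
Lemma HD_is_derive u u' : (forall x, I11 x -> is_derive x 1 u (u' x)) -> HD u u'.
Proof.
move=> H x xI; have [/cvg_ex[l Hl] Hd] := H x xI.
have {Hd}l' : l = u' x by rewrite -Hd; apply/esym/cvg_lim.
rewrite {}l' in Hl.
have sh : (fun t : R => t - x) @ within I11 x^' --> 0^'.
  move=> A [e /= e0 HA]; exists e => //= t /= Ht tx _; apply: HA => /=.
    by rewrite sub0r normrN distrC.
  by rewrite subr_eq0.
move: Hl => /(cvg_comp _ _ sh); apply: cvg_trans.
apply: near_eq_cvg; near=> t.
by rewrite /diff_quot /=  /GRing.scale /= mulr1 subrK.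
Unshelve. all: by end_near. Qed.

Lemma HD_derivable u u' x : HD u u' -> -1 < x < 1 -> is_derive x 1 u (u' x).
Proof.
move=> H xI.
have /H Hx : I11 x by apply/I11P; lra.
have Hc : (fun h => h^-1 *: (u (h *: 1 + x) - u x)) @ 0^' --> u' x.
  have sh : (fun t : R => t + x) @ 0^' --> within I11 x^'.
    move=> A [e /= e0 HA].
    exists (Num.min e (Num.min (1 - x) (x + 1))) => /=.
      by rewrite !lt_min e0 /=; lra.
    move=> t /=; rewrite sub0r normrN !lt_min => /and3P[te t1 t2] t0.
    have := ler_norm t; have := ler_norm (- t); rewrite normrN => h1 h2.
    apply: HA => /=.
    - by rewrite opprD addrCA subrr addr0 normrN.
    - by rewrite -subr_eq0 addrK.
    - by apply/I11P; lra.
  move: Hx => /(cvg_comp _ _ sh); apply: cvg_trans; apply: near_eq_cvg; near=> t.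
  by rewrite /diff_quot /=  /GRing.scale /= mulr1 addrK.
apply: DeriveDef; first by apply/cvg_ex; exists (u' x); exact: Hc.
by apply: cvg_lim.
Unshelve. all: by end_near. Qed.

Lemma C0_sub u a b : -1 <= a -> b <= 1 -> C0 u -> {within `[a, b], continuous u}.
Proof.
move=> a1 b1; apply: continuous_subspaceW => x; rewrite /= in_itv /= => xI; apply/I11P; lra.
Qed.

Lemma HD_MVT u u' a b : HD u u' -> -1 <= a -> a <= b -> b <= 1 ->
  exists2 c : R, a <= c <= b & u b - u a = u' c * (b - a).
Proof.
move=> H a1 ab b1.
have [c] : exists2 c : R, c \in `[a, b] & u b - u a = u' c * (b - a).
  apply: MVT_segment => //.
    move=> x; rewrite in_itv /= => xI; apply: HD_derivable => //; lra.
  by apply: C0_sub => //; apply: HD_C0 H.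
by rewrite in_itv /= => cI E; exists c.
Qed.

Lemma HD_le u u' a b : HD u u' -> (forall x, I11 x -> 0 <= u' x) ->
  -1 <= a -> a <= b -> b <= 1 -> u a <= u b.
Proof.
move=> H Hp a1 ab b1; have [c cI E] := HD_MVT H a1 ab b1.
rewrite -subr_ge0 E mulr_ge0 ?subr_ge0 //; apply/Hp/I11P; lra.
Qed.

Lemma HD_lip u u' a b M : HD u u' -> (forall x, a <= x <= b -> `|u' x| <= M) ->
  -1 <= a -> a <= b -> b <= 1 -> `|u b - u a| <= M * (b - a).
Proof.
move=> H Hp a1 ab b1; have [c cI E] := HD_MVT H a1 ab b1.
by rewrite E normrM (ger0_norm (_ : 0 <= b - a)) ?subr_ge0 // ler_wpM2r ?subr_ge0 ?Hp.
Qed.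

(** Composition with the projection of the line onto [-1,1] extends a function
    continuous on the interval to the whole line, where the fundamental theorem
    of calculus applies. *)
Definition clamp x : R := Num.max (-1) (Num.min 1 x).
Lemma clampI x : I11 (clamp x).
Proof.
apply/I11P; rewrite /clamp le_max lexx /= ge_max ge_min lexx /= andbT; lra.
Qed.
Lemma clamp_id x : I11 x -> clamp x = x.
Proof. by move=> /I11P /andP[x1 x2]; rewrite /clamp min_r // max_r. Qed.
Lemma clamp_lip x y : `|clamp x - clamp y| <= `|x - y|.
Proof.
rewrite /clamp; case: (leP 1 x) => hx; case: (leP 1 y) => hy;
 rewrite ?(max_r (_ : -1 <= 1)) //; try lra;
 try (case: (leP (-1) x) => hx1); try (case: (leP (-1) y) => hy1);
 rewrite ler_norml; have := ler_norm (x - y); have := ler_norm (- (x - y)); 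
 rewrite normrN; lra.
Qed.
Lemma clamp_cont u : C0 u -> continuous (u \o clamp).
Proof.
move=> /C0P Hu x; apply: cvg_comp (Hu _ (clampI x)) => A /=.
rewrite /within /= => -[e /= e0 HA].
exists e => //= t /= Ht; apply: HA => /=; last exact: clampI.
exact: le_lt_trans (clamp_lip _ _) Ht.
Qed.

Lemma C0_integrable u : C0 u -> (@lebesgue_measure R).-integrable I11 (EFin \o u).
Proof.
by move=> Hu; apply: continuous_compact_integrable => //; apply: segment_compact.
Qed.

Lemma C0_primitive u : C0 u -> exists U, HD U u.
Proof.
move=> Hu; have Hc := clamp_cont Hu.
have Hi : (@lebesgue_measure R).-integrable `[-2, 2] (EFin \o (u \o clamp)).
  apply: continuous_compact_integrable; first exact: segment_compact.
  exact: continuous_subspaceT.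
exists (fun x => (\int[@lebesgue_measure R]_(t in `[-2, x]) (u \o clamp) t)%R).
apply: HD_is_derive => x /[dup] xI /I11P xI'.
have [||h1 h2] := continuous_FTC1_closed (_ : x < 2) Hi _ (Hc x); try lra.
apply: DeriveDef => //; rewrite -derive1E h2 /= clamp_id //.
Qed.

Lemma ltN11 : -1 < 1 :> R. Proof. lra. Qed.

Lemma integral11_HD U u : HD U u -> C0 u -> integral11 u = U 1 - U (-1).
Proof.
move=> H Hu; rewrite /integral11 /Rintegral (continuous_FTC2 (F := U)) //.
- have /HD_C0/C0P HU := H.
  split.
  + by move=> x; rewrite in_itv /= => xI; have [] := HD_derivable H xI.
  + move/C0_sub : (HD_C0 H) => /(_ (-1) 1 (lexx _) (lexx _)).
    by move=> /(continuous_within_itvP _ ltN11)[].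
  + move/C0_sub : (HD_C0 H) => /(_ (-1) 1 (lexx _) (lexx _)).
    by move=> /(continuous_within_itvP _ ltN11)[].
- move=> x; rewrite in_itv /= => xI; have [_ <-] := HD_derivable H xI.
  by rewrite derive1E.
Qed.

Lemma C0_bounded u : C0 u -> exists2 M : R, 0 < M & forall x, I11 x -> `|u x| <= M.
Proof.
move=> Hu; have Hc : {within `[(-1) : R, 1], continuous (fun x => `|u x|)}.
  move=> x; apply: continuous_comp; [exact: Hu|exact: norm_continuous].
have [c _ Hmax] := EVT_max (ltW ltN11) Hc.
exists (`|u c| + 1) => [|x xI]; first by rewrite ltr_wpDl.
by apply: ler_wpDr => //; apply: Hmax; rewrite in_itv /=; exact/I11P.
Qed.

Lemma integrableM_C0 (g h : R -> R) :
  (@lebesgue_measure R).-integrable I11 (EFin \o g) -> C0 h ->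
  (@lebesgue_measure R).-integrable I11 (EFin \o (fun s => g s * h s)).
Proof.
move=> Ig Ch; have [Mh Mh0 HMh] := C0_bounded Ch.
have mI : measurable (I11 : set (measurableTypeR R)) by exact: measurable_itv.
have := integrableMl mI Ig (_ : measurable_fun I11 h) _; apply.
  by apply/measurable_EFinP; exact: (measurable_int _ (C0_integrable Ch)).
exists Mh; split; first exact: num_real.
by move=> y yM s sI; apply: le_trans (HMh s sI) (ltW yM).
Qed.

Lemma integral11_ext u v : (forall x, I11 x -> u x = v x) ->
  integral11 u = integral11 v.
Proof. by move=> uv; apply: eq_Rintegral => x; rewrite inE; exact: uv. Qed.

Lemma integral11D u v : C0 u -> C0 v ->
  integral11 (fun x => u x + v x) = integral11 u + integral11 v.
Proof.
move=> /[dup] Cu /C0_primitive[U HU] /[dup] Cv /C0_primitive[V HV].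
rewrite (integral11_HD HU) // (integral11_HD HV) // (integral11_HD (HDD HU HV)).
  by ring.
exact: C0D.
Qed.

Lemma integral11Z c u : C0 u ->
  integral11 (fun x => c * u x) = c * integral11 u.
Proof.
move=> /[dup] Cu /C0_primitive[U HU].
rewrite (integral11_HD HU) // (integral11_HD (HDZ c HU)); first by ring.
by apply: C0M => //; apply: C0c.
Qed.

Lemma integral11B u v : C0 u -> C0 v ->
  integral11 (fun x => u x - v x) = integral11 u - integral11 v.
Proof.
move=> /[dup] Cu /C0_primitive[U HU] /[dup] Cv /C0_primitive[V HV].
rewrite (integral11_HD HU) // (integral11_HD HV) // (integral11_HD (HDB HU HV)).
  by ring.
exact: C0B.
Qed.

Lemma integral11_ge0 u : (forall x, I11 x -> 0 <= u x) -> 0 <= integral11 u.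
Proof. by move=> H; apply: Rintegral_ge0 => x; exact: H. Qed.

Lemma integral11_le u v : C0 u -> C0 v -> (forall x, I11 x -> u x <= v x) ->
  integral11 u <= integral11 v.
Proof.
move=> Cu Cv H; rewrite -subr_ge0 -integral11B //.
by apply: integral11_ge0 => x xI; rewrite subr_ge0 H.
Qed.

Lemma integral11c c : integral11 (fun=> c) = 2 * c.
Proof.
have H : HD (fun x => c * x) (fun x => c * 1) := HDZ c HDid.
rewrite (@integral11_ext _ (fun x => c * 1)); last by move=> *; rewrite mulr1.
by rewrite (integral11_HD H); [ring|exact: C0c].
Qed.

End Calculus.
Arguments HDZ {R} c {u u'}.
Arguments HDc {R} c.
Arguments C0c {R} c.

(** * Vector functions, C^k and absolute continuity *)

Section Vectors.
Context {R : realType}.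

Lemma cvg_mx {T : Type} (F : set_system T) {FF : Filter F} (m n : nat)
  (y : T -> 'M[R]_(m, n)) (l : 'M[R]_(m, n)) :
  y @ F --> l <-> forall i j, (fun t => y t i j) @ F --> l i j.
Proof.
split=> [H i j|H].
  apply: (@cvg_comp _ _ _ y (fun M => M i j) F (nbhs l) _ H); exact: coord_continuous.
apply/cvg_ballP => e e0.
have : \forall t \near F, forall i j, ball (l i j) e (y t i j).
  apply: filter_forall => i; apply: filter_forall => j.
  by move/cvg_ballP : (H i j) => /(_ e e0).
by apply: filterS => t Ht; split.
Qed.

Lemma I2P (P : 'I_2 -> Prop) : P 0 -> P 1 -> forall i, P i.
Proof.
by move=> P0 P1 [[|[|//]] hi]; [have -> : Ordinal hi = 0 | have -> : Ordinal hi = 1];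
  first [exact/val_inj | done].
Qed.

Lemma col2P (a b : 'cV[R]_2) : a 0 0 = b 0 0 -> a 1 0 = b 1 0 -> a = b.
Proof. by move=> h0 h1; apply/colP; apply: I2P. Qed.

Implicit Types (y z h : R -> 'cV[R]_2).

Definition VC y := C0 (fun x => y x 0 0) /\ C0 (fun x => y x 1 0).

Lemma VC_within y : VC y <-> {within I11, continuous y}.
Proof.
split=> [[/C0P H0 /C0P H1]|/subspace_continuousP H].
  apply/subspace_continuousP => x xI; apply/cvg_mx.
  by apply: I2P => j; rewrite (ord1 j); auto.
by split; apply/C0P => x /H /cvg_mx.
Qed.

Definition VHD y y' := HD (fun x => y x 0 0) (fun x => y' x 0 0) /\
  HD (fun x => y x 1 0) (fun x => y' x 1 0).

Lemma diff_quot_coord y x t i :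
  diff_quot y x t i 0 = diff_quot (fun s => y s i 0) x t.
Proof. by rewrite /diff_quot !mxE. Qed.

(** Convergence in a space of columns is entrywise, which reduces vector
    derivatives to scalar ones. *)
Lemma VHD_cvg y y' : VHD y y' <-> forall x, I11 x -> diff_quot y x @ within I11 x^' --> y' x.
Proof.
split=> [[H0 H1] x xI|H].
  apply/cvg_mx; apply: I2P => j; rewrite (ord1 j).
    by under eq_fun do rewrite diff_quot_coord; exact: H0.
  by under eq_fun do rewrite diff_quot_coord; exact: H1.
split=> x /H /cvg_mx Hx.
  by have := Hx 0 0; under eq_fun do rewrite diff_quot_coord.
by have := Hx 1 0; under eq_fun do rewrite diff_quot_coord.
Qed.

Lemma VHD_eq_derive_on y y' x : VHD y y' -> I11 x -> derive_on y x = y' x.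
Proof.
move=> /VHD_cvg Hu xI; rewrite /derive_on; apply: cvg_lim => //; last exact: Hu.
by have := I11_dnbhs_proper xI.
Qed.

Lemma derivable_VHD y : (forall x, I11 x -> derivable_on y x) <-> VHD y (derive_on y).
Proof.
split=> [H|/VHD_cvg H x xI]; last by apply/cvg_ex; eexists; exact: H.
by apply/VHD_cvg => x xI; apply: H.
Qed.

Lemma derivable_HD (u : R -> R) :
  (forall x, I11 x -> derivable_on u x) <-> HD u (derive_on u).
Proof.
split=> [H x xI|H x xI]; last by apply/cvg_ex; eexists; exact: H.
exact: H.
Qed.

Lemma VHD_VC y y' : VHD y y' -> VC y.
Proof. by move=> [/HD_C0 ? /HD_C0]. Qed.

Lemma Ck1P y : Ck 1 y <-> exists2 y', VHD y y' & VC y'.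
Proof.
split=> [[H1 H2]|[y' Hy Cy]].
  exists (derive_on y); last exact/VC_within/(H1 1).
  by apply/derivable_VHD; exact: (H2 0).
have E x : I11 x -> derive_on y x = y' x by exact: VHD_eq_derive_on.
split=> [[|[|//]] _|[|//] _]; first exact/VC_within/(VHD_VC Hy).
  by apply/VC_within; split; [apply: (C0_ext Cy.1) | apply: (C0_ext Cy.2)] => x xI;
   rewrite /= E.
move=> x xI; apply: (iffRL (derivable_VHD y)) => //.
by split; [apply: (HD_ext Hy.1) | apply: (HD_ext Hy.2)] => // t tI; rewrite E.
Qed.

Section Generic.
Context {V : normedModType R}.
Implicit Types (f g : R -> V).

Lemma diff_quot_ext f g x : (forall t, I11 t -> f t = g t) -> I11 x ->
  diff_quot f x @ within I11 x^' = diff_quot g x @ within I11 x^'.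
Proof.
move=> fg xI; apply/seteqP; split=> A; apply: near_eq_cvg; near=> t;
 rewrite /diff_quot !fg //; near: t; exact: withinT.
Unshelve. all: by end_near. Qed.

Lemma derive_on_ext f g x : (forall t, I11 t -> f t = g t) -> I11 x ->
  derive_on f x = derive_on g x.
Proof. by move=> fg xI; rewrite /derive_on (diff_quot_ext fg). Qed.

Lemma derivable_on_ext f g x : (forall t, I11 t -> f t = g t) -> I11 x ->
  derivable_on f x -> derivable_on g x.
Proof. by move=> fg xI; rewrite /derivable_on (diff_quot_ext fg). Qed.

Lemma iter_derive_on_ext f g k x : (forall t, I11 t -> f t = g t) -> I11 x ->
  iter k derive_on f x = iter k derive_on g x.
Proof.
by move=> fg; elim: k x => [|k IH] x xI; [exact: fg|exact: derive_on_ext].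
Qed.

Lemma within_ext f g : (forall t, I11 t -> f t = g t) ->
  {within I11, continuous f} -> {within I11, continuous g}.
Proof.
move=> fg /subspace_continuousP H; apply/subspace_continuousP => x xI.
rewrite /from_subspace -fg //; apply: cvg_trans (H x xI); apply: near_eq_cvg; near=> t.
by rewrite /from_subspace fg //; near: t; exact: withinT.
Unshelve. all: by end_near. Qed.

Lemma Ck_ext k f g : Ck k f -> (forall t, I11 t -> f t = g t) -> Ck k g.
Proof.
move=> [H1 H2] fg; split=> j jk.
  by apply: within_ext (H1 j jk) => x xI; exact: iter_derive_on_ext.
by move=> x xI; apply: derivable_on_ext (H2 j jk x xI) => // t tI; exact: iter_derive_on_ext.
Qed.

Lemma CkS k f : Ck k.+1 f <->
  [/\ forall x, I11 x -> derivable_on f x, {within I11, continuous f}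
    & Ck k (derive_on f)].
Proof.
split=> [[H1 H2]|[H1 H2 [H3 H4]]].
  split; [exact: (H2 0)|exact: (H1 0)|split=> j jk; rewrite -iterSr].
    exact: H1.
  exact: H2.
by split=> -[|j] jk //; rewrite iterSr; [exact: H3|exact: H4].
Qed.

Lemma Ck_le j k f : (j <= k)%N -> Ck k f -> Ck j f.
Proof.
move=> jk [H1 H2]; split=> i ij; [apply: H1|apply: H2]; lia.
Qed.

End Generic.

Implicit Types (u v w : R -> R).

Lemma Ck0 u : Ck 0 u <-> C0 u.
Proof. by split=> [[H _]|H]; [exact: (H 0)|split=> // -[]]. Qed.

(** The recursive reading of C^k through HD, by which closure properties follow
    by induction. *)
Lemma CkSP k u : Ck k.+1 u <-> exists2 u', HD u u' & Ck k u'.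
Proof.
split=> [/CkS[/derivable_HD H1 H2 H3]|[u' H1 H2]]; first by exists (derive_on u).
apply/CkS; split; [|exact: HD_C0 H1|].
  move=> x xI; apply: (iffRL (derivable_HD u)) => // t tI.
  by rewrite (HD_eq_derive_on H1) //; exact: H1.
by apply: Ck_ext H2 _ => t tI; rewrite (HD_eq_derive_on H1).
Qed.

Lemma CkSVP k y : Ck k.+1 y <-> exists2 y', VHD y y' & Ck k y'.
Proof.
split=> [/CkS[/derivable_VHD H1 H2 H3]|[u' H1 H2]]; first by exists (derive_on y).
have E x : I11 x -> derive_on y x = u' x by exact: VHD_eq_derive_on.
apply/CkS; split; [|exact/VC_within/(VHD_VC H1)|].
  apply/derivable_VHD; split; [apply: (HD_ext H1.1) | apply: (HD_ext H1.2)] => // t tI; by rewrite E.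
by apply: Ck_ext H2 _ => t tI; rewrite E.
Qed.

Lemma CkV k y : Ck k y <-> Ck k (fun x => y x 0 0) /\ Ck k (fun x => y x 1 0).
Proof.
elim: k y => [|k IH] y.
  split=> [[/(_ 0 isT)/VC_within[H1 H2] _]|[/Ck0 H1 /Ck0 H2]]; first by split; apply/Ck0.
  by split=> // -[] // _; apply/VC_within.
split=> [/CkSVP[y' [H1 H2] /IH[H3 H4]]|[/CkSP[u0 H0 C0'] /CkSP[u1 H1 C1]]].
  by split; apply/CkSP; [exact: (ex_intro2 _ _ _ H1 H3)|exact: (ex_intro2 _ _ _ H2 H4)].
apply/CkSVP; exists (fun x => \col_i if i == 0 then u0 x else u1 x).
  by split; [apply: (HD_ext H0)|apply: (HD_ext H1)] => // x xI; rewrite mxE.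
apply/IH; split; [apply: Ck_ext C0' _|apply: Ck_ext C1 _] => x xI; by rewrite mxE.
Qed.

Lemma CkD k u v : Ck k u -> Ck k v -> Ck k (fun x => u x + v x).
Proof.
elim: k u v => [|k IH] u v; first by move=> /Ck0 ? /Ck0 ?; apply/Ck0/C0D.
move=> /CkSP[u' Hu Cu] /CkSP[v' Hv Cv]; apply/CkSP.
by eexists; [exact: HDD Hu Hv|exact: IH].
Qed.

Lemma CkM k u v : Ck k u -> Ck k v -> Ck k (fun x => u x * v x).
Proof.
elim: k u v => [|k IH] u v; first by move=> /Ck0 ? /Ck0 ?; apply/Ck0/C0M.
move=> /[dup] Cu0 /CkSP[u' Hu Cu] /[dup] Cv0 /CkSP[v' Hv Cv]; apply/CkSP.
eexists; first exact: HDM Hu Hv.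
exact: (CkD (IH _ _ Cu (Ck_le (leqnSn k) Cv0)) (IH _ _ (Ck_le (leqnSn k) Cu0) Cv)).
Qed.

Lemma AC_ext u v : abs_continuous u -> (forall x, I11 x -> u x = v x) ->
  abs_continuous v.
Proof.
move=> H uv e e0; have [d d0 Hd] := H e e0; exists d => // m a b ab dis s.
have := Hd m a b ab dis s; congr (_ < _); apply: eq_bigr => i _.
by have [h1 [h2 h3]] := ab i; rewrite !uv //; apply/I11P; lra.
Qed.

Lemma ACD u v : abs_continuous u -> abs_continuous v ->
  abs_continuous (fun x => u x + v x).
Proof.
move=> Hu Hv e e0; have e2 : 0 < e / 2 by lra.
have [d d0 Hd] := Hu _ e2; have [d' d0' Hd'] := Hv _ e2.
exists (Num.min d d'); first by rewrite lt_min d0.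
move=> m a b ab dis; rewrite lt_min => /andP[s s'].
have := ltrD (Hd m a b ab dis s) (Hd' m a b ab dis s').
rewrite -splitr; apply: le_lt_trans; rewrite -big_split /=; apply: ler_sum => i _.
apply: le_trans (ler_normD _ _); rewrite le_eqVlt; apply/orP; left; apply/eqP; congr `|_|; ring.
Qed.

Lemma ACN u : abs_continuous u -> abs_continuous (fun x => - u x).
Proof.
move=> H e e0; have [d d0 Hd] := H e e0; exists d => // m a b ab dis s.
have := Hd m a b ab dis s; congr (_ < _); apply: eq_bigr => i _.
by rewrite -normrN opprB opprK addrC.
Qed.

(** A bounded derivative makes the function Lipschitz. *)
Lemma HD_AC u u' : HD u u' -> C0 u' -> abs_continuous u.
Proof.
move=> Hu /C0_bounded[M M0 HM] e e0; exists (e / M); first exact: divr_gt0.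
move=> m a b ab dis; rewrite ltr_pdivlMr // => s; apply: le_lt_trans s.
rewrite mulr_suml; apply: ler_sum => i _; have [h1 [h2 h3]] := ab i.
rewrite mulrC; apply: (HD_lip Hu _ h1 h2 h3) => x xI; apply/HM/I11P; lra.
Qed.

(** The regularity class of f: C^k with absolutely continuous k-th derivative.
    *)
Definition ACk k u := Ck k u /\ abs_continuous (iter k derive_on u).

Lemma ACkSP k u : ACk k.+1 u <-> exists2 u', HD u u' & ACk k u'.
Proof.
split=> [[/CkS[/derivable_HD H1 H2 H3] H4]|[u' H1 [H2 H3]]].
  by exists (derive_on u) => //; split => //; rewrite -iterSr.
split; first by apply/CkSP; exists u'.
rewrite iterSr; apply: AC_ext H3 _ => x xI; apply: iter_derive_on_ext => // t tI.
by rewrite (HD_eq_derive_on H1).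
Qed.

Lemma ACk0 u : ACk 0 u <-> C0 u /\ abs_continuous u.
Proof. by split=> -[] => [/Ck0|] H1 H2; split=> //; apply/Ck0. Qed.

Lemma ACkD k u v : ACk k u -> ACk k v -> ACk k (fun x => u x + v x).
Proof.
elim: k u v => [|k IH] u v.
  move=> /ACk0[? ?] /ACk0[? ?]; apply/ACk0; split; [exact: C0D|exact: ACD].
move=> /ACkSP[u' Hu Cu] /ACkSP[v' Hv Cv]; apply/ACkSP.
by eexists; [exact: HDD Hu Hv|exact: IH].
Qed.

Lemma ACkN k u : ACk k u -> ACk k (fun x => - u x).
Proof.
elim: k u => [|k IH] u.
  move=> /ACk0[? ?]; apply/ACk0; split; [exact: C0N|exact: ACN].
move=> /ACkSP[u' Hu Cu]; apply/ACkSP.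
by eexists; [exact: HDN Hu|exact: IH].
Qed.

(** A function with continuous derivative is Lipschitz, hence absolutely
    continuous. *)
Lemma Ck_ACk k u : Ck k.+1 u -> ACk k u.
Proof.
elim: k u => [|k IH] u /CkSP[u' Hu Cu].
  by apply/ACk0; split; [exact: HD_C0 Hu|apply: HD_AC Hu _; exact/Ck0].
by apply/ACkSP; exists u' => //; apply: IH.
Qed.

Lemma ACk_ext k u v : ACk k u -> (forall x, I11 x -> u x = v x) -> ACk k v.
Proof.
move=> [H1 H2] uv; split; first exact: Ck_ext uv.
by apply: AC_ext H2 _ => x xI; exact: iter_derive_on_ext.
Qed.

Lemma VHD_coord_iter k y : Ck k y -> forall i x, I11 x ->
  iter k derive_on y x i 0 = iter k derive_on (fun t => y t i 0) x.
Proof.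
elim: k y => [//|k IH] y /CkSVP[y' Hy Cy] i x xI; rewrite !iterSr.
have E t : I11 t -> derive_on y t = y' t by exact: VHD_eq_derive_on.
rewrite (iter_derive_on_ext _ E) // IH //; apply: iter_derive_on_ext => // t tI.
by move: i; apply: I2P; rewrite ?(HD_eq_derive_on Hy.1) ?(HD_eq_derive_on Hy.2).
Qed.

Lemma ACV (y : R -> 'cV[R]_2) i : abs_continuous y -> abs_continuous (fun x => y x i 0).
Proof.
move=> H e e0; have [d d0 Hd] := H e e0; exists d => // m a b ab dis s.
apply: le_lt_trans (Hd m a b ab dis s); apply: ler_sum => j _.
rewrite [leRHS]/Num.Def.normr /= mx_normrE.
by apply: le_trans (le_bigmax _ _ (i, 0)); rewrite !mxE.
Qed.

(** Passage from the vector hypothesis on f to its coordinates, on which the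
    product rules are stated. *)
Lemma ACk_coord k y i : Ck k y -> abs_continuous (iter k derive_on y) ->
  ACk k (fun x => y x i 0).
Proof.
move=> Cy ACy; split; first by move: i; apply: I2P; have [] := (iffLR (CkV k y) Cy).
by apply: AC_ext (ACV i ACy) _ => x xI; exact: VHD_coord_iter.
Qed.

End Vectors.

(** * Integration by parts against an absolutely continuous function *)

Section AbsCont.
Context {R : realType}.
Implicit Types (h w W : R -> R) (K L N : nat).

Definition node N i : R := -1 + 2 * i%:R / N%:R.
Definition incr h N i : R := h (node N i.+1) - h (node N i).

Lemma nodeS N i : node N i.+1 - node N i = 2 / N%:R.
Proof. by rewrite /node -natr1; ring. Qed.

Lemma node_refine K L i : (0 < L)%N -> node (K * L) (i * L) = node K i.
Proof.
move=> L0; have LR : (L%:R : R) != 0 by rewrite pnatr_eq0 -lt0n.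
rewrite /node !natrM; congr (_ + _); rewrite invfM.
have [->|K0] := eqVneq (K%:R : R) 0; first by rewrite invr0 mulr0 mul0r mulr0.
by field; rewrite LR K0.
Qed.

Lemma node_le N i j : (i <= j)%N -> node N i <= node N j.
Proof.
move=> ij; rewrite lerD2l ler_wpM2r ?invr_ge0 ?ler0n // ler_wpM2l //.
by rewrite ler_nat.
Qed.

Lemma node_bound N i : (0 < N)%N -> (i <= N)%N -> -1 <= node N i /\ node N i <= 1.
Proof.
move=> N0 iN; have N0' : (0 : R) < N%:R by rewrite ltr0n.
have E0 : node N 0 = -1 by rewrite /node mulr0 mul0r addr0.
have E1 : node N N = 1 by rewrite /node mulfK ?gt_eqF //; ring.
by split; [rewrite -E0|rewrite -[leRHS]E1]; exact: node_le.
Qed.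

Lemma node0 N : node N 0 = -1.
Proof. by rewrite /node mulr0 mul0r addr0. Qed.
Lemma nodeN N : (0 < N)%N -> node N N = 1.
Proof. by move=> N0; rewrite /node mulfK ?pnatr_eq0 -?lt0n //; ring. Qed.

Lemma sum_cst N (c : R) : \sum_(i < N) c = c * N%:R.
Proof. by rewrite sumr_const card_ord -[in RHS]mulr_natr mul1r mulr_natr. Qed.

Lemma sum_blocks (F : nat -> R) (P : pred nat) K L :
  \sum_(i < K * L | P i) F i =
  \sum_(i < K) \sum_(j < L | P (i * L + j)%N) F (i * L + j)%N.
Proof.
rewrite -(big_mkord P F); elim: K => [|K IH]; first by rewrite mul0n big_ord0 big_nil.
rewrite big_ord_recr /= -IH mulSn addnC (@big_cat_nat _ _ _ (K * L)) ?leq_addr //=.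
congr (_ + _); rewrite -{1}(add0n (K * L)%N) big_addn addnC addnK big_mkord.
by apply: eq_big => [i|i _]; rewrite addnC.
Qed.

Lemma sum_incr h N i L : \sum_(j < L) incr h N (i + j) = h (node N (i + L)) - h (node N i).
Proof.
elim: L => [|L IH]; first by rewrite big_ord0 addn0 subrr.
by rewrite big_ord_recr /= IH /incr addnS; ring.
Qed.

Lemma incr_refine h K L i : (0 < L)%N ->
  \sum_(j < L) incr h (K * L) (i * L + j) = incr h K i.
Proof. by move=> L0; rewrite sum_incr -mulSnr !node_refine. Qed.

Lemma AC_grid h : abs_continuous h -> forall e, 0 < e -> exists2 d : R, 0 < d &
  forall N (S : pred nat), (0 < N)%N -> \sum_(i < N | S i) 2 / N%:R < d ->
    \sum_(i < N | S i) `|incr h N i| < e.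
Proof.
move=> H e e0; have [d d0 Hd] := H e e0; exists d => // N S N0 HS.
pose b (i : 'I_N) := if S i then node N i.+1 else node N i.
have := Hd N (fun i => node N i) b; rewrite [X in X -> _]/= => /(_ _)/= HH.
have E1 : \sum_i (b i - node N i) = \sum_(i < N | S i) 2 / N%:R.
  rewrite [RHS]big_mkcond /=; apply: eq_bigr => i _; rewrite /b; case: ifP => _.
    by rewrite nodeS.
  by rewrite subrr.
have E2 : \sum_i `|h (b i) - h (node N i)| = \sum_(i < N | S i) `|incr h N i|.
  rewrite [RHS]big_mkcond /=; apply: eq_bigr => i _; rewrite /b; case: ifP => _ //.
  by rewrite subrr normr0.
rewrite -E2; apply: HH; last by rewrite E1.
- move=> i; have iN := ltn_ord i; split; first by have [] := node_bound N0 (ltnW iN).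
  rewrite /b; case: ifP => _; last by rewrite lexx; have [] := node_bound N0 (ltnW iN).
  by rewrite node_le //; split=> //; have [] := node_bound N0 iN.
- have bS (i : 'I_N) : b i <= node N i.+1 by rewrite /b; case: ifP => // _; exact: node_le.
  move=> i j; rewrite -val_eqE /= neq_ltn => /orP[ij|ij]; [left|right];
  exact: le_trans (bS _) (node_le _ ij).
Qed.

(** Absolute continuity bounds the variation over grids: a grid of fixed size
    splits the increments into finitely many short groups. *)
Lemma AC_var h : abs_continuous h -> exists2 V : R, 0 < V &
  forall K, (0 < K)%N -> \sum_(i < K) `|incr h K i| <= V.
Proof.
move=> /AC_grid/(_ 1 ltr01)[d d0 Hd].
have [P P0 HP] : exists2 P, (0 < P)%N & 2 / P%:R < d.
  exists (Num.trunc (2 / d)).+1 => //.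
  rewrite ltr_pdivrMr ?ltr0n // mulrC -ltr_pdivrMr //.
  exact: truncnS_gt.
exists P%:R; first by rewrite ltr0n.
move=> K K0.
have le1 : \sum_(i < K) `|incr h K i| <= \sum_(i < K * P) `|incr h (K * P) i|.
  rewrite (sum_blocks (fun i => `|incr h (K * P) i|) xpredT) /=.
  apply: ler_sum => i _; rewrite -(incr_refine h K i P0); exact: ler_norm_sum.
apply: le_trans le1 _; rewrite mulnC.
rewrite (sum_blocks (fun i => `|incr h (P * K) i|) xpredT) /=.
have -> : (P%:R : R) = \sum_(i < P) 1 by rewrite sumr_const card_ord.
apply: ler_sum => i _.
have PK : (0 < P * K)%N by rewrite muln_gt0 P0.
have iPK j : (j < K)%N -> ((i * K + j) %/ K = i)%N.
  by move=> jK; rewrite divnMDl // divn_small // addn0.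
have HH (F : nat -> R) : \sum_(n < P * K | (n %/ K == i)%N) F n = \sum_(j < K) F (i * K + j)%N.
  rewrite (sum_blocks F (fun n => n %/ K == i)%N) (bigD1 i) //= [X in _ + X]big1 ?addr0.
    by apply: eq_bigl => j; rewrite iPK // eqxx.
  move=> k ki; rewrite big1 // => j /eqP; rewrite divnMDl // divn_small ?ltn_ord // addn0 => E.
  by case/eqP: ki; apply: val_inj.
have := Hd (P * K)%N (fun n => n %/ K == i)%N PK.
rewrite (HH (fun n => `|incr h (P * K) n|)) (HH (fun=> 2 / (P * K)%:R)) sumr_const card_ord => HH1; apply/ltW/HH1.
suff -> : 2 / (P * K)%:R *+ K = 2 / P%:R :> R by [].
rewrite -mulr_natr natrM; field.
by rewrite !pnatr_eq0 -!lt0n P0 K0.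
Qed.

Lemma sqr_le_le (a b : R) : 0 <= b -> a ^+ 2 <= b ^+ 2 -> a <= b.
Proof. by move=> b0; apply: contraTT; rewrite -!ltNge => ba; nra. Qed.

(** The excess of the length function sqrt (1 + d^2) over its tangent at s (a
    Bregman divergence). *)
Definition breg (s d : R) : R := Num.sqrt (1 + d ^+ 2) - Num.sqrt (1 + s ^+ 2)
  - s / Num.sqrt (1 + s ^+ 2) * (d - s).

Lemma sqrt1D_gt0 (s : R) : 0 < Num.sqrt (1 + s ^+ 2).
Proof. by rewrite sqrtr_gt0; have := sqr_ge0 s; lra. Qed.

Lemma sqrt1D_sqr (s : R) : Num.sqrt (1 + s ^+ 2) ^+ 2 = 1 + s ^+ 2.
Proof. by rewrite sqr_sqrtr //; have := sqr_ge0 s; lra. Qed.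

Lemma sqrt1D_CS (s d : R) :
  `|1 + s * d| <= Num.sqrt (1 + s ^+ 2) * Num.sqrt (1 + d ^+ 2).
Proof.
apply: sqr_le_le; first by rewrite mulr_ge0 // sqrtr_ge0.
rewrite real_normK ?num_real // exprMn !sqrt1D_sqr.
have : 0 <= (d - s) ^+ 2 by exact: sqr_ge0.
nra.
Qed.

Lemma bregE (s d : R) : Num.sqrt (1 + s ^+ 2) * breg s d =
  Num.sqrt (1 + s ^+ 2) * Num.sqrt (1 + d ^+ 2) - 1 - s * d.
Proof.
have := sqrt1D_sqr s; have := sqrt1D_gt0 s; rewrite /breg.
set a := Num.sqrt _ => a0 aE.
rewrite mulrBr mulrA mulrCA divff ?gt_eqF // mulrBr -expr2 aE; ring.
Qed.

Lemma breg_ge0 (s d : R) : 0 <= breg s d.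
Proof.
rewrite -(pmulr_rge0 _ (sqrt1D_gt0 s)) bregE.
have := ler_norm (1 + s * d); have := sqrt1D_CS s d; lra.
Qed.

(** Strict convexity of the length function, made quantitative: over bounded
    slopes s the distance of d from s is controlled by the excess of length, up
    to an error tau. *)
Lemma slope_gap (s d k tau : R) : 0 < tau -> `|s| <= k ->
  `|d - s| <= tau + 2 * (1 + k) ^+ 2 * (1 + k + tau) / tau * breg s d.
Proof.
move=> t0 sk; have := bregE s d; have := breg_ge0 s d; have := sqrt1D_CS s d.
have := sqrt1D_sqr d; have := sqrt1D_sqr s; have := sqrt1D_gt0 d; have := sqrt1D_gt0 s.
set a : R := Num.sqrt (1 + s ^+ 2); set b : R := Num.sqrt (1 + d ^+ 2).
set B : R := breg s d => a0 b0 aE bE ab1 B0 BE.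
have s2 : 0 <= s ^+ 2 by exact: sqr_ge0.
have d2 : 0 <= d ^+ 2 by exact: sqr_ge0.
have k0 : 0 <= k by exact: le_trans (normr_ge0 s) sk.
set x : R := `|d - s|.
have x0 : 0 <= x by exact: normr_ge0.
have xE : x ^+ 2 = (d - s) ^+ 2 by rewrite real_normK // num_real.
have ak : a <= 1 + k.
  apply: sqr_le_le; first by lra.
  rewrite aE; have : s ^+ 2 <= k ^+ 2.
    by rewrite -(real_normK (num_real s)) ler_sqr ?nnegrE.
  nra.
have bax : b <= a + x.
  apply: sqr_le_le; first by lra.
  have sa : `|s| <= a.
    by apply: sqr_le_le; rewrite ?ltW // real_normK ?num_real // aE; lra.
  have : s * (d - s) <= a * x.
    by apply: le_trans (ler_norm _) _; rewrite normrM; apply: ler_pM.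
  rewrite bE sqrrD aE xE mulr2n; nra.
have k1 : 0 <= 1 + k by lra.
have kt : 0 <= 1 + k + tau by lra.
have kkt : 0 <= 2 * (1 + k) ^+ 2 * (1 + k + tau) by rewrite !mulr_ge0 ?exprn_ge0.
have [xt|tx] := leP x tau.
  by apply: ler_wpDr => //; apply: mulr_ge0 B0; apply: divr_ge0 (ltW t0).
have key : x ^+ 2 <= 2 * a ^+ 2 * (a + x) * B.
  have -> : x ^+ 2 = (a * b + (1 + s * d)) * (a * B).
    rewrite BE xE; have : (a * b) ^+ 2 = (1 + s ^+ 2) * (1 + d ^+ 2) by rewrite exprMn aE bE.
    nra.
  have h1 : a * b + (1 + s * d) <= 2 * a * (a + x).
    apply: (@le_trans _ _ (2 * a * b)); first by have := ler_norm (1 + s * d); lra.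
    by apply: ler_wpM2l => //; lra.
  have h2 := ler_wpM2r (mulr_ge0 (ltW a0) B0) h1.
  apply: le_trans h2 _; rewrite le_eqVlt; apply/orP; left; apply/eqP; ring.
have key2 : x * tau <= 2 * a ^+ 2 * (a + tau) * B.
  rewrite -(ler_pM2r (_ : 0 < a + x)); last by lra.
  have h0 : 0 <= x * a * (x - tau).
    by apply: mulr_ge0; [apply: mulr_ge0 => //; exact: ltW|rewrite subr_ge0 ltW].
  have h1 : x * tau * (a + x) <= x ^+ 2 * (a + tau) by lra.
  apply: le_trans h1 _.
  have h2 : x ^+ 2 * (a + tau) <= 2 * a ^+ 2 * (a + x) * B * (a + tau).
    by apply: ler_wpM2r => //; lra.
  apply: le_trans h2 _; rewrite le_eqVlt; apply/orP; left; apply/eqP; ring.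
have key3 : 2 * a ^+ 2 * (a + tau) * B <= 2 * (1 + k) ^+ 2 * (1 + k + tau) * B.
  have a0' := ltW a0; apply: ler_wpM2r => //; apply: ler_pM; rewrite ?mulr_ge0 ?exprn_ge0 //; try lra.
  by rewrite ler_wpM2l // ler_sqr ?nnegrE //; lra.
rewrite mulrAC ler_wpDl ?(ltW t0) // ler_pdivlMr //.
exact: le_trans key2 key3.
Qed.

Definition slope h K i : R := incr h K i * K%:R / 2.
(** Length of the inscribed polygon of the graph of h on the grid of K steps.
    *)
Definition glen h K : R := \sum_(i < K) 2 / K%:R * Num.sqrt (1 + slope h K i ^+ 2).

Lemma slopeK h K i : (0 < K)%N -> 2 / K%:R * slope h K i = incr h K i.
Proof. by move=> K0; rewrite /slope; field; rewrite pnatr_eq0 -lt0n. Qed.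

(** Subdividing a chord leaves the sum of the tangent terms unchanged, so the
    gain in length is the sum of the excesses. *)
Lemma glen_refine h K L : (0 < K)%N -> (0 < L)%N ->
  glen h (K * L) - glen h K =
  \sum_(i < K) \sum_(j < L) 2 / (K * L)%:R * breg (slope h K i) (slope h (K * L) (i * L + j)).
Proof.
move=> K0 L0; have KL0 : (0 < K * L)%N by rewrite muln_gt0 K0.
have KR : (K%:R : R) != 0 by rewrite pnatr_eq0 -lt0n.
have LR : (L%:R : R) != 0 by rewrite pnatr_eq0 -lt0n.
rewrite /glen (sum_blocks (fun i => 2 / (K * L)%:R * Num.sqrt (1 + slope h (K * L) i ^+ 2)) xpredT) /=.
rewrite -sumrB; apply: eq_bigr => i _.
set s := slope h K i; set a := Num.sqrt (1 + s ^+ 2).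
have -> : 2 / K%:R * a = \sum_(j < L) 2 / (K * L)%:R * a.
  by rewrite sum_cst natrM; field; rewrite KR LR.
rewrite -sumrB.
have E : \sum_(j < L) (2 / (K * L)%:R * slope h (K * L) (i * L + j) - 2 / (K * L)%:R * s) = 0.
  rewrite sumrB sum_cst.
  under eq_bigr do rewrite slopeK //.
  by rewrite incr_refine // -(slopeK h i K0) -/s natrM; field; rewrite KR LR.
have E' := congr1 ( *%R (s / a)) E; rewrite mulr0 in E'.
rewrite -[LHS]subr0 -[X in _ - X]E' mulr_sumr -sumrB; apply: eq_bigr => j _.
by rewrite /breg -/a; ring.
Qed.

(** On some grid h is already linear up to e in total variation, whatever the
    refinement. Choose a grid whose polygon nearly has the supremum of the
    lengths: any refinement then gains almost no length, so by slope_gap the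
    slopes hardly change on the steps of moderate slope; the steps of large
    slope have small total length, and absolute continuity bounds their
    increments. This replaces the almost everywhere derivative of h. *)
Lemma AC_refine h : abs_continuous h -> forall e : R, 0 < e -> exists2 K, (0 < K)%N &
  forall L, (0 < L)%N -> \sum_(i < K) \sum_(j < L)
    `|incr h (K * L) (i * L + j) - incr h K i / L%:R| <= e.
Proof.
move=> H e e0; have e4 : 0 < e / 5 by lra.
have [V V0 HV] := AC_var H.
have [d d0 Hd] := AC_grid H e4.
(* steps steeper than k have total length below d, as the variation is at most V *)
pose k := 2 * V / d.
have k0 : 0 < k by rewrite divr_gt0 // mulr_gt0.
pose tau := e / 10; have t0 : 0 < tau by rewrite divr_gt0.
pose C := 2 * (1 + k) ^+ 2 * (1 + k + tau) / tau.
have C0 : 0 < C.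
  by rewrite divr_gt0 // !mulr_gt0 ?exprn_gt0 // ?addr_gt0.
pose A : set R := [set glen h K | K in [set K | (0 < K)%N]].
have Aub : ubound A (2 + V).
  move=> _ [K /= K0 <-]; rewrite /glen.
  have K0' : (0 : R) < K%:R by rewrite ltr0n.
  apply: (@le_trans _ _ (\sum_(i < K) (2 / K%:R + `|incr h K i|))).
    apply: ler_sum => i _.
    rewrite -(slopeK h i K0) normrM (ger0_norm (_ : 0 <= 2 / K%:R)) ?divr_ge0 ?ler0n //.
    rewrite -{2}[2 / K%:R]mulr1 -mulrDr ler_wpM2l ?divr_ge0 ?ler0n //.
    apply: sqr_le_le; first by rewrite addr_ge0.
    rewrite sqrt1D_sqr -(real_normK (num_real (slope h K i))).
    have := normr_ge0 (slope h K i); nra.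
  rewrite big_split /= lerD ?HV // sum_cst divfK //.
  by rewrite gt_eqF.
have AS : has_sup A by split; [exists (glen h 1); exists 1%N|exists (2 + V)].
have eC : 0 < e / 5 / C by rewrite divr_gt0.
have [_ [K K0 <-] HK] := sup_adherent eC AS.
exists K => // L L0.
have KL0 : (0 < K * L)%N by rewrite muln_gt0 K0.
have K0' : (0 : R) < K%:R by rewrite ltr0n.
have L0' : (0 : R) < L%:R by rewrite ltr0n.
have KR := lt0r_neq0 K0'; have LR := lt0r_neq0 L0'.
have gap : glen h (K * L) - glen h K <= e / 5 / C.
  have : glen h (K * L) <= sup A by apply: ub_le_sup; [exists (2 + V)|exists (K * L)%N].
  lra.
pose bad i := k < `|slope h K i|.
have badlen : \sum_(i < K | bad i) 2 / K%:R < d.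
  have : k * \sum_(i < K | bad i) 2 / K%:R <= V.
    apply: le_trans (HV K K0); rewrite mulr_sumr [leLHS]big_mkcond /=.
    apply: ler_sum => i _; case: ifP => // /ltW bi.
    rewrite -(slopeK h i K0) normrM (ger0_norm (_ : 0 <= 2 / K%:R)) ?divr_ge0 ?ler0n //.
    by rewrite mulrC ler_wpM2l // divr_ge0 ?ler0n.
  rewrite -ler_pdivlMl // => /le_lt_trans; apply.
  rewrite mulrC ltr_pdivrMr // /k mulrC divfK ?gt_eqF //; lra.
have bad1 : \sum_(i < K | bad i) `|incr h K i| <= e / 5 by exact/ltW/Hd.
have bad2 : \sum_(i < K | bad i) \sum_(j < L) `|incr h (K * L) (i * L + j)| <= e / 5.
  have E (F : nat -> R) : \sum_(n < K * L | bad (n %/ L)%N) F n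
      = \sum_(i < K | bad i) \sum_(j < L) F (i * L + j)%N.
    rewrite (sum_blocks F (fun n => bad (n %/ L)%N)) [RHS]big_mkcond /=.
    apply: eq_bigr => i _; rewrite (eq_bigl (fun=> bad i)); last first.
      by move=> j; rewrite divnMDl // divn_small // addn0.
    by case: (bad i) => //; rewrite big_pred0_eq.
  rewrite -(E (fun n => `|incr h (K * L) n|)); apply/ltW/(Hd _ (fun n => bad (n %/ L)%N)) => //.
  rewrite (E (fun=> 2 / (K * L)%:R)).
  rewrite (eq_bigr (fun=> 2 / K%:R)) // => i _.
  by rewrite sum_cst natrM; field; rewrite KR LR.
have good : \sum_(i < K | ~~ bad i) \sum_(j < L)
    `|incr h (K * L) (i * L + j) - incr h K i / L%:R| <= 2 * tau + e / 5.
  apply: (@le_trans _ _ (\sum_(i < K) \sum_(j < L) (2 / (K * L)%:R * tau +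
    C * (2 / (K * L)%:R * breg (slope h K i) (slope h (K * L) (i * L + j)))))).
    rewrite [leLHS]big_mkcond /=; apply: ler_sum => i _.
    have p0 : 0 <= 2 / (K * L)%:R :> R by rewrite divr_ge0 ?ler0n.
    case: ifP => [|_]; last first.
      apply: sumr_ge0 => j _; apply: addr_ge0; first exact: mulr_ge0 p0 (ltW t0).
      by apply: mulr_ge0 (ltW C0) _; apply: mulr_ge0 p0 (breg_ge0 _ _).
    rewrite /bad -leNgt => gi; apply: ler_sum => j _.
    have -> : incr h (K * L) (i * L + j) - incr h K i / L%:R =
       2 / (K * L)%:R * (slope h (K * L) (i * L + j) - slope h K i).
      rewrite mulrBr slopeK // -(slopeK h i K0) natrM; field; by rewrite KR LR.
    rewrite normrM (ger0_norm p0) (mulrCA C) -mulrDr ler_wpM2l //.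
    exact: slope_gap.
  have -> : \sum_(i < K) \sum_(j < L) (2 / (K * L)%:R * tau +
    C * (2 / (K * L)%:R * breg (slope h K i) (slope h (K * L) (i * L + j)))) =
    2 * tau + C * (glen h (K * L) - glen h K).
    rewrite glen_refine // mulr_sumr -[2 * tau](_ : \sum_(i < K) \sum_(j < L) 2 / (K * L)%:R * tau = _).
      rewrite -big_split; apply: eq_bigr => i _ /=.
      by rewrite mulr_sumr -big_split.
    by under eq_bigr do rewrite sum_cst; rewrite sum_cst natrM; field; rewrite KR LR.
  by rewrite lerD2l mulrC -ler_pdivlMr.
rewrite (bigID (fun i : 'I_K => bad i)) /=.
have badall : \sum_(i < K | bad i) \sum_(j < L)
    `|incr h (K * L) (i * L + j) - incr h K i / L%:R| <= e / 5 + e / 5.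
  apply: le_trans (lerD bad2 bad1); rewrite -big_split /=; apply: ler_sum => i _.
  have -> : `|incr h K i| = \sum_(j < L) `|incr h K i / L%:R|.
    rewrite sum_cst normrM normfV (ger0_norm (ltW L0')) divfK //.
  by rewrite -big_split /=; apply: ler_sum => j _; exact: ler_normB.
rewrite /tau in good; lra.
Qed.

Lemma telescope_node (F : R -> R) N : (0 < N)%N ->
  \sum_(i < N) (F (node N i.+1) - F (node N i)) = F 1 - F (-1).
Proof.
move=> N0; have := sum_incr F N 0 N; rewrite /incr add0n nodeN // node0 => <-.
by apply: eq_bigr.
Qed.

(** Integration by parts of h against w', leaving the integral of w dh. On the
    grid of AC_refine, dh is replaced by a step density, whose integral against
    w only involves the primitive W; this is small when w oscillates fast, and
    the replacement costs e times the bound of w. *)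
Lemma AC_stieltjes h : C0 h -> abs_continuous h -> forall e : R, 0 < e ->
  exists2 M : R, 0 <= M & forall (w w' W : R -> R) (C c : R),
    HD w w' -> C0 w' -> HD W w -> (forall x, I11 x -> `|w x| <= C) ->
    (forall x, I11 x -> `|W x| <= c) ->
    `|integral11 (fun x => h x * w' x) - (h 1 * w 1 - h (-1) * w (-1))| <= C * e + M * c.
Proof.
move=> Ch ACh e e0; have [K K0 HK] := AC_refine ACh e0.
have K0' : (0 : R) < K%:R by rewrite ltr0n.
pose S := \sum_(i < K) `|incr h K i|.
have S0 : 0 <= S by apply: sumr_ge0.
exists (S * K%:R); first by rewrite mulr_ge0 ?ler0n.
move=> w w' W C c Hw Cw' HW wC Wc.
have [B B0 HB] := C0_bounded Cw'.
have C0' : 0 <= C by apply: le_trans (normr_ge0 _) (wC 1 I11_1).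
have [U HU] := C0_primitive (C0M Ch Cw').
rewrite (integral11_HD HU (C0M Ch Cw')).
apply/ler_addgt0Pr => e1 e1_0.
pose e2 := e1 / (2 * B + S * B + 1).
have den0 : 0 < 2 * B + S * B + 1.
  by rewrite ltr_wpDl // addr_ge0 // mulr_ge0 // ltW.
have e2_0 : 0 < e2 by rewrite divr_gt0.
have [d d0 Hd] := ACh e2 e2_0.
pose m := Num.min d e2; have m0 : 0 < m by rewrite lt_min d0.
have [L L0 HL] : exists2 L, (0 < L)%N & 2 / (K * L)%:R < m.
  exists (Num.trunc (2 / m)).+1 => //.
  apply: (@le_lt_trans _ _ (2 / (Num.trunc (2 / m)).+1%:R)).
    rewrite ler_wpM2l // lef_pV2 ?posrE ?ltr0n ?muln_gt0 ?K0 // ler_nat.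
    by rewrite leq_pmull.
  rewrite ltr_pdivrMr ?ltr0n // mulrC -ltr_pdivrMr //.
  exact: truncnS_gt.
move: HL; rewrite lt_min => /andP[HLd HLe].
have L0' : (0 : R) < L%:R by rewrite ltr0n.
have KR := lt0r_neq0 K0'; have LR := lt0r_neq0 L0'.
set N := (K * L)%N in HLd HLe *.
have N0 : (0 < N)%N by rewrite muln_gt0 K0.
have N0' : (0 : R) < N%:R by rewrite ltr0n.
pose x i : R := node N i.
have xB i : (i <= N)%N -> -1 <= x i /\ x i <= 1 by exact: node_bound.
have xI i : (i <= N)%N -> I11 (x i) by move=> /xB[? ?]; apply/I11P; lra.
have osc i t : (i < N)%N -> x i <= t <= x i.+1 -> `|h t - h (x i)| <= e2.
  move=> iN /andP[t1 t2].
  have [h1 _] := xB i (ltnW iN); have [_ h2] := xB i.+1 iN.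
  have := Hd 1%N (fun=> x i) (fun=> t); rewrite !big_ord1 => HH; apply/ltW/HH.
  - by move=> _; split=> //; split=> //; exact: le_trans t2 h2.
  - by move=> j k; rewrite !ord1 eqxx.
  - by apply: le_lt_trans HLd; rewrite -(nodeS N i) lerD2r.
have E1 : `|U 1 - U (-1) - \sum_(i < N) h (x i) * (w (x i.+1) - w (x i))| <= 2 * B * e2.
  rewrite -(telescope_node U N0) -sumrB.
  apply: le_trans (ler_norm_sum _ _ _) _.
  apply: (@le_trans _ _ (\sum_(i < N) (e2 * B * (2 / N%:R)))); last first.
    by rewrite sum_cst le_eqVlt; apply/orP; left; apply/eqP; field; rewrite lt0r_neq0.
  apply: ler_sum => i _; have iN := ltn_ord i.
  have [h1 _] := xB i (ltnW iN); have [_ h2] := xB i.+1 iN.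
  have HH := HDB HU (HDZ (h (x i)) Hw).
  have := @HD_lip _ _ _ (x i) (x i.+1) (e2 * B) HH _ h1 (node_le N (leqnSn i)) h2.
  rewrite nodeS => /(_ _)/= HHH.
  rewrite (_ : _ - _ = U (x i.+1) - h (x i) * w (x i.+1) - (U (x i) - h (x i) * w (x i))); last first.
    by rewrite /x; ring.
  apply: HHH => t tx; rewrite -mulrBl normrM; apply: ler_pM => //.
    exact: osc.
  by apply: HB; apply/I11P; lra.
have E2 : \sum_(i < N) h (x i) * (w (x i.+1) - w (x i)) =
   h 1 * w 1 - h (-1) * w (-1) - \sum_(i < N) w (x i.+1) * incr h N i.
  rewrite -(telescope_node (fun t => h t * w t) N0) -sumrB; apply: eq_bigr => i _.
  by rewrite /incr /x; ring.
have E3 : `|\sum_(i < N) w (x i.+1) * incr h N i| <= C * e + S * K%:R * c + S * B * e2.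
  rewrite (sum_blocks (fun i => w (x i.+1) * incr h N i) xpredT) /=.
  have -> : \sum_(i < K) \sum_(j < L) w (x (i * L + j).+1) * incr h N (i * L + j) =
    \sum_(i < K) \sum_(j < L) w (x (i * L + j).+1) * (incr h N (i * L + j) - incr h K i / L%:R)
    + \sum_(i < K) \sum_(j < L) w (x (i * L + j).+1) * (incr h K i / L%:R).
    rewrite -big_split; apply: eq_bigr => i _ /=; rewrite -big_split; apply: eq_bigr => j _ /=.
    by rewrite -mulrDr subrK.
  have ijN (i : 'I_K) (j : 'I_L) : (i * L + j < N)%N.
    apply: (@leq_trans (i.+1 * L)); first by rewrite mulSnr ltn_add2l.
    by rewrite leq_mul2r ltn_ord orbT.
  apply: le_trans (ler_normD _ _) _; rewrite -addrA; apply: lerD.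
    apply: le_trans (ler_wpM2l C0' (HK L L0)).
    apply: le_trans (ler_norm_sum _ _ _) _; rewrite mulr_sumr; apply: ler_sum => i _.
    apply: le_trans (ler_norm_sum _ _ _) _; rewrite mulr_sumr; apply: ler_sum => j _.
    by rewrite normrM ler_wpM2r // wC //; apply/xI/ijN.
  apply: le_trans (ler_norm_sum _ _ _) _.
  rewrite -!mulrA -mulrDr mulr_suml; apply: ler_sum => i _.
  have W1 : `|\sum_(j < L) w (x (i * L + j).+1) * (2 / N%:R) - (W (node K i.+1) - W (node K i))|
     <= 2 / K%:R * (B * e2).
    have -> : W (node K i.+1) - W (node K i) = \sum_(j < L) incr W N (i * L + j).
      by rewrite incr_refine.
    rewrite -sumrB; apply: le_trans (ler_norm_sum _ _ _) _.
    apply: (@le_trans _ _ (\sum_(j < L) (e2 * B * (2 / N%:R)))); last first.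
      by rewrite sum_cst le_eqVlt /N natrM; apply/orP; left; apply/eqP; field; rewrite KR LR.
    apply: ler_sum => j _; set n := (i * L + j)%N.
    have iN : (n < N)%N := ijN i j.
    have [h1 _] := xB n (ltnW iN); have [_ h2] := xB n.+1 iN.
    have HH := HDB HW (HDZ (w (x n.+1)) HDid).
    have := @HD_lip _ _ _ (x n) (x n.+1) (e2 * B) HH _ h1 (node_le N (leqnSn n)) h2.
    rewrite nodeS => /(_ _)/= HHH.
    rewrite -normrN (_ : - _ = W (x n.+1) - w (x n.+1) * x n.+1 - (W (x n) - w (x n.+1) * x n)); last first.
      by rewrite -(nodeS N n) /incr /x; ring.
    apply: HHH => t /andP[t1 t2]; rewrite mulr1 -normrN opprB.
    have wl := @HD_lip _ _ _ t (x n.+1) B Hw _ (le_trans h1 t1) t2 h2.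
    apply: le_trans (wl _) _; first by move=> s /andP[s1 s2]; apply: HB; apply/I11P; lra.
    rewrite mulrC ler_wpM2r ?(ltW B0) //; apply: le_trans (ltW HLe).
    by rewrite -(nodeS N n) lerD2l lerN2.
  have -> : \sum_(j < L) w (x (i * L + j).+1) * (incr h K i / L%:R) =
     incr h K i * (K%:R / 2 * \sum_(j < L) w (x (i * L + j).+1) * (2 / N%:R)).
    rewrite mulr_sumr mulr_sumr; apply: eq_bigr => j _; rewrite /N natrM; field.
    by rewrite LR KR.
  rewrite normrM ler_wpM2l // normrM (ger0_norm (_ : 0 <= K%:R / 2)); last first.
    by rewrite divr_ge0 ?ler0n.
  have iK := ltn_ord i.
  have nI k : (k <= K)%N -> I11 (node K k).
    by move=> /(node_bound K0)[? ?]; apply/I11P; lra.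
  have Wd : `|W (node K i.+1) - W (node K i)| <= c + c.
    apply: le_trans (ler_normB _ _) _; apply: lerD; apply: Wc; apply: nI => //; exact: ltnW.
  set s := \sum_(j < L) _ in W1 *.
  have : `|s| <= c + c + 2 / K%:R * (B * e2).
    rewrite -[s](subrK (W (node K i.+1) - W (node K i))) addrC.
    exact: le_trans (ler_normD _ _) (lerD Wd W1).
  move=> /(ler_wpM2l (_ : 0 <= K%:R / 2)); rewrite divr_ge0 ?ler0n // => /(_ isT) Hs.
  apply: le_trans Hs _; rewrite le_eqVlt; apply/orP; left; apply/eqP; field; by rewrite KR.
have E4 : 2 * B * e2 + S * B * e2 <= e1.
  rewrite -mulrDl /e2 mulrCA ger_pMr // ler_pdivrMr // mul1r; lra.
rewrite E2 in E1.
set a := U 1 - U (-1) in E1 *; set b := h 1 * w 1 - _ in E1 *.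
set s := \sum_(i < N) _ in E1 E3.
have : `|a - b| <= `|a - (b - s)| + `|s|.
  by apply: le_trans (ler_normB _ _); rewrite le_eqVlt; apply/orP; left; apply/eqP; congr `|_|; ring.
move=> Hab; lra.
Qed.

End AbsCont.

(** * The Dirac system as a first order system *)

Section Dirac.
Context {R : realType}.
Implicit Types (y z h k u w : R -> 'cV[R]_2) (l : R).

Lemma innerE u w :
  inner u w = integral11 (fun x => u x 0 0 * w x 0 0 + u x 1 0 * w x 1 0).
Proof.
apply: integral11_ext => x _; rewrite mxE big_ord_recl big_ord1 !mxE.
by congr (_ + u x _ _ * w x _ _); exact/val_inj.
Qed.

Lemma VC_inner u w : VC u -> VC w ->
  C0 (fun x => u x 0 0 * w x 0 0 + u x 1 0 * w x 1 0).
Proof. by move=> [? ?] [? ?]; apply: C0D; apply: C0M. Qed.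

Lemma VC_ext u w : VC u -> (forall x, I11 x -> u x = w x) -> VC w.
Proof. by move=> [Cu Cv] uw; split; [apply: (C0_ext Cu)|apply: (C0_ext Cv)] => x xI; rewrite uw. Qed.

Lemma VCD u w : VC u -> VC w -> VC (fun x => u x + w x).
Proof.
move=> [H1 H2] [H3 H4]; split.
  by apply: (C0_ext (C0D H1 H3)) => x _; rewrite mxE.
by apply: (C0_ext (C0D H2 H4)) => x _; rewrite mxE.
Qed.

Lemma VCZ c u : VC u -> VC (fun x => c *: u x).
Proof.
move=> [H1 H2]; split.
  by apply: (C0_ext (C0M (C0c c) H1)) => x _; rewrite mxE.
by apply: (C0_ext (C0M (C0c c) H2)) => x _; rewrite mxE.
Qed.

Lemma VCB u w : VC u -> VC w -> VC (fun x => u x - w x).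
Proof.
move=> Cu /(VCZ (-1)) Cw; apply: (VC_ext (VCD Cu Cw)) => x _.
by rewrite scaleN1r.
Qed.

Lemma VC0 : VC (fun=> 0 : 'cV[R]_2).
Proof. by split; apply: (C0_ext (C0c 0)) => x _; rewrite mxE. Qed.

Lemma VC_sum (I : Type) (s : seq I) (P : pred I) (F : I -> R -> 'cV[R]_2) :
  (forall i, P i -> VC (F i)) -> VC (fun x => \sum_(i <- s | P i) F i x).
Proof.
move=> H; elim: s => [|i s IH].
  by apply: (VC_ext VC0) => x _; rewrite big_nil.
case Pi: (P i); last by apply: (VC_ext IH) => x _; rewrite big_cons Pi.
by apply: (VC_ext (VCD (H i Pi) IH)) => x _; rewrite big_cons Pi.
Qed.

Lemma innerC u w : inner u w = inner w u.
Proof. by rewrite !innerE; apply: integral11_ext => x _; ring. Qed.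

Lemma inner_ext u u' w w' : (forall x, I11 x -> u x = u' x) ->
  (forall x, I11 x -> w x = w' x) -> inner u w = inner u' w'.
Proof. by move=> uu ww; apply: integral11_ext => x xI; rewrite uu // ww. Qed.

Lemma innerDl u u' w : VC u -> VC u' -> VC w ->
  inner (fun x => u x + u' x) w = inner u w + inner u' w.
Proof.
move=> Cu Cu' Cw; rewrite !innerE -integral11D; [|exact: VC_inner..].
by apply: integral11_ext => x _; rewrite !mxE; ring.
Qed.

Lemma innerZl c u w : VC u -> VC w -> inner (fun x => c *: u x) w = c * inner u w.
Proof.
move=> Cu Cw; rewrite !innerE -integral11Z; last exact: VC_inner.
by apply: integral11_ext => x _; rewrite !mxE; ring.
Qed.

Lemma innerBl u u' w : VC u -> VC u' -> VC w ->
  inner (fun x => u x - u' x) w = inner u w - inner u' w.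
Proof.
move=> Cu Cu' Cw; rewrite !innerE -integral11B; [|exact: VC_inner..].
by apply: integral11_ext => x _; rewrite !mxE; ring.
Qed.

Lemma innerDr u u' w : VC u -> VC u' -> VC w ->
  inner w (fun x => u x + u' x) = inner w u + inner w u'.
Proof. by move=> *; rewrite innerC innerDl // !(innerC w). Qed.
Lemma innerBr u u' w : VC u -> VC u' -> VC w ->
  inner w (fun x => u x - u' x) = inner w u - inner w u'.
Proof. by move=> *; rewrite innerC innerBl // !(innerC w). Qed.
Lemma innerZr c u w : VC u -> VC w -> inner w (fun x => c *: u x) = c * inner w u.
Proof. by move=> *; rewrite innerC innerZl // !(innerC w). Qed.

Lemma inner_ge0 u : 0 <= inner u u.
Proof.
rewrite innerE; apply: integral11_ge0 => x _.
by rewrite -!expr2 addr_ge0 // sqr_ge0.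
Qed.

Lemma inner0l w : inner (fun=> 0) w = 0.
Proof.
by rewrite innerE (integral11_ext (v := fun=> 0)) ?integral11c ?mulr0 // => x _; rewrite !mxE; ring.
Qed.

Lemma inner_suml (I : Type) (s : seq I) (P : pred I) (F : I -> R -> 'cV[R]_2) w :
  (forall i, VC (F i)) -> VC w ->
  inner (fun x => \sum_(i <- s | P i) F i x) w = \sum_(i <- s | P i) inner (F i) w.
Proof.
move=> CF Cw; elim: s => [|i s IH].
  rewrite big_nil -(inner0l w); apply: inner_ext => // x _; by rewrite big_nil.
rewrite big_cons -IH; case Pi: (P i).
  rewrite -innerDl //; last exact: VC_sum.
  by apply: inner_ext => // x _; rewrite big_cons Pi.
by apply: inner_ext => // x _; rewrite big_cons Pi.
Qed.

Lemma inner_CS u w : VC u -> VC w ->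
  inner u w ^+ 2 <= inner u u * inner w w.
Proof.
move=> Cu Cw.
have H t : 0 <= inner u u * t ^+ 2 + 2 * t * inner u w + inner w w.
  have := inner_ge0 (fun x => t *: u x + w x).
  have Ct := VCZ t Cu.
  rewrite innerDl ?innerDr ?innerZl ?innerZr //; try exact: VCD.
  by rewrite (innerC w u); congr (_ <= _); ring.
have := inner_ge0 u; rewrite le_eqVlt => /predU1P[u0|u0].
  have [->|uw0] := eqVneq (inner u w) 0; first by rewrite expr0n /= -u0 mul0r.
  have := H (- (inner w w + 1) / (2 * inner u w)); rewrite -u0 mul0r add0r.
  have -> : 2 * (- (inner w w + 1) / (2 * inner u w)) * inner u w = - (inner w w + 1).
    by field.
  lra.
have := H (- inner u w / inner u u).
have un := lt0r_neq0 u0.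
have -> : inner u u * (- inner u w / inner u u) ^+ 2 +
  2 * (- inner u w / inner u u) * inner u w + inner w w = (inner u u * inner w w - inner u w ^+ 2) / inner u u.
  by field.
by rewrite pmulr_lge0 ?invr_gt0 // subr_ge0.
Qed.

Lemma inner_quad u w c : VC u -> VC w ->
  inner (fun x => u x - c *: w x) (fun x => u x - c *: w x) =
  inner u u - 2 * c * inner u w + c ^+ 2 * inner w w.
Proof.
move=> Cu Cw; have CZ := VCZ c Cw; have CB := VCB Cu CZ.
rewrite (innerBl Cu CZ CB) (innerBr Cu CZ Cu) (innerBr Cu CZ CZ).
rewrite (innerZl c Cw Cu) (innerZr c Cw Cu) (innerZl c Cw CZ) (innerZr c Cw Cw).
rewrite (innerC w u); ring.
Qed.

(** The weighted parallelogram bound u = (u - c w) + c w. *)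
Lemma inner_split u w c : VC u -> VC w -> inner u u <=
  2 * inner (fun x => u x - c *: w x) (fun x => u x - c *: w x) + 2 * c ^+ 2 * inner w w.
Proof.
move=> Cu Cw; have := inner_ge0 (fun x => u x - (2 * c) *: w x).
by rewrite !inner_quad //; lra.
Qed.

Definition sqn (a : 'cV[R]_2) : R := a 0 0 ^+ 2 + a 1 0 ^+ 2.

Lemma inner_sqn u : inner u u = integral11 (fun x => sqn (u x)).
Proof. by rewrite innerE; apply: integral11_ext => x _; rewrite /sqn !expr2. Qed.

(** The equation (A - l) y = h solved for the derivatives, entry by entry, so
    that the rules for HD apply. Changing l only moves a multiple of y to the
    right-hand side (dsys_shift). *)
Definition dsys (p r : R -> R) l y h :=
  HD (fun x => y x 0 0) (fun x => - (h x 1 0 + (r x + l) * y x 1 0)) /\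
  HD (fun x => y x 1 0) (fun x => h x 0 0 + (p x + l) * y x 0 0).

Section Fix.
Variables (p r : R -> R).

Lemma dirac_op0 y x : dirac_op p r y x 0 0 = derive_on y x 1 0 - p x * y x 0 0.
Proof.
rewrite /dirac_op /Jmx /Qmx !mxE !big_ord_recl !big_ord0 !mxE /=.
rewrite !mulr1n !mulr0n (_ : lift ord0 ord0 = 1); last exact/val_inj.
by rewrite (_ : ord0 = 0) //; ring.
Qed.

Lemma dirac_op1 y x : dirac_op p r y x 1 0 = - derive_on y x 0 0 - r x * y x 1 0.
Proof.
rewrite /dirac_op /Jmx /Qmx !mxE !big_ord_recl !big_ord0 !mxE /=.
rewrite !mulr1n !mulr0n (_ : lift ord0 ord0 = 1); last exact/val_inj.
by rewrite (_ : ord0 = 0) //; ring.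
Qed.

Lemma subZE (a b : 'cV[R]_2) l i j : (a - l *: b) i j = a i j - l * b i j.
Proof. by rewrite [LHS]mxE [X in _ + X]mxE [X in - X]mxE. Qed.

Hypotheses (Cp : C0 p) (Cr : C0 r).

Lemma dsys_VC l y h : dsys p r l y h -> VC y.
Proof. by move=> [/HD_C0 ? /HD_C0 ?]. Qed.

Lemma dsysP l y h : VC h ->
  dsys p r l y h <-> Ck 1 y /\ forall x, I11 x -> dirac_op p r y x - l *: y x = h x.
Proof.
move=> [Ch0 Ch1]; split.
  move=> /[dup] /dsys_VC [Cy0 Cy1] [H0 H1].
  pose y' x : 'cV[R]_2 := \col_i if i == 0 then - (h x 1 0 + (r x + l) * y x 1 0)
     else h x 0 0 + (p x + l) * y x 0 0.
  have Hy : VHD y y' by split; [apply: (HD_ext H0)|apply: (HD_ext H1)] => // x _; rewrite mxE.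
  split.
    apply/Ck1P; exists y' => //; split.
      have C : C0 (fun x => - (h x 1 0 + (r x + l) * y x 1 0)).
        by apply: C0N; apply: C0D => //; apply: C0M => //; apply: C0D => //; exact: C0c.
      by apply: (C0_ext C) => x _; rewrite mxE.
    have C : C0 (fun x => h x 0 0 + (p x + l) * y x 0 0).
      by apply: C0D => //; apply: C0M => //; apply: C0D => //; exact: C0c.
    by apply: (C0_ext C) => x _; rewrite mxE.
  move=> x xI; apply: col2P.
    by rewrite subZE dirac_op0 (VHD_eq_derive_on Hy) // mxE /=; ring.
  by rewrite subZE dirac_op1 (VHD_eq_derive_on Hy) // mxE /=; ring.
move=> [/Ck1P [y' Hy Cy'] E].
have E0 x : I11 x -> dirac_op p r y x 0 0 - l * y x 0 0 = h x 0 0.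
  by move=> xI; rewrite -E // subZE.
have E1 x : I11 x -> dirac_op p r y x 1 0 - l * y x 1 0 = h x 1 0.
  by move=> xI; rewrite -E // subZE.
split; [apply: (HD_ext Hy.1)|apply: (HD_ext Hy.2)] => // x xI.
  by rewrite -E1 // dirac_op1 (VHD_eq_derive_on Hy) //; ring.
by rewrite -E0 // dirac_op0 (VHD_eq_derive_on Hy) //; ring.
Qed.

Lemma dsys_ext l y y' h h' : dsys p r l y h -> (forall x, I11 x -> y x = y' x) ->
  (forall x, I11 x -> h x = h' x) -> dsys p r l y' h'.
Proof.
move=> [H0 H1] yy hh; split; [apply: (HD_ext H0)|apply: (HD_ext H1)] => x xI;
  by rewrite ?yy ?hh.
Qed.

Lemma dsysD l y h y' h' : dsys p r l y h -> dsys p r l y' h' ->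
  dsys p r l (fun x => y x + y' x) (fun x => h x + h' x).
Proof.
move=> [H0 H1] [H0' H1']; split.
  by apply: (HD_ext (HDD H0 H0')) => x xI; rewrite !mxE //; ring.
by apply: (HD_ext (HDD H1 H1')) => x xI; rewrite !mxE //; ring.
Qed.

Lemma dsysZ l c y h : dsys p r l y h ->
  dsys p r l (fun x => c *: y x) (fun x => c *: h x).
Proof.
move=> [H0 H1]; split.
  by apply: (HD_ext (HDZ c H0)) => x xI; rewrite !mxE //; ring.
by apply: (HD_ext (HDZ c H1)) => x xI; rewrite !mxE //; ring.
Qed.

Lemma dsysB l y h y' h' : dsys p r l y h -> dsys p r l y' h' ->
  dsys p r l (fun x => y x - y' x) (fun x => h x - h' x).
Proof.
move=> H /(dsysZ (-1)) H'; apply: (dsys_ext (dsysD H H')) => x _; by rewrite scaleN1r.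
Qed.

Lemma dsys_shift l m y h : dsys p r l y h ->
  dsys p r m y (fun x => h x + (l - m) *: y x).
Proof.
move=> [H0 H1]; split.
  by apply: (HD_ext H0) => x xI; rewrite ?mxE //; ring.
by apply: (HD_ext H1) => x xI; rewrite ?mxE //; ring.
Qed.

Lemma dsys0 l : dsys p r l (fun=> 0) (fun=> 0).
Proof.
by split; apply: (HD_ext (HDc 0)) => x _; rewrite ?mxE //; ring.
Qed.

(** The boundary form of Green's identity for the Dirac operator. *)
Definition bracket (a b : 'cV[R]_2) : R := a 1 0 * b 0 0 - a 0 0 * b 1 0.

(** The derivative of the bracket of y and z is the pointwise difference of the
    two integrands. *)
Lemma lagrange l y z h k : VC h -> VC k -> dsys p r l y h -> dsys p r l z k ->
  inner h z - inner y k = bracket (y 1) (z 1) - bracket (y (-1)) (z (-1)).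
Proof.
move=> Ch Ck Hy Hz; have Cy := dsys_VC Hy; have Cz := dsys_VC Hz.
rewrite !innerE -integral11B; [|exact: VC_inner..].
move: Hy Hz => [y0 y1] [z0 z1].
have H := HDB (HDM y1 z0) (HDM y0 z1).
rewrite (integral11_HD (U := fun x => y x 1 0 * z x 0 0 - y x 0 0 * z x 1 0)) //.
  by apply: (HD_ext H) => // x xI; ring.
by apply: C0B; exact: VC_inner.
Qed.

(** Gronwall's inequality for y0^2 + y1^2. In the derivative the terms with l
    cancel and p, r enter only through p - r, so the constant is independent of
    l. *)
Lemma energy_estimate : exists2 C : R, 0 < C & forall l y h, VC h -> dsys p r l y h ->
  forall x, I11 x -> sqn (y x) <= C * (sqn (y (-1)) + inner h h).
Proof.
have [M M0 HM] := C0_bounded (C0B Cp Cr).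
pose c := M + 1; have c0 : 0 < c by rewrite addr_gt0.
exists (expR c * expR c); first by rewrite mulr_gt0 // expR_gt0.
move=> l y h Ch Hy x xI.
pose E t := y t 0 0 * y t 0 0 + y t 1 0 * y t 1 0.
have [y0 y1] := Hy.
have HE := HDD (HDM y0 y0) (HDM y1 y1).
have Hexp : HD (fun t => expR (- c * t)) (fun t => - c * expR (- c * t)).
  apply: HD_is_derive => t _.
  have Hl : is_derive t 1 (fun s : R => - c * s) (- c).
    have := @is_deriveZ _ _ _ (@id R) (- c) t 1 1 (is_derive_id _ _).
    by rewrite /GRing.scale /= mulr1.
  have := @is_derive1_comp _ expR (fun s : R => - c * s) t _ _ (is_derive_expR _) Hl.
  by rewrite mulrC.
have HF := HDM Hexp HE.
have [H HH] := C0_primitive (VC_inner Ch Ch).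
have Hn : inner h h = H 1 - H (-1).
  by rewrite innerE (integral11_HD HH) //; exact: VC_inner.
have HG := HDB (HDZ (expR c) HH) HF.
have pos t : I11 t -> 0 <= h t 0 0 * h t 0 0 + h t 1 0 * h t 1 0.
  by move=> _; rewrite -!expr2 addr_ge0 // sqr_ge0.
have /andP[x1 x2] : -1 <= x <= 1 by exact/I11P.
have G1 : expR c * H (-1) - expR (- c * -1) * E (-1) <= expR c * H x - expR (- c * x) * E x.
  apply: (HD_le HG _ (lexx _) x1 x2) => t tI; have tI' : -1 <= t <= 1 by exact/I11P.
  have := HM t tI; have := pos t tI.
  have et : expR (- c * t) <= expR c.
    by rewrite ler_expR; nra.
  have et0 := expR_gt0 (- c * t).
  set e := expR (- c * t) in et et0 *; set e' := expR c in et *.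
  set h0 := h t 0 0; set h1 := h t 1 0; set a := y t 0 0; set b := y t 1 0.
  move=> hp pr.
  have key : (- (h1 + (r t + l) * b) * a + a * - (h1 + (r t + l) * b)
     + ((h0 + (p t + l) * a) * b + b * (h0 + (p t + l) * a)))
     <= (h0 * h0 + h1 * h1) + c * (a * a + b * b).
    have s1 := sqr_ge0 (a + h1); have s2 := sqr_ge0 (b - h0).
    move: pr; rewrite ler_norml => /andP[pr1 pr2].
    (* 2 (p - r) a b <= M (a^2 + b^2), split into two squares for the arithmetic solver *)
    have s3 : 0 <= (M - (p t - r t)) * (a + b) ^+ 2 by rewrite mulr_ge0 ?sqr_ge0 // subr_ge0.
    have s4 : 0 <= (M + (p t - r t)) * (a - b) ^+ 2 by rewrite mulr_ge0 ?sqr_ge0 //; lra.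
    rewrite /c; lra.
  have : e * (h0 * h0 + h1 * h1) <= e' * (h0 * h0 + h1 * h1) by rewrite ler_wpM2r.
  have := ler_wpM2l (ltW et0) key.
  lra.
have Hx1 : H x <= H 1 by apply: (HD_le HH pos x1 x2 (lexx _)).
have F0 : 0 <= sqn (y (-1)) + inner h h by rewrite addr_ge0 ?inner_ge0 // /sqn addr_ge0 // sqr_ge0.
have EE t : E t = sqn (y t) by rewrite /E /sqn !expr2.
rewrite -EE -[E x](mulKf (lt0r_neq0 (expR_gt0 (- c * x)))).
rewrite -expRN mulNr opprK -mulNr -mulrA.
have ec0 := expR_gt0 c.
apply: (@le_trans _ _ (expR c * (expR (- c * x) * E x))).
  apply: ler_wpM2r.
    by rewrite mulr_ge0 ?expR_ge0 // EE /sqn addr_ge0 // sqr_ge0.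
  by rewrite ler_expR; nra.
rewrite ler_wpM2l ?expR_ge0 //.
rewrite -EE Hn; move: G1; rewrite mulrN1 opprK => G1.
have := ler_wpM2l (ltW ec0) Hx1; lra.
Qed.

End Fix.
End Dirac.

(** * Power series with geometrically dominated coefficients *)

Section PowerSeries.
Context {R : realType}.

Lemma geom_dominated_cvg (a : nat -> R) (D k x : R) : (forall m, `|a m| <= D * k ^+ m) ->
  0 <= k -> `|x| * k < 1 -> cvgn (pseries a x).
Proof.
move=> Ha k0 xk; rewrite /pseries; apply: normed_cvg.
have D0 : 0 <= D by have := Ha 0%N; rewrite expr0 mulr1; apply: le_trans.
apply: (@series_le_cvg _ _ (geometric D (`|x| * k))).
- by move=> n /=.
- by move=> n /=; rewrite mulr_ge0 // exprn_ge0 // mulr_ge0.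
- move=> n /=; rewrite normrM normrX exprMn mulrCA mulrC.
  by rewrite ler_wpM2l ?exprn_ge0.
- by apply: is_cvg_geometric_series; rewrite ger0_norm // mulr_ge0.
Qed.

Lemma diffs_dominated (a : nat -> R) (D k : R) : 0 <= k -> (forall m, `|a m| <= D * k ^+ m) ->
  forall m, `|pseries_diffs a m| <= D * k * (2 * k) ^+ m.
Proof.
move=> k0 Ha m; rewrite /pseries_diffs normrM ger0_norm ?ler0n //.
have D0 : 0 <= D by have := Ha 0%N; rewrite expr0 mulr1; apply: le_trans.
apply: (@le_trans _ _ (2 ^+ m * (D * k ^+ m.+1))).
  by apply: ler_pM => //; rewrite -natrX ler_nat ltn_expl.
by rewrite exprS exprMn le_eqVlt; apply/orP; left; apply/eqP; ring.
Qed.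

(** The comparison radius 1 / (8 k) leaves room for the growth of the
    coefficients of two successive termwise derivatives, each of which doubles
    the ratio k. *)
Lemma pseries_is_derive (a : nat -> R) (D k x : R) : 0 < k -> (forall m, `|a m| <= D * k ^+ m) ->
  `|x| * (8 * k) < 1 ->
  is_derive x 1 (fun y => limn (pseries a y)) (limn (pseries (pseries_diffs a) x)).
Proof.
move=> k0 Ha xk; have k0' := ltW k0.
have H1 := diffs_dominated k0' Ha.
have k2 : 0 <= 2 * k by rewrite mulr_ge0.
have H2 := diffs_dominated k2 H1.
pose K := (8 * k)^-1.
have K0 : 0 < K by rewrite invr_gt0 mulr_gt0.
have K8 : K * (8 * k) = 1 by rewrite mulVf // gt_eqF // mulr_gt0.
have KE : `|K| = K by rewrite gtr0_norm.
apply: (@pseries_snd_diffs _ _ K).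
- by apply: geom_dominated_cvg Ha k0' _; rewrite KE; nra.
- by apply: geom_dominated_cvg H1 k2 _; rewrite KE; nra.
- by apply: geom_dominated_cvg H2 _ _; rewrite ?KE; nra.
- by rewrite KE /K -(ltr_pM2r (_ : 0 < 8 * k)) ?mulr_gt0 // K8.
Qed.

(** Termwise differentiation, applied to the resolvent expansion of the Green
    matrix. Differentiation multiplies the ratio k by 2, so each step of the
    induction shrinks the disc. *)
Lemma derive1n_mx_pseries (m n : nat) (F : R -> 'M[R]_(m, n)) (a : 'I_m -> 'I_n -> nat -> R)
  (D k rho : R) : 0 < k -> 0 < rho -> (forall i j l, `|a i j l| <= D * k ^+ l) ->
  (forall x, `|x| < rho -> forall i j, pseries (a i j) x @ \oo --> F x i j) ->
  forall d i j, derive1n d F 0 i j = d`!%:R * a i j d.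
Proof.
move=> k0 rho0 Ha HF d.
have : exists (D' k' rho' : R), [/\ 0 < k', 0 < rho',
   (forall i j l, `|iter d (@pseries_diffs R) (a i j) l| <= D' * k' ^+ l) &
   (forall x, `|x| < rho' -> forall i j,
      pseries (iter d (@pseries_diffs R) (a i j)) x @ \oo --> derive1n d F x i j)].
  elim: d => [|d [D' [k' [rho' [k'0 rho'0 Ha' HF']]]]]; first by exists D, k, rho.
  exists (D' * k'), (2 * k'), (Num.min rho' (8 * k')^-1); split.
  - by rewrite mulr_gt0.
  - by rewrite lt_min rho'0 invr_gt0 mulr_gt0.
  - by move=> i j; exact: diffs_dominated (ltW k'0) (Ha' i j).
  - move=> x; rewrite lt_min => /andP[xr xk] i j.
    have xk8 : `|x| * (8 * k') < 1.
      by rewrite -ltr_pdivlMr ?mulr_gt0 // div1r.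
    have cd : cvgn (pseries (pseries_diffs (iter d (@pseries_diffs R) (a i j))) x).
      apply: geom_dominated_cvg (diffs_dominated (ltW k'0) (Ha' i j)) _ _.
        by rewrite mulr_ge0 // ltW.
      have := normr_ge0 x; nra.
    rewrite iterS.
    have -> : derive1n d.+1 F x i j = limn (pseries (pseries_diffs (iter d (@pseries_diffs R) (a i j))) x); last exact: cd.
    rewrite derive1nS derive1E.
    pose Lm : 'M[R]_(m, n) := \matrix_(i, j) limn (pseries (pseries_diffs (iter d (@pseries_diffs R) (a i j))) x).
    suff H : h^-1 *: ((derive1n d F \o shift x) (h *: 1) - derive1n d F x) @[h --> 0^'] --> Lm.
      by rewrite /derive (cvg_lim _ H) // mxE.
    apply/cvg_mx => i' j'; rewrite mxE.
    have [dv <-] := pseries_is_derive k'0 (Ha' i' j') xk8.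
    rewrite /derive; move: dv => /cvg_ex[l Hl]; rewrite (cvg_lim _ Hl) //.
    apply: cvg_trans Hl; apply: near_eq_cvg; near=> h.
    rewrite !mxE /=; congr (_ * _).
    have -> : derive1n d F x i' j' = limn (pseries (iter d (@pseries_diffs R) (a i' j')) x).
      by apply/esym/cvg_lim => //; exact: HF'.
    have -> // : derive1n d F (h * 1 + x) i' j' = limn (pseries (iter d (@pseries_diffs R) (a i' j')) (h * 1 + x)).
    apply/esym/cvg_lim => //; apply: HF'; rewrite mulr1.
    apply: le_lt_trans (ler_normD _ _) _; rewrite -ltrBrDr.
    near: h; apply: dnbhs0_lt; by rewrite subr_gt0.
move=> [D' [k' [rho' [_ rho'0 _ HF']]]] i j.
have := HF' 0 _ i j; rewrite normr0 => /(_ rho'0) H.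
rewrite (cvg_unique _ H (_ : pseries (iter d (@pseries_diffs R) (a i j)) 0 @ \oo --> iter d (@pseries_diffs R) (a i j) 0%N)) //.
  have E (b : nat -> R) (l : nat) : iter d (@pseries_diffs R) b l = (\prod_(s < d) (l + s.+1)%:R) * b (l + d)%N.
    elim: d b l {HF' H} => [|d IH] b l; first by rewrite big_ord0 mul1r addn0.
    rewrite iterS /pseries_diffs IH mulrA big_ord_recl addn1 addSnnS; congr (_ * _ * _).
    by apply: eq_bigr => s _; rewrite /= addSnnS.
  rewrite E add0n; congr (_ * _); elim: d {HF' H E} => [|d IH]; first by rewrite big_ord0.
  by rewrite big_ord_recr /= IH add0n factS natrM mulrC.
apply/cvgrPdist_le => e e0; exists 1%N => // -[//|l] /= _.
rewrite /pseries /series /= big_nat_recl // expr0 mulr1 big1 ?addr0 ?subrr ?normr0 ?(ltW e0) //.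
by move=> s _; rewrite expr0n /= mulr0.
Unshelve. all: by end_near. Qed.

End PowerSeries.

(** * Convergent linear systems and tail sums *)

Section Systems.
Context {R : realType}.

Lemma cvg_bigsum (I : Type) (s : seq I) (F : I -> nat -> R) (L : I -> R) :
  (forall i, F i @ \oo --> L i) -> (fun N => \sum_(i <- s) F i N) @ \oo --> \sum_(i <- s) L i.
Proof.
move=> H; elim: s => [|i s IH].
  rewrite big_nil [X in X @ _](_ : _ = fun=> 0); first exact: cvg_cst.
  by apply/funext => N; rewrite big_nil.
rewrite big_cons [X in X @ _](_ : _ = fun N => F i N + \sum_(j <- s) F j N).
  exact: cvgD.
by apply/funext => N; rewrite big_cons.
Qed.

Lemma cvg_bigprod (I : Type) (s : seq I) (F : I -> nat -> R) (L : I -> R) :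
  (forall i, F i @ \oo --> L i) -> (fun N => \prod_(i <- s) F i N) @ \oo --> \prod_(i <- s) L i.
Proof.
move=> H; elim: s => [|i s IH].
  rewrite big_nil [X in X @ _](_ : _ = fun=> 1); first exact: cvg_cst.
  by apply/funext => N; rewrite big_nil.
rewrite big_cons [X in X @ _](_ : _ = fun N => F i N * \prod_(j <- s) F j N).
  exact: cvgM.
by apply/funext => N; rewrite big_cons.
Qed.

Lemma cvg_exp (F : nat -> R) (L : R) k : F @ \oo --> L -> (fun N => F N ^+ k) @ \oo --> L ^+ k.
Proof.
move=> H; elim: k => [|k IH]; first exact: cvg_cst.
by rewrite exprS [X in X @ _](_ : _ = fun N => F N * F N ^+ k); [exact: cvgM|apply/funext => N; rewrite exprS].
Qed.

Lemma cvg_det m (A : nat -> 'M[R]_m) (L : 'M[R]_m) :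
  (forall i j, (fun N => A N i j) @ \oo --> L i j) -> (fun N => \det (A N)) @ \oo --> \det L.
Proof.
move=> H; apply: cvg_bigsum => s; apply: cvgM; first exact: cvg_cst.
by apply: cvg_bigprod => i; exact: H.
Qed.

Lemma cvg_adj m (A : nat -> 'M[R]_m) (L : 'M[R]_m) i j :
  (forall i j, (fun N => A N i j) @ \oo --> L i j) ->
  (fun N => (\adj (A N)) i j) @ \oo --> (\adj L) i j.
Proof.
move=> H; rewrite mxE [X in X @ _](_ : _ = fun N => cofactor (A N) j i).
  apply: cvgM; first exact: cvg_cst.
  apply: cvg_det => i' j'; rewrite !mxE.
  by rewrite [X in X @ _](_ : _ = fun N => A N (lift j i') (lift i j')); [exact: H|apply/funext => N; rewrite !mxE].
by apply/funext => N; rewrite mxE.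
Qed.

(** Cramer's rule is continuous in the entries where the determinant does not
    vanish. *)
Lemma cvg_system m (A : nat -> 'M[R]_m) (L : 'M[R]_m) (b : nat -> 'rV[R]_m) (b0 : 'rV[R]_m) :
  (forall i j, (fun N => A N i j) @ \oo --> L i j) ->
  (forall j, (fun N => b N 0 j) @ \oo --> b0 0 j) -> \det L != 0 ->
  exists y : nat -> 'rV[R]_m, exists2 y0 : 'rV[R]_m, y0 *m L = b0 &
    (forall j, (fun N => y N 0 j) @ \oo --> y0 0 j) /\
    \forall N \near \oo, forall z, z *m A N = b N <-> z = y N.
Proof.
move=> HA Hb L0; have HD := cvg_det HA.
have unit_det (B : 'M[R]_m) : \det B != 0 -> B \in unitmx by rewrite unitmxE unitfE.
exists (fun N => (\det (A N))^-1 *: (b N *m \adj (A N))).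
exists (b0 *m invmx L); first by rewrite mulmxKV // unit_det.
split.
  move=> j; rewrite /invmx unit_det // -scalemxAr mxE.
  rewrite [X in X @ _](_ : _ = fun N => (\det (A N))^-1 * \sum_k b N 0 k * \adj (A N) k j).
    rewrite [X in _ * X]mxE; apply: cvgM; first exact: cvgV.
    by apply: cvg_bigsum => k; apply: cvgM; [exact: Hb|exact: cvg_adj].
  by apply/funext => N; rewrite mxE [X in _ * X]mxE.
have : \forall N \near \oo, \det (A N) != 0.
  have /cvgrPdist_lt/(_ `|\det L|) := HD; rewrite normr_gt0 => /(_ L0).
  apply: filterS => N; apply: contraTneq => ->; by rewrite subr0 ltxx.
apply: filterS => N dN z; have uN := unit_det _ dN.
have E : (\det (A N))^-1 *: (b N *m \adj (A N)) = b N *m invmx (A N).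
  by rewrite /invmx uN -scalemxAr.
rewrite E; split=> [<-|->]; [by rewrite mulmxK|by rewrite mulmxKV].
Qed.

Lemma vanish_poly q (y : 'I_q -> R) (I : finType) (S : {set I}) (X : I -> R) :
  #|S| = q -> {in S &, injective X} ->
  (forall s, s \in S -> \sum_(k < q) X s ^+ k * y k = 0) -> forall k, y k = 0.
Proof.
move=> Sq Xi H.
pose P := \poly_(k < q) (if insub k is Some i then y i else 0).
have PX x : P.[x] = \sum_(k < q) x ^+ k * y k.
  by rewrite horner_poly; apply: eq_bigr => k _; rewrite valK mulrC.
have P0 : P = 0.
  apply: (@roots_geq_poly_eq0 _ _ [seq X s | s <- enum S]).
  - by apply/allP => x /mapP[s]; rewrite mem_enum => sS ->; rewrite rootE PX H.
  - rewrite map_inj_in_uniq ?enum_uniq // => a b; rewrite !mem_enum; exact: Xi.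
  - by rewrite size_map -cardE Sq size_poly.
move=> k; have := coef_poly q (fun k => if insub k is Some i then y i else 0) k.
by rewrite -/P P0 coef0 ltn_ord valK.
Qed.

(** A polynomial of degree q with leading coefficient a that vanishes at q
    distinct points is a times the product of the linear factors. *)
Lemma monic_interp q (a : R) (y : 'I_q -> R) (I : finType) (S : {set I}) (X : I -> R) :
  #|S| = q -> {in S &, injective X} ->
  (forall s, s \in S -> \sum_(k < q) X s ^+ k * y k + a * X s ^+ q = 0) ->
  forall x, \sum_(k < q) x ^+ k * y k + a * x ^+ q = a * \prod_(s in S) (x - X s).
Proof.
move=> Sq Xi H.
pose V := \prod_(s <- enum S) ('X - (X s)%:P).
have sV : size V = q.+1 by rewrite size_prod_XsubC -cardE Sq.
have mV : V`_q = 1.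
  by have /monicP := monic_prod_XsubC (enum S) xpredT X; rewrite lead_coefE sV.
have VX x : V.[x] = \sum_(k < q) x ^+ k * V`_k + x ^+ q.
  rewrite horner_coef sV big_ord_recr /= mV mul1r; congr (_ + _).
  by apply: eq_bigr => k _; rewrite mulrC.
have VE x : V.[x] = \prod_(s in S) (x - X s).
  rewrite horner_prod big_enum /=; apply: eq_bigr => s _; by rewrite hornerXsubC.
have Z : forall k : 'I_q, y k - a * V`_k = 0.
  apply: (vanish_poly Sq Xi) => s sS.
  have := VX (X s); rewrite VE (bigD1 s) //= subrr mul0r => V0.
  have := H s sS.
  under [X in _ -> X = 0]eq_bigr do rewrite mulrBr mulrCA.
  rewrite sumrB -mulr_sumr => h1.
  have h2 : \sum_(k < q) X s ^+ k * V`_k = - X s ^+ q by lra.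
  rewrite h2; lra.
move=> x; rewrite -VE VX mulrDr mulr_sumr; congr (_ + _).
by apply: eq_bigr => k _; rewrite mulrCA; congr (_ * _); apply/eqP; rewrite -subr_eq0 Z.
Qed.

(** Row s of the linear system for the defects: X s is the node, a s and b s
    the boundary factors of the eigenfunction. *)
Definition two_block q (X a b : 'I_(2 * q) -> R) (z z' : 'I_q -> R) s :=
  \sum_(k < q) X s ^+ k * (a s * z k - b s * z' k).

Lemma addqq q : (q + q = 2 * q)%N. Proof. by rewrite addnn mul2n. Qed.

Definition block_mat q (X a b : 'I_(2 * q) -> R) : 'M[R]_(q + q) :=
  col_mx (\matrix_(k, j) (X (cast_ord (addqq q) j) ^+ k * a (cast_ord (addqq q) j)))
         (\matrix_(k, j) - (X (cast_ord (addqq q) j) ^+ k * b (cast_ord (addqq q) j))).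

Lemma mul_block_mat q (X a b : 'I_(2 * q) -> R) (w : 'rV[R]_(q + q)) j :
  (w *m block_mat X a b) 0 j =
  two_block X a b (fun k => w 0 (lshift q k)) (fun k => w 0 (rshift q k)) (cast_ord (addqq q) j).
Proof.
rewrite mxE big_split_ord /= -big_split; apply: eq_bigr => k _.
by rewrite /block_mat col_mxEu col_mxEd !mxE /=; ring.
Qed.

Lemma block_system q (X a b rhs : 'I_(2 * q) -> R) (w : 'rV[R]_(q + q)) :
  w *m block_mat X a b = \row_j rhs (cast_ord (addqq q) j) <->
  forall s, two_block X a b (fun k => w 0 (lshift q k)) (fun k => w 0 (rshift q k)) s = rhs s.
Proof.
split=> [/rowP H s|H]; last by apply/rowP => j; rewrite mul_block_mat H mxE.
by have := H (cast_ord (esym (addqq q)) s); rewrite mul_block_mat mxE cast_ordKV.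
Qed.

(** On the rows of E the limit of the right boundary factor is K, on the others
    -K. *)
Definition psign (I : finType) (E : {set I}) s : R := if s \in E then 1 else -1.

Lemma two_blockE q (X : 'I_(2 * q) -> R) (K : R) (E : {set 'I_(2 * q)}) (z z' : 'I_q -> R) s :
  two_block X (fun s => K * psign E s) (fun=> K) z z' s =
  K * psign E s * \sum_(k < q) X s ^+ k * (z k - psign E s * z' k).
Proof.
rewrite mulr_sumr; apply: eq_bigr => k _; rewrite /psign.
by case: (s \in E); ring.
Qed.

(** In the limit the rows of E only see the differences and the other rows the
    sums of the unknowns, and a polynomial of degree less than q with q
    distinct zeros vanishes. *)
Lemma block_regular q (X : 'I_(2 * q) -> R) (K : R) (E : {set 'I_(2 * q)}) : K != 0 ->
  #|E| = q -> #|~: E| = q -> {in E &, injective X} -> {in ~: E &, injective X} ->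
  \det (block_mat X (fun s => K * psign E s) (fun=> K)) != 0.
Proof.
move=> K0 Eq Oq EX OX; apply/negP => /det0P[w w0 H].
have {}H : w *m block_mat X (fun s => K * psign E s) (fun=> K) =
    \row_j (fun=> 0) (cast_ord (addqq q) j) by rewrite H; apply/rowP => j; rewrite !mxE.
have {}H := (block_system _ _ _ (fun=> 0) w).1 H; apply/negP: w0; rewrite negbK; apply/eqP.
have HE := vanish_poly (y := fun k => w 0 (lshift q k) - w 0 (rshift q k)) Eq EX.
have HO := vanish_poly (y := fun k => w 0 (lshift q k) + w 0 (rshift q k)) Oq OX.
have {}HE k : w 0 (lshift q k) - w 0 (rshift q k) = 0.
  apply: HE => s sE; have := H s; rewrite two_blockE /psign sE mulr1 => /eqP.
  by rewrite mulf_eq0 (negPf K0) /= => /eqP h; rewrite -[RHS]h; apply: eq_bigr => j _; rewrite mul1r.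
have {}HO k : w 0 (lshift q k) + w 0 (rshift q k) = 0.
  apply: HO => s; rewrite inE => sE; have := H s; rewrite two_blockE /psign (negPf sE) => /eqP.
  rewrite mulf_eq0 mulrN1 oppr_eq0 (negPf K0) /= => /eqP h.
  by rewrite -[RHS]h; apply: eq_bigr => j _; rewrite mulN1r opprK.
apply/rowP => i; rewrite mxE; case: (split_ordP i) => k ->.
  by have := HE k; have := HO k; lra.
by have := HE k; have := HO k; lra.
Qed.

(** The limit data z, z' are given by the limit equations, from which their
    generating polynomials are read off. The eventual system determines the
    unknowns, which yields existence as well as convergence. *)
Lemma block_cvg q (X a b rhs : nat -> 'I_(2 * q) -> R) (X0 rhs0 : 'I_(2 * q) -> R) (K : R)
    (E : {set 'I_(2 * q)}) : K != 0 ->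
  #|E| = q -> #|~: E| = q -> {in E &, injective X0} -> {in ~: E &, injective X0} ->
  (forall s, (fun N => X N s) @ \oo --> X0 s) ->
  (forall s, (fun N => a N s) @ \oo --> K * psign E s) ->
  (forall s, (fun N => b N s) @ \oo --> K) ->
  (forall s, (fun N => rhs N s) @ \oo --> rhs0 s) ->
  exists y y' : nat -> 'I_q -> R, exists z z' : 'I_q -> R,
  [/\ (forall s, K * psign E s * \sum_(k < q) X0 s ^+ k * (z k - psign E s * z' k) = rhs0 s),
      (forall k, (fun N => y N k) @ \oo --> z k),
      (forall k, (fun N => y' N k) @ \oo --> z' k) &
      \forall N \near \oo, forall w w', (forall s, two_block (X N) (a N) (b N) w w' s = rhs N s) <->
        (forall k, w k = y N k) /\ (forall k, w' k = y' N k)].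
Proof.
move=> K0 Eq Oq EX OX HX Ha Hb Hr.
have [||y [y0 Hy0 [Hy HN]]] := cvg_system (A := fun N => block_mat (X N) (a N) (b N))
  (b := fun N => \row_j rhs N (cast_ord (addqq q) j))
  (b0 := \row_j rhs0 (cast_ord (addqq q) j)) _ _ (block_regular K0 Eq Oq EX OX).
- move=> i j; case: (split_ordP i) => k ->.
    rewrite /block_mat col_mxEu mxE.
    rewrite [X in X @ _](_ : _ = fun N => X N (cast_ord (addqq q) j) ^+ k * a N (cast_ord (addqq q) j)).
      by apply: cvgM; [exact: cvg_exp|exact: Ha].
    by apply/funext => N; rewrite col_mxEu mxE.
  rewrite /block_mat col_mxEd mxE.
  rewrite [X in X @ _](_ : _ = fun N => - (X N (cast_ord (addqq q) j) ^+ k * b N (cast_ord (addqq q) j))).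
    by apply: cvgN; apply: cvgM; [exact: cvg_exp|exact: Hb].
  by apply/funext => N; rewrite col_mxEd mxE.
- move=> j; rewrite mxE [X in X @ _](_ : _ = fun N => rhs N (cast_ord (addqq q) j)); first exact: Hr.
  by apply/funext => N; rewrite mxE.
exists (fun N k => y N 0 (lshift q k)), (fun N k => y N 0 (rshift q k)).
exists (fun k => y0 0 (lshift q k)), (fun k => y0 0 (rshift q k)); split=> //.
  by move=> s; rewrite -two_blockE; exact: (block_system _ _ _ rhs0 y0).1 Hy0 s.
apply: filterS HN => N HN w w'.
pose W : 'rV[R]_(q + q) := row_mx (\row_k w k) (\row_k w' k).
have Wl k : W 0 (lshift q k) = w k by rewrite /W row_mxEl mxE.
have Wr k : W 0 (rshift q k) = w' k by rewrite /W row_mxEr mxE.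
have TB s : two_block (X N) (a N) (b N) w w' s =
    two_block (X N) (a N) (b N) (fun k => W 0 (lshift q k)) (fun k => W 0 (rshift q k)) s.
  by apply: eq_bigr => k _; rewrite Wl Wr.
split=> [H|[H1 H2]].
  have /HN WE : W *m block_mat (X N) (a N) (b N) = \row_j rhs N (cast_ord (addqq q) j).
    by apply/(block_system _ _ _ (rhs N)) => s; rewrite -TB.
  by split=> k; rewrite -?Wl -?Wr WE.
move=> s; rewrite TB; move: s; apply/(block_system _ _ _ (rhs N) W)/HN.
by apply/rowP => i; case: (split_ordP i) => k ->; rewrite ?Wl ?Wr.
Qed.

End Systems.

Section Tails.
Context {R : realType}.
Implicit Types (P : {poly R}) (a b : nat -> int -> R).

(** First and second order bounds on [-1,1], by a joint induction: the second
    order bound for X P needs the first order bound for P. *)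
Lemma poly_taylor P : exists2 L : R, 0 <= L & forall s t : R, -1 <= s <= 1 -> -1 <= t <= 1 ->
  `|P.[s] - P.[t]| <= L * `|s - t| /\
  `|P.[s] - P.[t] - (deriv P).[s] * (s - t)| <= L * (s - t) ^+ 2.
Proof.
elim/poly_ind: P => [|P c [L L0 HL]].
  exists 0 => // s t _ _; rewrite deriv0 !horner0 !(subrr, mul0r, normr0).
  by split.
exists (2 * L + `|P.[0]|); first by rewrite addr_ge0 ?mulr_ge0.
move=> s t sI tI; have [H1 H2] := HL s t sI tI.
have z0 : -1 <= (0 : R) <= 1 by apply/andP; split; lra.
have [H3 _] := HL t 0 tI z0.
rewrite !poly.derivE !hornerE /=.
have n1 : `|s| <= 1 by rewrite ler_norml.
have n2 : `|t| <= 1 by rewrite ler_norml.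
have n3 : `|P.[t]| <= L + `|P.[0]|.
  rewrite -[P.[t]](subrK P.[0]); apply: le_trans (ler_normD _ _) _.
  rewrite subr0 in H3; rewrite lerD2r; apply: le_trans H3 _; nra.
split.
  rewrite (_ : _ - _ = (P.[s] - P.[t]) * s + P.[t] * (s - t)); last ring.
  apply: le_trans (ler_normD _ _) _; rewrite !normrM.
  have : `|P.[s] - P.[t]| * `|s| <= L * `|s - t| by rewrite -[leRHS]mulr1 ler_pM.
  have : `|P.[t]| * `|s - t| <= (L + `|P.[0]|) * `|s - t| by rewrite ler_wpM2r.
  lra.
rewrite (_ : _ - _ = (P.[s] - P.[t] - (deriv P).[s] * (s - t)) * s - (P.[s] - P.[t]) * (s - t)); last ring.
apply: le_trans (ler_normB _ _) _; rewrite !normrM.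
have : `|P.[s] - P.[t] - (deriv P).[s] * (s - t)| * `|s| <= L * (s - t) ^+ 2.
  by rewrite -[leRHS]mulr1 ler_pM.
have : `|P.[s] - P.[t]| * `|s - t| <= L * (s - t) ^+ 2.
  by rewrite -(real_normK (num_real (s - t))) expr2 mulrA ler_wpM2r.
have : 0 <= `|P.[0]| * (s - t) ^+ 2 by rewrite mulr_ge0 ?sqr_ge0.
lra.
Qed.

Lemma poly_primitive P : exists Q, (deriv Q) = P.
Proof.
exists (\poly_(i < (size P).+1) (P`_i.-1 / i%:R)).
apply/polyP => i; rewrite coef_deriv coef_poly ltnS /=.
case: ltnP => iP; last by rewrite mul0rn nth_default.
by rewrite -[_ *+ _]mulr_natr mulfVK // pnatr_eq0.
Qed.

Lemma HD_poly P : HD (fun x => P.[x]) (fun x => (deriv P).[x]).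
Proof.
elim/poly_ind: P => [|P c IH].
  by apply: (HD_ext (HDc 0)) => x _; rewrite ?deriv0 ?horner0.
by apply: (HD_ext (HDD (HDM IH HDid) (HDc c))) => x _; rewrite !(poly.derivE, hornerE) /=; ring.
Qed.

Lemma integral11_poly P : integral11 (fun x => (deriv P).[x]) = P.[1] - P.[-1].
Proof.
have Cd : C0 (fun x => (deriv P).[x]) by apply: (HD_C0 (@HD_poly (deriv P))).
by rewrite (integral11_HD (@HD_poly P) Cd).
Qed.

(** Its increment over [0,1] is that of P over [-1,1]; it merges the
    contributions of n and -n. *)
Definition oddify P := P - (P \Po (- 'X)).

Lemma oddifyE P x : (oddify P).[x] = P.[x] - P.[- x].
Proof. by rewrite /oddify hornerD hornerN horner_comp hornerN hornerX. Qed.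

Lemma oddify_deriv P x : (deriv (oddify P)).[x] = (deriv P).[x] + (deriv P).[- x].
Proof. by rewrite /oddify derivB deriv_comp derivN derivX mulrN1 opprK hornerD horner_comp hornerN hornerX. Qed.

(** The points N/k of one parity are N/k and N/(k+2), at distance about 2N/k^2;
    replacing N/k^2 by half the distance costs a relative error of about 2/k,
    and replacing the derivative by an increment costs the square of the
    distance. *)
Lemma tail_step P : exists2 C : R, 0 <= C & forall N k : nat, (0 < N)%N -> (N < k)%N ->
  `|N%:R / k%:R ^+ 2 * (deriv P).[N%:R / k%:R] - (P.[N%:R / k%:R] - P.[N%:R / k.+2%:R]) / 2|
    <= C / N%:R * (N%:R / k%:R ^+ 2).
Proof.
have [L L0 HL] := poly_taylor P; have [M M0 HM] := poly_taylor (deriv P).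
exists (2 * (M + `|(deriv P).[0]|) + 2 * L); first by rewrite addr_ge0 ?mulr_ge0 ?addr_ge0.
move=> N k N0 Nk.
have n0 : 0 < N%:R :> R by rewrite ltr0n.
have nk : N%:R < k%:R :> R by rewrite ltr_nat.
have k2 : k.+2%:R = k%:R + 2 :> R by rewrite -addn2 natrD.
rewrite k2; move: n0 nk; move: N%:R k%:R => n x n0 nx.
have x0 : 0 < x by lra.
have s1 : 0 <= n / x <= 1 by rewrite divr_ge0 ?ler_pdivrMr ?mul1r //; lra.
have t1 : 0 <= n / (x + 2) <= 1 by rewrite divr_ge0 ?ler_pdivrMr ?mul1r //; lra.
have [_ H1] := HL (n / x) (n / (x + 2)) (ltac:(lra)) (ltac:(lra)).
have [H2 _] := HM (n / x) 0 (ltac:(lra)) (ltac:(lra)).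
have H3 : `|(deriv P).[n / x]| <= M + `|(deriv P).[0]|.
  rewrite -[(deriv P).[n / x]](subrK (deriv P).[0]); apply: le_trans (ler_normD _ _) _.
  rewrite lerD2r; apply: le_trans H2 _; rewrite subr0 ger0_norm; nra.
have E1 : n / x - n / (x + 2) = 2 * n / (x * (x + 2)) by field; rewrite !gt_eqF //; lra.
have E2 : n / x ^+ 2 - (n / x - n / (x + 2)) / 2 = n / x ^+ 2 * (2 / (x + 2)).
  by field; rewrite !gt_eqF //; lra.
have w0 : 0 <= n / x ^+ 2 by rewrite divr_ge0 ?sqr_ge0 //; lra.
have B1 : 2 / (x + 2) <= 2 / n by rewrite ler_pM2l // lef_pV2 ?posrE //; lra.
have B2 : (n / x - n / (x + 2)) ^+ 2 <= n / x ^+ 2 * (4 / n).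
  have B : 0 <= n / x - n / (x + 2) <= 2 / x.
    rewrite E1; apply/andP; split; first by rewrite divr_ge0 ?mulr_ge0 //; lra.
    rewrite -mulf_div -[leRHS]mulr1 ler_wpM2l ?divr_ge0 //; first lra.
    by rewrite ler_pdivrMr ?mul1r; lra.
  have -> : n / x ^+ 2 * (4 / n) = (2 / x) ^+ 2 by field; rewrite !gt_eqF.
  by rewrite ler_sqr ?nnegrE //; lra.
set p1 := (deriv P).[n / x] in H1 H3 *; set p2 := P.[n / x] in H1 *; set p3 := P.[_] in H1 *.
have -> : n / x ^+ 2 * p1 - (p2 - p3) / 2 = (n / x ^+ 2 - (n / x - n / (x + 2)) / 2) * p1
   - (p2 - p3 - p1 * (n / x - n / (x + 2))) / 2 by ring.
have EN : 0 <= n / x ^+ 2 * (2 / (x + 2)) by rewrite mulr_ge0 // divr_ge0 //; lra.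
rewrite E2; apply: le_trans (ler_normB _ _) _; rewrite normrM (ger0_norm EN) normrM.
have -> : `|2^-1| = 2^-1 :> R by rewrite ger0_norm // invr_ge0.
have A1 : n / x ^+ 2 * (2 / (x + 2)) * `|p1| <= n / x ^+ 2 * (2 / n) * (M + `|(deriv P).[0]|).
  by apply: ler_pM => //; rewrite ler_wpM2l.
have A2 : L * (n / x - n / (x + 2)) ^+ 2 <= L * (n / x ^+ 2 * (4 / n)) by rewrite ler_wpM2l.
move: A1 A2 H1; rewrite (_ : n / x ^+ 2 * (4 / n) = 4 * (n / x ^+ 2 / n)); last by field; rewrite !gt_eqF.
rewrite (_ : n / x ^+ 2 * (2 / n) = 2 * (n / x ^+ 2 / n)); last by field; rewrite !gt_eqF.
rewrite (_ : (2 * (M + `|(deriv P).[0]|) + 2 * L) / n * (n / x ^+ 2) = (2 * (M + `|(deriv P).[0]|) + 2 * L) * (n / x ^+ 2 / n)); last ring.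
move: (n / x ^+ 2 / n) => W; lra.
Qed.

Definition tail_bounded b := exists C : R, \forall N \near \oo, forall n, (N < `|n|)%N -> `|b N n| <= C.
Definition tail_small b := forall e : R, 0 < e -> \forall N \near \oo, forall n, (N < `|n|)%N -> `|b N n| <= e.
(** Uniform approximation on |n| > N as N grows. The limit is required to be
    bounded so that the relation is stable under products. *)
Definition tail_close a b := tail_bounded b /\ tail_small (fun N n => a N n - b N n).

Lemma tail_closeD a b a' b' : tail_close a b -> tail_close a' b' ->
  tail_close (fun N n => a N n + a' N n) (fun N n => b N n + b' N n).
Proof.
move=> [[C HC] H] [[C' HC'] H']; split.
  exists (C + C'); near=> N => n nN; apply: le_trans (ler_normD _ _) _.
  by apply: lerD; move: n nN; near: N.
move=> e e0; have e2 : 0 < e / 2 by rewrite divr_gt0.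
near=> N => n nN; rewrite [leRHS](splitr e) opprD addrACA; apply: le_trans (ler_normD _ _) _.
by apply: lerD; move: n nN; near: N; [exact: H|exact: H'].
Unshelve. all: by end_near. Qed.

Lemma tail_closeM a b a' b' : tail_close a b -> tail_close a' b' ->
  tail_close (fun N n => a N n * a' N n) (fun N n => b N n * b' N n).
Proof.
move=> [[C HC] H] [[C' HC'] H']; split.
  exists (`|C| * `|C'|); apply: filterS2 HC HC' => N HC HC' n nN.
  by rewrite normrM ler_pM // (le_trans _ (ler_norm _)) ?HC ?HC'.
move=> e e0; pose K := `|C| + `|C'| + 1.
have K0 : 0 < K by rewrite /K ltr_wpDl // addr_ge0.
pose d := Num.min 1 (e / (2 * K)).
have d0 : 0 < d by rewrite lt_min ltr01 divr_gt0 // mulr_gt0.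
apply: filterS (filterI (filterI HC HC') (filterI (H d d0) (H' d d0))).
move=> N [[{}HC {}HC'] [{}H {}H']] n nN.
have {}HC := le_trans (HC n nN) (ler_norm _); have {}HC' := le_trans (HC' n nN) (ler_norm _).
have {}H := H n nN; have {}H' := H' n nN.
have d1 : d <= 1 by rewrite /d ge_min lexx.
have d2 : d * K <= e / 2.
  rewrite -ler_pdivlMr // (_ : e / 2 / K = e / (2 * K)); last by rewrite invfM mulrA.
  by rewrite /d ge_min lexx orbT.
rewrite (_ : _ - _ = (a N n - b N n) * a' N n + b N n * (a' N n - b' N n)); last ring.
apply: le_trans (ler_normD _ _) _; rewrite !normrM.
have Ha' : `|a' N n| <= `|C'| + 1.
  by rewrite -[a' N n](subrK (b' N n)); apply: le_trans (ler_normD _ _) _; lra.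
have A1 : `|a N n - b N n| * `|a' N n| <= d * K.
  by apply: ler_pM => //; apply: le_trans Ha' _; rewrite /K; have := normr_ge0 C; lra.
have A2 : `|b N n| * `|a' N n - b' N n| <= K * d.
  by apply: ler_pM => //; apply: le_trans HC _; rewrite /K; have := normr_ge0 C'; lra.
lra.
Qed.

Lemma tail_close_cvg (y : nat -> R) (z : R) : y @ \oo --> z -> tail_close (fun N _ => y N) (fun _ _ => z).
Proof.
move=> H; split; first by exists `|z|; apply: nearW.
move=> e e0; move/cvgrPdist_le : H => /(_ e e0); apply: filterS => N HN n _.
by rewrite distrC.
Qed.

Lemma tail_close_cst (z : R) : tail_close (fun _ _ => z) (fun _ _ => z).
Proof. by apply: tail_close_cvg; exact: cvg_cst. Qed.

Lemma tail_closeX a b (k : nat) : tail_close a b -> tail_close (fun N n => a N n ^+ k) (fun N n => b N n ^+ k).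
Proof.
move=> H; elim: k => [|k IH]; first exact: tail_close_cst.
have := tail_closeM H IH; congr tail_close; do 2 apply/funext => ?; by rewrite exprS.
Qed.

Lemma tail_close_sum (I : Type) (s : seq I) (a b : I -> nat -> int -> R) :
  (forall i, tail_close (a i) (b i)) ->
  tail_close (fun N n => \sum_(i <- s) a i N n) (fun N n => \sum_(i <- s) b i N n).
Proof.
move=> H; elim: s => [|i s IH].
  have := tail_close_cst 0; congr tail_close; do 2 apply/funext => ?; by rewrite big_nil.
have := tail_closeD (H i) IH; congr tail_close; do 2 apply/funext => ?; by rewrite big_cons.
Qed.

Lemma tail_close_ext a b a' b' : tail_close a b ->
  (forall N n, (N < `|n|)%N -> a N n = a' N n) -> (forall N n, (N < `|n|)%N -> b N n = b' N n) ->
  tail_close a' b'.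
Proof.
move=> [[C HC] H] aE bE; split.
  by exists C; apply: filterS HC => N HC n nN; rewrite -bE //; exact: HC.
by move=> e e0; apply: filterS (H e e0) => N HN n nN; rewrite -aE // -bE //; exact: HN.
Qed.

(** The sum telescopes: the term of index k compares with D N k - D N k.+1,
    where D averages the primitives of the two parities at consecutive points.
    The errors are summed with N/k^2 <= N/(k-1) - N/k, whose sum over k > N is
    at most 1. *)
Lemma tail_sum_limit a (Psi : bool -> {poly R}) (S : nat -> R) :
  tail_close a (fun N n => (Psi (2 %| n)%Z).[N%:R / n%:~R]) ->
  (\forall N \near \oo, (fun M => \sum_(0 <= j < M)
      N%:R / (N.+1 + j)%:R ^+ 2 * (a N (N.+1 + j)%:Z + a N (- (N.+1 + j)%:Z))) @ \oo --> S N) ->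
  S @ \oo --> (integral11 (fun x => (Psi true).[x]) + integral11 (fun x => (Psi false).[x])) / 2.
Proof.
move=> [_ Ha] HS.
have [P1 HP1] := poly_primitive (Psi true); have [P0 HP0] := poly_primitive (Psi false).
pose Q (b : bool) := oddify (if b then P1 else P0).
have QP (b : bool) (x : R) : (deriv (Q b)).[x] = (Psi b).[x] + (Psi b).[- x].
  by rewrite oddify_deriv; case: b; rewrite ?HP1 ?HP0.
have QI (b : bool) : integral11 (fun x => (Psi b).[x]) = (Q b).[1].
  by rewrite oddifyE; case: b; rewrite -?HP1 -?HP0 integral11_poly.
have Q0 (b : bool) : (Q b).[0] = 0 by rewrite oddifyE oppr0 subrr.
rewrite !QI.
have [C1 C10 HC1] := tail_step (Q true); have [C2 C20 HC2] := tail_step (Q false).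
have [L1 L10 HL1] := poly_taylor (Q true); have [L2 L20 HL2] := poly_taylor (Q false).
pose C := C1 + C2; pose L := L1 + L2.
have HC (b : bool) (N k : nat) : (0 < N)%N -> (N < k)%N ->
  `|N%:R / k%:R ^+ 2 * (deriv (Q b)).[N%:R / k%:R] - ((Q b).[N%:R / k%:R] - (Q b).[N%:R / k.+2%:R]) / 2|
    <= C / N%:R * (N%:R / k%:R ^+ 2).
  move=> N0 Nk; have w0 : 0 <= N%:R / k%:R ^+ 2 :> R by rewrite divr_ge0 ?sqr_ge0.
  case: b; [apply: le_trans (HC1 N k N0 Nk) _|apply: le_trans (HC2 N k N0 Nk) _];
    rewrite ler_wpM2r // ler_wpM2r ?invr_ge0 // /C; lra.
have HL (b : bool) (s t : R) : 0 <= s <= 1 -> 0 <= t <= 1 -> `|(Q b).[s] - (Q b).[t]| <= L * `|s - t|.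
  move=> sI tI; have d0 := normr_ge0 (s - t).
  have [H1 _] := HL1 s t (ltac:(lra)) (ltac:(lra)); have [H2 _] := HL2 s t (ltac:(lra)) (ltac:(lra)).
  by case: b; apply: le_trans; [exact: H1| |exact: H2|]; rewrite ler_wpM2r // /L; lra.
pose par (k : nat) := (2 %| k%:Z)%Z.
pose D (N k : nat) := ((Q (par k)).[N%:R / k%:R] + (Q (par k.+1)).[N%:R / k.+1%:R]) / 2.
have parSS k : par k.+2 = par k by rewrite /par; clear; lia.
have parN (k : nat) : (2 %| - k%:Z)%Z = par k by rewrite /par; clear; lia.
pose T (N k : nat) : R := N%:R / k%:R ^+ 2 * (a N k%:Z + a N (- k%:Z)).
have step (N k : nat) e : (0 < N)%N -> (N < k)%N -> (forall n : int, (N < `|n|)%N ->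
     `|a N n - (Psi (2 %| n)%Z).[N%:R / n%:~R]| <= e) ->
   `|T N k - (D N k - D N k.+1)| <= (2 * e + C / N%:R) * (N%:R / k%:R ^+ 2).
  move=> N0 Nk He.
  have w0 : 0 <= N%:R / k%:R ^+ 2 :> R by rewrite divr_ge0 ?sqr_ge0.
  have e1 := He k%:Z (ltac:(clear -Nk; lia)); have e2 := He (- k%:Z) (ltac:(clear -Nk; lia)).
  rewrite parN mulrNz -pmulrn invrN mulrN in e2; rewrite -/(par k) -pmulrn in e1.
  have := HC (par k) N k N0 Nk; rewrite QP /T /D parSS.
  move: (Psi (par k)).[_] (Psi (par k)).[_] e1 e2 => u2 u1 e1 e2.
  move: (Q (par k)).[_] (Q (par k)).[_] (Q (par k.+1)).[_] => q2 q1 q3 H.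
  rewrite (_ : _ - _ = N%:R / k%:R ^+ 2 * ((a N k%:Z - u1) + (a N (- k%:Z) - u2)) +
     (N%:R / k%:R ^+ 2 * (u1 + u2) - (q1 - q2) / 2)); last by field; rewrite gt_eqF // ltr0n (leq_ltn_trans _ Nk).
  apply: le_trans (ler_normD _ _) _; rewrite [leRHS]mulrDl; apply: lerD => //.
  rewrite normrM (ger0_norm w0) mulrC ler_wpM2r //.
  by apply: le_trans (ler_normD _ _) _; lra.
have wsum (N k : nat) : (0 < N)%N -> (N < k)%N ->
   N%:R / k%:R ^+ 2 <= N%:R / k.-1%:R - N%:R / k%:R :> R.
  case: k => // k N0 Nk /=; have k0 : 0 < k%:R :> R by rewrite ltr0n (leq_trans N0).
  have n0 : 0 < N%:R :> R by rewrite ltr0n.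
  rewrite -natr1; move: N%:R k%:R n0 k0 => n x n0 x0.
  have -> : n / x - n / (x + 1) = n / (x + 1) ^+ 2 * ((x + 1) / x).
    by field; rewrite !gt_eqF //; lra.
  rewrite -[leLHS]mulr1 ler_wpM2l ?divr_ge0 ?sqr_ge0 ?ler_pdivlMr //; lra.
have psum (N M : nat) e : (0 < N)%N -> (forall n : int, (N < `|n|)%N ->
     `|a N n - (Psi (2 %| n)%Z).[N%:R / n%:~R]| <= e) -> 0 <= e ->
   `|\sum_(0 <= j < M) T N (N.+1 + j)%N - (D N N.+1 - D N (N.+1 + M)%N)| <=
     (2 * e + C / N%:R) * (1 - N%:R / (N + M)%:R).
  move=> N0 He e0; have E0 : 0 <= 2 * e + C / N%:R by apply: addr_ge0; [exact: mulr_ge0|apply: divr_ge0 => //; exact: addr_ge0].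
  elim: M => [|M IH].
    by rewrite big_nil !addn0 subrr subr0 normr0 divff ?subrr ?mulr0 // pnatr_eq0 -lt0n.
  rewrite big_nat_recr //=.
  rewrite (_ : _ - _ = (\sum_(0 <= j < M) T N (N.+1 + j)%N - (D N N.+1 - D N (N.+1 + M)%N)) +
     (T N (N.+1 + M)%N - (D N (N.+1 + M)%N - D N (N.+1 + M).+1))); last by rewrite addnS; ring.
  have h1 := step N (N.+1 + M)%N e N0 (leq_addr _ _) He.
  have h2 := wsum N (N.+1 + M)%N N0 (leq_addr _ _).
  rewrite -(ler_pM2l (_ : 0 < 1)) // in h2.
  have h3 : (2 * e + C / N%:R) * (N%:R / (N.+1 + M)%:R ^+ 2) <=
     (2 * e + C / N%:R) * (N%:R / (N + M)%:R - N%:R / (N.+1 + M)%:R).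
    by apply: ler_wpM2l => //; rewrite !mul1r in h2.
  rewrite addnS -addSn; apply: le_trans (ler_normD _ _) _.
  move: h1 h3 IH; move: (2 * e + C / N%:R) (N%:R / (N + M)%:R) (N%:R / (N.+1 + M)%:R) => E x1 x2.
  move: (_ / _) => w h1 h3 IH; lra.
have key (N : nat) e : (0 < N)%N -> (forall n : int, (N < `|n|)%N ->
     `|a N n - (Psi (2 %| n)%Z).[N%:R / n%:~R]| <= e) -> 0 <= e ->
   (fun M => \sum_(0 <= j < M) T N (N.+1 + j)%N) @ \oo --> S N ->
   `|S N - D N N.+1| <= 2 * e + C / N%:R.
  move=> N0 He e0 HN; have L0 : 0 <= L by exact: addr_ge0.
  have E0 : 0 <= C / N%:R by apply: divr_ge0 => //; exact: addr_ge0.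
  apply/ler_addgt0Pr => eta eta0; have eta2 : 0 < eta / 2 by rewrite divr_gt0.
  have HD k : (N < k)%N -> `|D N k| <= L * (N%:R / k%:R).
    move=> Nk; have k0 : 0 < k%:R :> R by rewrite ltr0n (leq_ltn_trans _ Nk).
    have k1 : 0 < k.+1%:R :> R by rewrite ltr0n.
    have nk : N%:R <= k%:R :> R by rewrite ler_nat ltnW.
    have s1 : 0 <= (N%:R / k%:R : R) <= 1 by rewrite divr_ge0 //= ler_pdivrMr // mul1r.
    have st : N%:R / k.+1%:R <= N%:R / k%:R :> R.
      by rewrite ler_wpM2l // lef_pV2 ?posrE // ler_nat.
    have t0 : 0 <= N%:R / k.+1%:R :> R by rewrite divr_ge0.
    have z0 : 0 <= (0 : R) <= 1 by rewrite lexx ler01.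
    have h1 := HL (par k) _ 0 s1 z0.
    have t1 : 0 <= (N%:R / k.+1%:R : R) <= 1 by rewrite t0 (le_trans st) // (andP s1).2.
    have h2 := HL (par k.+1) _ 0 t1 z0.
    rewrite !Q0 !subr0 (ger0_norm (andP s1).1) in h1; rewrite !Q0 !subr0 (ger0_norm t0) in h2.
    have h3 := ler_wpM2l L0 st.
    rewrite /D normrM [`|2^-1|]ger0_norm ?invr_ge0 //.
    have := ler_normD (Q (par k)).[N%:R / k%:R] (Q (par k.+1)).[N%:R / k.+1%:R].
    move: h1 h2 h3; move: `|_| `|_| `|_| (L * _) (L * _) => x1 x2 x3 x4 x5; lra.
  have HN' : \forall M \near \oo, `|S N - \sum_(0 <= j < M) T N (N.+1 + j)%N| <= eta / 2.
    by move/cvgrPdist_le : HN; exact.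
  have [M0 _ HM0] := HN'.
  have := archi_boundP (divr_ge0 (mulr_ge0 L0 (ler0n _ N)) (ltW eta2)).
  move: (Num.Def.archi_bound _) => M1 HM1.
  have {HM0}h1 := HM0 (M0 + M1)%N (leq_addr _ _).
  have {}h2 := psum N (M0 + M1)%N e N0 He e0.
  have h3 : `|D N (N.+1 + (M0 + M1))%N| <= eta / 2.
    apply: le_trans (HD _ (leq_addr _ _)) _.
    rewrite mulrA ler_pdivrMr ?ltr0n //; move: (ltW HM1); rewrite ler_pdivrMr // => h.
    apply: le_trans h _; rewrite mulrC ler_wpM2l ?(ltW eta2) // ler_nat.
    by rewrite addnA leq_addl.
  have h4 : (2 * e + C / N%:R) * (1 - N%:R / (N + (M0 + M1))%:R) <= 2 * e + C / N%:R.
    rewrite -[leRHS]mulr1; apply: ler_wpM2l; first by rewrite addr_ge0 // mulr_ge0.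
    by rewrite gerBl divr_ge0.
  move: h1 h2 h3 h4; move: (\sum_(_ <= _ < _) _) (D N N.+1) (D N (N.+1 + _)%N) => X Y Z h1 h2 h3 h4.
  rewrite (_ : S N - Y = (S N - X) + (X - (Y - Z)) - Z); last ring.
  apply: le_trans (ler_normB _ _) _; have := ler_normD (S N - X) (X - (Y - Z)).
  move: h4; move: (_ * _) (2 * e + C / N%:R) h2 => X1 X2 h2 h4; lra.
have L0 : 0 <= L by exact: addr_ge0.
apply/cvgrPdist_le => e e0; have e8 : 0 < e / 8 by rewrite divr_gt0.
have C0' : 0 <= C by exact: addr_ge0.
have := archi_boundP (divr_ge0 (addr_ge0 C0' (mulr_ge0 (ler0n _ 2) L0)) (ltW e8)).
move: (Num.Def.archi_bound _) => M1 HM1.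
apply: filterS (filterI (filterI (Ha _ e8) HS) (nbhs_infty_ge M1.+1)).
move=> N [[{}Ha {}HS] NM].
have N0 : (0 < N)%N by exact: leq_ltn_trans NM.
have n0 : 0 < N%:R :> R by rewrite ltr0n.
have {}HM1 : (C + 2 * L) / N%:R <= e / 8.
  rewrite ler_pdivrMr // [leRHS]mulrC -ler_pdivrMr //; apply: le_trans (ltW HM1) _.
  by rewrite ler_nat ltnW.
have {}key := key N _ N0 Ha (ltW e8) HS.
have near1 (b : bool) (k : nat) : (N < k)%N -> (k <= N.+2)%N -> `|(Q b).[1] - (Q b).[N%:R / k%:R]| <= 2 * L / N%:R.
  move=> Nk kN; have k0 : 0 < k%:R :> R by rewrite ltr0n (leq_ltn_trans _ Nk).
  have nk : N%:R <= k%:R :> R by rewrite ler_nat ltnW.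
  have s1 : 0 <= (N%:R / k%:R : R) <= 1 by rewrite divr_ge0 //= ler_pdivrMr // mul1r.
  have u1 : 0 <= (1 : R) <= 1 by rewrite lexx ler01.
  apply: le_trans (HL b _ _ u1 s1) _; rewrite ger0_norm; last by lra.
  rewrite [leLHS]mulrC (_ : 2 * L / N%:R = 2 / N%:R * L); last by rewrite mulrAC.
  rewrite ler_wpM2r // ler_pdivlMr // mulrBl mul1r.
  have kN' : k%:R <= N%:R + 2 :> R by rewrite -natrD ler_nat addn2.
  have -> : N%:R / k%:R * N%:R = N%:R - (k%:R - N%:R) * (N%:R / k%:R) :> R by field; rewrite gt_eqF.
  move: s1 nk kN'; move: (N%:R / k%:R) => s /andP[s0 s1] nk kN'.
  have : (k%:R - N%:R) * s <= 2 * 1 by apply: ler_pM => //; lra.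
  by rewrite mulr1 opprB addrCA subrr addr0.
have HD : `|((Q true).[1] + (Q false).[1]) / 2 - D N N.+1| <= 2 * L / N%:R.
  have parS : par N.+2 = ~~ par N.+1 by rewrite /par; clear; lia.
  have a1 := near1 (par N.+1) N.+1 (leqnn _) (leqnSn _).
  have a2 := near1 (par N.+2) N.+2 (leqnSn _) (leqnn _).
  have avg (x y z w X : R) : `|x - z| <= X -> `|y - w| <= X -> `|(x + y) / 2 - (z + w) / 2| <= X.
    move=> h1 h2; rewrite (_ : _ - _ = ((x - z) + (y - w)) / 2); last by field.
    rewrite normrM [`|2^-1|]ger0_norm ?invr_ge0 //; have := ler_normD (x - z) (y - w); lra.
  rewrite /D; move: a1 a2; rewrite parS; case: (par N.+1) => a1 a2; first exact: avg.
  by rewrite [X in _ - X / 2]addrC; apply: avg.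
have a3 : 0 <= C / N%:R by exact: divr_ge0.
have a4 : 0 <= 2 * L / N%:R by rewrite divr_ge0 // mulr_ge0.
rewrite mulrDl in HM1.
rewrite -(subrK (D N N.+1) (_ / 2)) -addrA; apply: le_trans (ler_normD _ _) _.
rewrite [`|D N N.+1 - _|]distrC; lra.
Qed.

End Tails.

(** * Solution operator, eigenfunction expansion and the limit *)

Section Cutoff.
Context {R : realType}.
Implicit Types (u : R -> R).

Lemma HD_quadratic u u' (C : R) : (forall x t, I11 x -> I11 t ->
  `|u t - u x - u' x * (t - x)| <= C * (t - x) ^+ 2) -> HD u u'.
Proof.
move=> H x xI; apply/cvgrPdist_le => e e0.
have C0 : 0 < `|C| + 1 by rewrite ltr_wpDl.
have d0 : 0 < e / (`|C| + 1) by exact: divr_gt0.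
rewrite /within /=; exists (e / (`|C| + 1)) => //= t /= xt tx tI.
have tx0 : t - x != 0 by rewrite subr_eq0.
have nt0 : 0 < `|t - x| by rewrite normr_gt0.
rewrite /diff_quot /GRing.scale /= -(ler_pM2r nt0) -normrM.
rewrite mulrBl mulrAC mulVf // mul1r distrC.
apply: le_trans (H x t xI tI) _; rewrite -real_normK ?num_real // expr2 mulrA.
rewrite ler_pM2r // distrC.
have h1 : `|C| * `|x - t| <= (`|C| + 1) * `|x - t| by rewrite ler_wpM2r // lerDl.
have h2 : (`|C| + 1) * `|x - t| <= e by rewrite mulrC -ler_pdivlMr // ltW.
apply: le_trans h2; apply: le_trans h1; rewrite ler_wpM2r //; exact: ler_norm.
Qed.

(** Rises linearly from 0 to 1 on the part of the interval within eps of the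
    end point e, where e is 1 or -1; its square is continuously differentiable.
    *)
Definition ramp (e eps s : R) : R := Num.max 0 (1 - (1 - e * s) / eps).
Definition cutoff e eps s : R := ramp e eps s ^+ 2.
Definition dcutoff e eps s : R := e * (2 / eps * ramp e eps s).

Lemma max_sqr (a b : R) :
  `|Num.max 0 b ^+ 2 - Num.max 0 a ^+ 2 - 2 * Num.max 0 a * (b - a)| <= (b - a) ^+ 2.
Proof.
have sa := sqr_ge0 a; have sb := sqr_ge0 b; have sab := sqr_ge0 (b - a).
case: (leP 0 a) => a0; case: (leP 0 b) => b0; rewrite ler_norml; apply/andP; split;
  by first [lra | have := mulr_ge0_le0 a0 (ltW b0); lra | have := mulr_le0_ge0 (ltW a0) b0; lra].
Qed.

Lemma cutoff_HD e eps : e ^+ 2 = 1 -> 0 < eps -> HD (cutoff e eps) (dcutoff e eps).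
Proof.
move=> e1 eps0; apply: (@HD_quadratic _ _ (eps ^- 2)) => x t _ _.
have := max_sqr (1 - (1 - e * x) / eps) (1 - (1 - e * t) / eps).
rewrite -!/(ramp _ _ _) -!/(cutoff _ _ _).
have -> : 1 - (1 - e * t) / eps - (1 - (1 - e * x) / eps) = e * (t - x) / eps by ring.
have -> : dcutoff e eps x * (t - x) = 2 * ramp e eps x * (e * (t - x) / eps).
  by rewrite /dcutoff; ring.
have -> // : (e * (t - x) / eps) ^+ 2 = eps ^- 2 * (t - x) ^+ 2.
by rewrite !exprMn e1 mul1r exprVn mulrC.
Qed.

Lemma ramp_cont e eps : continuous (ramp e eps).
Proof.
move=> x; pose b s := 1 - (1 - e * s) / eps.
have -> : ramp e eps = fun s => (b s + `|b s|) / 2.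
  apply/funext => s; rewrite /ramp -/(b s); case: (leP 0 (b s)) => bs.
    by rewrite ger0_norm //; field.
  by rewrite ltr0_norm //; ring.
suff bx : b @ x --> b x.
  by apply: cvgM; [apply: cvgD => //; exact: cvg_norm|exact: cvg_cst].
apply: cvgB; first exact: cvg_cst.
apply: cvgM; last exact: cvg_cst.
apply: cvgB; first exact: cvg_cst.
by apply: cvgM; [exact: cvg_cst|exact: cvg_id].
Qed.

Lemma ramp_ge0 e eps s : 0 <= ramp e eps s.
Proof. by rewrite /ramp le_max lexx. Qed.

Lemma ramp_le1 e eps s : e ^+ 2 = 1 -> 0 < eps -> I11 s -> ramp e eps s <= 1.
Proof.
move=> e1 eps0 /I11P sI; rewrite /ramp ge_max ler01 /= lerBlDr lerDl divr_ge0 ?(ltW eps0) //.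
have : (e - 1) * (e + 1) == 0 by apply/eqP; ring: e1.
by rewrite mulf_eq0 => /orP[/eqP ee|/eqP ee]; nra.
Qed.

Lemma dcutoff_C0 e eps : C0 (dcutoff e eps).
Proof.
rewrite /dcutoff; apply: C0M; first exact: C0c.
apply: C0M; first exact: C0c.
exact/C0_cont/ramp_cont.
Qed.

Lemma cutoff_end e eps : e ^+ 2 = 1 -> cutoff e eps e = 1.
Proof.
by move=> e1; rewrite /cutoff /ramp -expr2 e1 subrr mul0r subr0 max_r // expr1n.
Qed.

Lemma ramp_far e eps s : 0 < eps -> eps <= 1 - e * s -> ramp e eps s = 0.
Proof. by move=> eps0 es; rewrite /ramp max_l // subr_le0 ler_pdivlMr // mul1r. Qed.

Lemma cutoff_far e eps s : 0 < eps -> eps <= 1 - e * s -> cutoff e eps s = 0.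
Proof. by move=> eps0 es; rewrite /cutoff ramp_far // expr0n. Qed.

End Cutoff.

Section Resolvent.
Context {R : realType}.
Variables (p r : R -> R) (alpha beta : R) (G : R -> R -> R -> 'M[R]_2).
Hypotheses (Cp : C0 p) (Cr : C0 r).
Hypothesis hG : green_matrix alpha beta p r G.
Implicit Types (y z h k u w : R -> 'cV[R]_2) (l e : R) (a b : 'cV[R]_2).

Definition regular l := ~ dirac_eigenvalue alpha beta p r l.
Definition angle e := if e == 1 then beta else alpha.
Definition bcs y := bform alpha (y (-1)) = 0 /\ bform beta (y 1) = 0.

Lemma bform_lin g a b c : bform g (a + c *: b) = bform g a + c * bform g b.
Proof. by rewrite /bform !mxE; ring. Qed.

Lemma bformB g a b : bform g (a - b) = bform g a - bform g b.
Proof. by rewrite /bform !mxE; ring. Qed.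

Lemma bform_eq0 g a : bform g a = 0 -> exists c, a = c *: bdir g.
Proof.
rewrite /bform => H; exists (a 0 0 * cos g - a 1 0 * sin g).
have H' : a 1 0 * cos g = - (a 0 0 * sin g) by lra.
have cs : cos g ^+ 2 = 1 - sin g ^+ 2 by rewrite -(cos2Dsin2 g); ring.
have E0 : (a 0 0 * cos g - a 1 0 * sin g) * cos g = a 0 0.
  have -> : (a 0 0 * cos g - a 1 0 * sin g) * cos g = a 0 0 * cos g ^+ 2 - a 1 0 * cos g * sin g by ring.
  by rewrite cs H'; ring.
have E1 : (a 0 0 * cos g - a 1 0 * sin g) * - sin g = a 1 0.
  have -> : (a 0 0 * cos g - a 1 0 * sin g) * - sin g = - (a 0 0 * sin g) * cos g + a 1 0 * sin g ^+ 2 by ring.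
  rewrite -H' (_ : sin g ^+ 2 = 1 - cos g ^+ 2); last by rewrite cs; ring.
  by ring.
by apply: col2P; rewrite /bdir !mxE /= ?E0 ?E1.
Qed.

Lemma bracket_bdir a g c : bracket a (c *: bdir g) = c * bform g a.
Proof. by rewrite /bracket /bform /bdir !mxE /=; ring. Qed.

Lemma bcs_bracket y z : bcs y -> bcs z ->
  bracket (y 1) (z 1) = 0 /\ bracket (y (-1)) (z (-1)) = 0.
Proof.
move=> [y0 y1] [/bform_eq0[c0 ->] /bform_eq0[c1 ->]].
by rewrite !bracket_bdir y0 y1 !mulr0.
Qed.

Lemma bcs_lin y z c : bcs y -> bcs z -> bcs (fun x => y x + c *: z x).
Proof. by move=> [y0 y1] [z0 z1]; split; rewrite bform_lin ?y0 ?y1 ?z0 ?z1 mulr0 addr0. Qed.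

Lemma bcsB y z : bcs y -> bcs z -> bcs (fun x => y x - z x).
Proof. by move=> Hy Hz; have := bcs_lin (-1) Hy Hz; rewrite /bcs !scaleN1r. Qed.

Lemma dsys_sym l y z h k : VC h -> VC k -> dsys p r l y h -> bcs y ->
  dsys p r l z k -> bcs z -> inner h z = inner y k.
Proof.
move=> Ch Ck Hy By Hz Bz; apply/eqP; rewrite -subr_eq0.
rewrite (lagrange Ch Ck Hy Hz); have [-> ->] := bcs_bracket By Bz.
by rewrite subrr.
Qed.

Lemma in_domainP y : in_domain alpha beta y <-> Ck 1 y /\ bcs y.
Proof. by split=> [[]|[H []]]. Qed.

(** The difference of two solutions would be an eigenfunction. *)
Lemma regular_uniq l y z h : regular l -> VC h -> dsys p r l y h -> bcs y ->
  dsys p r l z h -> bcs z -> forall x, I11 x -> y x = z x.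
Proof.
move=> nl Ch Hy By Hz Bz x xI; apply/eqP; apply: contrapT => /negP yz; apply: nl.
pose u t := y t - z t.
have Hu : dsys p r l u (fun=> 0).
  by apply: (dsys_ext (dsysB Hy Hz)) => // t _; rewrite subrr.
have [C1 E] := iffLR (dsysP Cp Cr l u VC0) Hu.
exists u; split.
- by apply/in_domainP; split => //; exact: bcsB.
- by exists x => //; rewrite subr_eq0.
- by move=> t tI; apply/eqP; rewrite -subr_eq0 E.
Qed.

(** The solution operator given by the Green matrix, at spectral parameter l.
    *)
Definition Tg l h x : 'cV[R]_2 := \col_i integral11 (fun s => (G l x s *m h s) i 0).

Lemma Tg_spec l h : regular l -> VC h -> dsys p r l (Tg l h) h /\ bcs (Tg l h).
Proof.
move=> nl Ch; have [_ _ /(_ h (iffLR (VC_within h) Ch))] := hG nl.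
by move=> [/in_domainP[C1 B] E]; split => //; apply/dsysP.
Qed.

Lemma Tg_VC l h : regular l -> VC h -> VC (Tg l h).
Proof. by move=> nl Ch; have [/dsys_VC] := Tg_spec nl Ch. Qed.

Lemma Tg_eq l h y : regular l -> VC h -> dsys p r l y h -> bcs y ->
  forall x, I11 x -> Tg l h x = y x.
Proof.
move=> nl Ch Hy By; have [HT BT] := Tg_spec nl Ch.
exact: regular_uniq nl Ch HT BT Hy By.
Qed.

(** The bracket of two functions satisfying the boundary conditions vanishes at
    both ends. *)
Lemma Tg_sym l h k : regular l -> VC h -> VC k -> inner (Tg l h) k = inner h (Tg l k).
Proof.
move=> nl Ch Ck; have [H1 H2] := Tg_spec nl Ch; have [H3 H4] := Tg_spec nl Ck.
by rewrite (dsys_sym Ch Ck H1 H2 H3 H4).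
Qed.

(** The source (A - l) applied to the cut-off constant vector b. *)
Definition hcut l e eps b x : 'cV[R]_2 := \col_i
  if i == 0 then dcutoff e eps x * b 1 0 - (p x + l) * (cutoff e eps x * b 0 0)
  else - (dcutoff e eps x * b 0 0) - (r x + l) * (cutoff e eps x * b 1 0).
(** A homogeneous solution with boundary datum b at the end e: cut off b near e
    and correct by the solution operator. It does not depend on eps
    (zsol_indep), and letting eps tend to 0 shows the value of the Green matrix
    at the end point. *)
Definition zsol l e eps b x : 'cV[R]_2 := cutoff e eps x *: b - Tg l (hcut l e eps b) x.

Lemma cutoff_C0 e eps : e ^+ 2 = 1 -> 0 < eps -> C0 (cutoff e eps).
Proof. by move=> e1 eps0; apply: HD_C0 (cutoff_HD e1 eps0). Qed.

Lemma hcut_VC l e eps b : e ^+ 2 = 1 -> 0 < eps -> VC (hcut l e eps b).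
Proof.
move=> e1 eps0; have Cc := cutoff_C0 e1 eps0; have Cd : C0 (dcutoff e eps) by exact: dcutoff_C0.
have Cpl : C0 (fun x => p x + l) by apply: C0D => //; exact: C0c.
have Crl : C0 (fun x => r x + l) by apply: C0D => //; exact: C0c.
split.
  have H : C0 (fun x => dcutoff e eps x * b 1 0 - (p x + l) * (cutoff e eps x * b 0 0)).
    by apply: C0B; apply: C0M => //; [exact: C0c|apply: C0M => //; exact: C0c].
  by apply: (C0_ext H) => x _; rewrite mxE.
have H : C0 (fun x => - (dcutoff e eps x * b 0 0) - (r x + l) * (cutoff e eps x * b 1 0)).
  by apply: C0B; [apply: C0N|]; apply: C0M => //; [exact: C0c|apply: C0M => //; exact: C0c].
by apply: (C0_ext H) => x _; rewrite mxE.
Qed.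

Lemma hcut_dsys l e eps b : e ^+ 2 = 1 -> 0 < eps ->
  dsys p r l (fun x => cutoff e eps x *: b) (hcut l e eps b).
Proof.
move=> e1 eps0; have H := cutoff_HD e1 eps0; split.
  by apply: (HD_ext (HDZ (b 0 0) H)) => x _; rewrite /hcut !mxE /=; ring.
by apply: (HD_ext (HDZ (b 1 0) H)) => x _; rewrite /hcut !mxE /=; ring.
Qed.

(** Inhomogeneous boundary condition at e, homogeneous one at the opposite end.
    *)
Definition bdata e b y := bform (angle e) (y e) = bform (angle e) b /\
  bform (angle (- e)) (y (- e)) = 0.

Lemma end_cases e : e ^+ 2 = 1 -> e = 1 \/ e = -1.
Proof.
move=> e1; have : (e - 1) * (e + 1) == 0 by apply/eqP; ring: e1.
by rewrite mulf_eq0 subr_eq0 addr_eq0 => /orP[/eqP|/eqP]; [left|right].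
Qed.

Lemma angleN1 : angle (-1) = alpha.
Proof. by rewrite /angle lt_eqF //; exact: ltN11. Qed.
Lemma angle1 : angle 1 = beta.
Proof. by rewrite /angle eqxx. Qed.

Lemma bcs_end y e : e ^+ 2 = 1 -> bcs y ->
  bform (angle e) (y e) = 0 /\ bform (angle (- e)) (y (- e)) = 0.
Proof.
by move=> /end_cases[]-> [H1 H2]; rewrite ?opprK angle1 angleN1.
Qed.

Lemma zsol_spec l e eps b : regular l -> e ^+ 2 = 1 -> 0 < eps -> eps <= 1 ->
  dsys p r l (zsol l e eps b) (fun=> 0) /\ bdata e b (zsol l e eps b).
Proof.
move=> nl e1 eps0 eps1.
have [H1 H2] := Tg_spec nl (hcut_VC l b e1 eps0).
split.
  by apply: (dsys_ext (dsysB (hcut_dsys l b e1 eps0) H1)) => // x _; rewrite subrr.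
have [H3 H4] := bcs_end e1 H2.
rewrite /bdata /zsol !bformB H3 H4 !subr0.
rewrite cutoff_end // scale1r cutoff_far ?scale0r //.
  by split => //; rewrite /bform !mxE; ring.
by rewrite mulrN -expr2 e1; lra.
Qed.

Lemma bdata_uniq l e b y z h : regular l -> VC h -> e ^+ 2 = 1 ->
  dsys p r l y h -> bdata e b y -> dsys p r l z h -> bdata e b z ->
  forall x, I11 x -> y x = z x.
Proof.
move=> nl Ch e1 Hy [y1 y2] Hz [z1 z2] x xI.
have Hu := dsysB Hy Hz.
have Hu0 : dsys p r l (fun x => y x - z x) (fun=> 0).
  by apply: (dsys_ext Hu) => // t _; rewrite subrr.
have B1 : bform (angle e) (y e - z e) = 0.
  by rewrite bformB y1 z1 subrr.
have B2 : bform (angle (-e)) (y (-e) - z (-e)) = 0.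
  by rewrite bformB y2 z2 subr0.
have Bu : bcs (fun x => y x - z x).
  by have [ee|ee] := end_cases e1; move: B1 B2; rewrite ee ?opprK angle1 angleN1.
apply/eqP; rewrite -subr_eq0; apply/eqP.
apply: (regular_uniq nl VC0 Hu0 Bu (dsys0 _ _ _) _ xI).
by split; rewrite /bform !mxE; ring.
Qed.

Lemma inner_le_sup w (M : R) : VC w -> (forall x, I11 x -> sqn (w x) <= M) ->
  inner w w <= 2 * M.
Proof.
move=> Cw H; rewrite inner_sqn -integral11c; apply: integral11_le => //; last exact: C0c.
by move: (VC_inner Cw Cw) => /C0_ext; apply=> x _; rewrite /sqn !expr2.
Qed.

Lemma sqn_ge0 a : 0 <= sqn a.
Proof. by rewrite /sqn addr_ge0 // sqr_ge0. Qed.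

Lemma sqn_bdir (g c : R) : sqn (c *: bdir g) = c ^+ 2.
Proof.
rewrite /sqn /bdir !mxE /= !exprMn sqrrN -mulrDr cos2Dsin2 mulr1 //.
Qed.

Lemma bracket_bdirl a g c : bracket (c *: bdir g) a = - (c * bform g a).
Proof. by rewrite /bracket /bform /bdir !mxE /=; ring. Qed.

(** By energy_estimate only the initial value c of y, in the direction allowed
    by the boundary condition, has to be bounded. Pairing h with a homogeneous
    solution that satisfies the right but not the left condition gives c up to
    a nonzero factor. *)
Lemma resolvent_bound l : regular l -> exists2 C : R, 0 < C & forall y h, VC h ->
  dsys p r l y h -> bcs y -> forall x, I11 x -> sqn (y x) <= C * inner h h.
Proof.
move=> nl; have [C C0 HC] := energy_estimate Cp Cr.
pose b : 'cV[R]_2 := \col_i if i == 0 then sin alpha else cos alpha.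
have N1 : (-1 : R) ^+ 2 = 1 by rewrite sqrrN expr1n.
have [Hz [Bz1 Bz2]] := zsol_spec b nl N1 ltr01 (lexx 1).
set z := zsol l (-1) 1 b in Hz Bz1 Bz2.
rewrite opprK angle1 angleN1 in Bz1 Bz2.
have bb : bform alpha b = 1.
  by rewrite /bform /b !mxE /= -!expr2 cos2Dsin2.
rewrite bb in Bz1.
have Cz := dsys_VC Hz.
exists (C * (inner z z + 1)); first by rewrite mulr_gt0 // ltr_wpDl // inner_ge0.
move=> y h Ch Hy By x xI.
have := lagrange Ch VC0 Hy Hz.
have [c Ec] := bform_eq0 By.1; have [d Ed] := bform_eq0 By.2.
rewrite (innerC y) inner0l subr0 Ec Ed !bracket_bdirl Bz1 Bz2 !mulr0 oppr0 mulr1 sub0r opprK => hz.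
apply: le_trans (HC _ _ _ Ch Hy x xI) _; rewrite -mulrA ler_wpM2l ?(ltW C0) //.
rewrite Ec sqn_bdir -hz mulrDl mul1r lerD2r mulrC; exact: inner_CS.
Qed.

Section Eigen.
Variables (lam : int -> R) (v : int -> R -> 'cV[R]_2).
Hypotheses (reg0 : regular 0)
  (hlam : eigenvalue_enum alpha beta p r lam)
  (hv : eigenfunction_system alpha beta p r lam v).

Lemma v_dsys n : dsys p r (lam n) (v n) (fun=> 0) /\ bcs (v n).
Proof.
have [/(_ n) [/in_domainP[H1 H2] _ H3] _ _ _] := hv.
split => //; apply/(dsysP Cp Cr); first exact: VC0.
by split => // x xI; rewrite H3 // subrr.
Qed.

Lemma v_VC n : VC (v n).
Proof. by have [/dsys_VC] := v_dsys n. Qed.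

Lemma v_ortho m n : inner (v m) (v n) = (m == n)%:R.
Proof. by have [_ ->] := hv. Qed.

Lemma lam_neq0 n : lam n != 0.
Proof.
apply/negP => /eqP l0; apply: reg0.
by have [_ H _] := hlam; apply/H; exists n.
Qed.

Lemma Tg_v n x : I11 x -> Tg 0 (v n) x = (lam n)^-1 *: v n x.
Proof.
have [H B] := v_dsys n; apply: (@Tg_eq 0 (v n) (fun x => (lam n)^-1 *: v n x)) => //; first exact: v_VC.
  apply: (dsys_ext (dsysZ (lam n)^-1 (dsys_shift 0 H))) => // t _.
  by rewrite add0r subr0 scalerA mulVf ?scale1r // lam_neq0.
have B0 : bcs (fun=> 0) by split; rewrite /bform !mxE; ring.
by have := bcs_lin (lam n)^-1 B0 B; rewrite /bcs !add0r.
Qed.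

Lemma inner_Tg_v g n : VC g -> inner (Tg 0 g) (v n) = (lam n)^-1 * inner g (v n).
Proof.
move=> Cg; rewrite (Tg_sym reg0 Cg (v_VC n)).
rewrite (inner_ext (fun x _ => erefl (g x)) (Tg_v n)) innerZr //; exact: v_VC.
Qed.

Lemma v_left_neq0 n : exists2 c, c != 0 & v n (-1) = c *: bdir alpha.
Proof.
have [H B] := v_dsys n; have [c Ec] := bform_eq0 B.1.
exists c => //; apply/negP => /eqP c0.
have [C C0 HC] := energy_estimate Cp Cr.
have vx x : I11 x -> sqn (v n x) = 0.
  move=> xI; apply/eqP; rewrite eq_le sqn_ge0 andbT.
  apply: le_trans (HC _ _ _ VC0 H x xI) _.
  by rewrite inner0l Ec c0 sqn_bdir expr0n /= addr0 mulr0.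
have := v_ortho n n; rewrite eqxx inner_sqn (integral11_ext (v := fun=> 0)) //.
by rewrite integral11c mulr0 => /esym/eqP; rewrite oner_eq0.
Qed.

(** Off the spectrum this is resolvent_bound. At an eigenvalue mu, subtract the
    multiple of the eigenfunction that cancels the initial value;
    energy_estimate then applies, and as y is orthogonal to the eigenfunction
    the subtraction only increases the norm. *)
Lemma coercive mu : exists2 C : R, 0 < C & forall y h, VC h -> dsys p r mu y h -> bcs y ->
  (forall n, lam n = mu -> inner y (v n) = 0) -> inner y y <= C * inner h h.
Proof.
have [ev|nl] := pselect (dirac_eigenvalue alpha beta p r mu); last first.
  have [C C0 HC] := resolvent_bound nl.
  exists (2 * C) => [|y h Ch Hy By _]; first by rewrite mulr_gt0.
  rewrite -mulrA; apply: inner_le_sup; first exact: dsys_VC Hy.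
  exact: HC Hy By.
have [n En] : exists n, lam n = mu by have [_ H _] := hlam; exact/H.
have [C C0 HC] := energy_estimate Cp Cr.
exists (2 * C) => [|y h Ch Hy By /(_ n En) yv]; first by rewrite mulr_gt0.
have [t Et] := bform_eq0 By.1.
have [c c0 Ec] := v_left_neq0 n.
have [Hv Bv] := v_dsys n; rewrite En in Hv.
have Cy := dsys_VC Hy; have Cv := v_VC n.
pose w x := y x - (t / c) *: v n x.
have Hw : dsys p r mu w h.
  by apply: (dsys_ext (dsysB Hy (dsysZ (t / c) Hv))) => // x _; rewrite scaler0 subr0.
have Cw := dsys_VC Hw.
have w1 : w (-1) = 0 by rewrite /w Et Ec scalerA divfK // subrr.
have : inner w w <= 2 * (C * inner h h).
  apply: inner_le_sup => // x xI; apply: le_trans (HC _ _ _ Ch Hw x xI) _.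
  by rewrite w1 /sqn !mxE expr0n /= !add0r.
rewrite mulrA; apply: le_trans.
have CZ : VC (fun x => (t / c) *: v n x) by exact: VCZ.
rewrite /w innerBl ?innerBr ?innerZl ?innerZr //; try exact: VCB.
rewrite (innerC (v n)) yv v_ortho eqxx !mulr0 subr0 sub0r opprK mulr1 lerDl -expr2 sqr_ge0 //.
Qed.

Definition perp (N : nat) g := forall n : int, (`|n| <= N)%N -> inner g (v n) = 0.

Lemma perp_Tg N g : VC g -> perp N g -> perp N (Tg 0 g).
Proof. by move=> Cg Pg n nN; rewrite inner_Tg_v // Pg // mulr0. Qed.

Lemma Tg_lin h k c x : VC h -> VC k -> I11 x ->
  Tg 0 (fun t => h t + c *: k t) x = Tg 0 h x + c *: Tg 0 k x.
Proof.
move=> Ch Ck; have [H1 B1] := Tg_spec reg0 Ch; have [H2 B2] := Tg_spec reg0 Ck.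
apply: (@Tg_eq 0 _ (fun x => Tg 0 h x + c *: Tg 0 k x)) => //.
- exact: VCD Ch (VCZ c Ck).
- exact: dsysD H1 (dsysZ c H2).
- exact: bcs_lin.
Qed.

Lemma inner_ext2 u u' : (forall x, I11 x -> u x = u' x) -> inner u u = inner u' u'.
Proof. by move=> H; exact: inner_ext. Qed.

(** Let rho be the supremum of |T g|^2 over unit vectors g orthogonal to the
    low eigenfunctions, and mu = rho^(-1/2). If rho > m^-2, no eigenvalue +-mu
    belongs to a high index, so both A - mu and A + mu are coercive on the
    complement, hence so is 1 - mu^2 T^2. But a maximizing sequence makes |g -
    mu^2 T^2 g| tend to 0. No spectral theorem for compact operators is
    involved. *)
Lemma T_gap (m : R) (N : nat) : 0 < m ->
  (forall n : int, (N < `|n|)%N -> m < `|lam n|) ->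
  forall g, VC g -> perp N g ->
  inner (Tg 0 g) (Tg 0 g) <= m ^- 2 * inner g g.
Proof.
move=> m0 Hm.
have [C C0 HC] : exists2 C : R, 0 < C & forall g, VC g -> inner (Tg 0 g) (Tg 0 g) <= C * inner g g.
  have [C C0 HC] := resolvent_bound reg0.
  exists (2 * C) => [|g Cg]; first by rewrite mulr_gt0.
  have [H B] := Tg_spec reg0 Cg.
  by rewrite -mulrA; apply: inner_le_sup (dsys_VC H) _; exact: HC.
pose A : set R := [set inner (Tg 0 g) (Tg 0 g) | g in [set g | [/\ VC g, perp N g & inner g g <= 1]]].
have A0 : A 0.
  exists (fun=> 0).
    by split; [exact: VC0|move=> n _; rewrite inner0l|rewrite inner0l].
  apply/eqP; rewrite eq_le inner_ge0 andbT.
  by apply: le_trans (HC _ VC0) _; rewrite inner0l mulr0.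
have Aub : ubound A C.
  move=> _ [g [Cg _ g1] <-]; apply: le_trans (HC g Cg) _.
  by rewrite -[leRHS]mulr1 ler_wpM2l // ltW.
have AS : has_sup A by split; [exists 0|exists C].
pose rho := sup A.
have rho0 : 0 <= rho by apply: ub_le_sup => //; exists C.
have Hrho g : VC g -> perp N g -> inner (Tg 0 g) (Tg 0 g) <= rho * inner g g.
  move=> Cg Pg; have := inner_ge0 g; rewrite le_eqVlt => /predU1P[g0|g0].
    by have := HC g Cg; rewrite -g0 !mulr0.
  pose s := (Num.sqrt (inner g g))^-1.
  have s2 : s ^+ 2 = (inner g g)^-1 by rewrite /s exprVn sqr_sqrtr // ltW.
  have CsG : VC (fun x => s *: g x) by exact: VCZ.
  have CT := Tg_VC reg0 Cg.
  have : A (s ^+ 2 * inner (Tg 0 g) (Tg 0 g)).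
    exists (fun x => s *: g x).
      split => //; first by move=> n nN; rewrite innerZl ?Pg ?mulr0 //; exact: v_VC.
      by rewrite innerZl // innerZr // mulrA -expr2 s2 mulVf // gt_eqF.
    rewrite (inner_ext2 (u' := fun x => s *: Tg 0 g x)).
      by rewrite innerZl ?innerZr //; [rewrite mulrA expr2|exact: VCZ].
    move=> x xI; have := @Tg_lin (fun=> 0) g s x VC0 Cg xI.
    have -> : (fun t => 0 + s *: g t) = (fun t => s *: g t) by apply/funext => t; rewrite add0r.
    move=> ->; rewrite (@Tg_eq 0 _ (fun=> 0) reg0 VC0 (dsys0 _ _ _) _ _ xI) ?add0r //.
    by split; rewrite /bform !mxE; ring.
  have := ub_le_sup (ex_intro _ C Aub) => /[apply].
  by rewrite s2 mulrC ler_pdivrMr.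
suff rm : rho <= m ^- 2.
  move=> g Cg Pg; apply: le_trans (Hrho g Cg Pg) _.
  by rewrite ler_wpM2r // inner_ge0.
rewrite leNgt; apply/negP => rm.
have m2 : 0 < m ^- 2 by rewrite invr_gt0 exprn_gt0.
have rp : 0 < rho by exact: lt_trans rm.
(* mu ^ 2 is the reciprocal of the supremum, the only possible eigenvalue of A^2
   produced by a maximizing sequence *)
pose mu := (Num.sqrt rho)^-1.
have sq0 : 0 < Num.sqrt rho by rewrite sqrtr_gt0.
have mu0 : 0 < mu by rewrite invr_gt0.
have mu2 : mu ^+ 2 = rho^-1 by rewrite /mu exprVn sqr_sqrtr // ltW.
have mum : mu <= m.
  apply: sqr_le_le; first exact: ltW.
  by rewrite mu2 -[m ^+ 2]invrK lef_pV2 ?posrE ?exprn_gt0 ?invr_gt0 // ?exprn_gt0 // ltW.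
have [C1 C10 HC1] := coercive mu; have [C2 C20 HC2] := coercive (- mu).
have low n : `|lam n| = mu -> (`|n| <= N)%N.
  by move=> E; rewrite leqNgt; apply/negP => /Hm; rewrite E ltNge mum.
pose C3 := 2 + 2 * (C1 * C2 * mu ^+ 4).
have C30 : 0 < C3 by rewrite ltr_wpDr // !mulr_ge0 // ?exprn_ge0 ?(ltW mu0) ?(ltW C10) ?(ltW C20).
have key g : VC g -> perp N g ->
    rho ^+ 2 * inner g g <= C3 * (rho * (rho * inner g g - inner (Tg 0 g) (Tg 0 g))).
  move=> Cg Pg.
  have [H1 B1] := Tg_spec reg0 Cg; have CT := dsys_VC H1; have PT := perp_Tg Cg Pg.
  have [H2 B2] := Tg_spec reg0 CT; have CU := dsys_VC H2; have PU := perp_Tg CT PT.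
  set T1 := Tg 0 g in H1 B1 CT PT H2 B2 CU PU *; set T2 := Tg 0 T1 in H2 B2 CU PU *.
  have Hrg : inner T2 T2 <= rho * inner T1 T1 := Hrho T1 CT PT.
  (* symmetry of the solution operator *)
  have e1 : inner T2 g = inner T1 T1 by rewrite (Tg_sym reg0 CT Cg).
  clearbody T2; clearbody T1.
  pose y1 x := T1 x + mu *: T2 x.
  have Cy1 : VC y1 by exact: VCD CT (VCZ mu CU).
  have k1 : inner T2 T2 <= C2 * inner y1 y1.
    apply: (HC2 T2 y1 Cy1) => //.
      by apply: (dsys_ext (dsys_shift (- mu) H2)) => // x _; rewrite sub0r opprK.
    by move=> n En; apply/PU/low; rewrite En normrN gtr0_norm.
  pose d x := g x - mu ^+ 2 *: T2 x.
  have Cd : VC d by exact: VCB Cg (VCZ _ CU).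
  have k2 : inner y1 y1 <= C1 * inner d d.
    apply: (HC1 y1 d Cd).
    - apply: (dsys_ext (dsys_shift mu (dsysD H1 (dsysZ mu H2)))) => // x _.
      have L (a b c : 'cV[R]_2) : a + mu *: b + (0 - mu) *: (b + mu *: c) = a - mu ^+ 2 *: c.
        by apply/matrixP => i j; rewrite !mxE; ring.
      exact: L.
    - exact: bcs_lin.
    - move=> n En; rewrite innerDl ?innerZl ?PT ?PU ?mulr0 ?addr0 //; 
        by [apply: low; rewrite En gtr0_norm|exact: v_VC|exact: VCZ].
  have dd : inner d d = inner g g - 2 * mu ^+ 2 * inner T1 T1 + mu ^+ 4 * inner T2 T2.
    by rewrite (inner_quad _ Cg CU) (innerC g T2) e1; ring.
  have dd2 : rho ^+ 2 * inner d d <= rho * (rho * inner g g - inner T1 T1).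
    rewrite dd (_ : mu ^+ 4 = (mu ^+ 2) ^+ 2); last by rewrite -exprM.
    rewrite mu2.
    have -> : rho ^+ 2 * (inner g g - 2 / rho * inner T1 T1 + rho^-1 ^+ 2 * inner T2 T2) =
       rho ^+ 2 * inner g g - 2 * rho * inner T1 T1 + inner T2 T2.
      by field; rewrite gt_eqF.
    lra.
  have gg : inner g g <= 2 * inner d d + 2 * mu ^+ 4 * inner T2 T2.
    by have := inner_split (mu ^+ 2) Cg CU; rewrite -exprM.
  have k3 : inner T2 T2 <= C2 * (C1 * inner d d).
    by apply: le_trans k1 _; rewrite ler_wpM2l // ltW.
  have k4 : inner g g <= C3 * inner d d.
    have := ler_wpM2l (exprn_ge0 4 (ltW mu0)) k3; rewrite /C3.
    lra.
  have := ler_wpM2l (sqr_ge0 rho) k4.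
  have := ler_wpM2l (ltW C30) dd2; lra.
(* small enough that the inequality key fails for a maximizer up to e *)
pose e := rho / (2 * (C3 + 1)).
have C31 : 0 < 2 * (C3 + 1) by rewrite mulr_gt0 // addr_gt0.
have e0 : 0 < e by rewrite divr_gt0.
have eE : e * (2 * (C3 + 1)) = rho by rewrite /e divfK // gt_eqF.
have [_ [g [Cg Pg g1] <-] He] := sup_adherent e0 AS.
rewrite -/rho in He.
have := key g Cg Pg; have := Hrho g Cg Pg.
set t := inner (Tg 0 g) (Tg 0 g) in He *; set n := inner g g in g1 *.
move=> Ht Hk.
have n0 : 0 <= n := inner_ge0 g.
have h1 : rho * n <= C3 * (rho * n - t).
  by rewrite -(ler_pM2l rp) mulrA -expr2 mulrCA.
have h2 : rho * n <= rho by rewrite -[leRHS]mulr1 ler_wpM2l.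
have h3 : C3 * (rho * n - t) <= C3 * e by rewrite ler_wpM2l ?(ltW C30) //; lra.
nra.
Qed.

Definition srange (N : nat) : seq int := [seq m%:Z - N%:Z | m <- index_iota 0 (2 * N).+1].

Lemma mem_srange N (k : int) : (k \in srange N) = (`|k| <= N)%N.
Proof.
apply/mapP/idP => [[m] + ->|kN].
  by rewrite mem_index_iota; lia.
by exists `|(k + N%:Z)%R|%N; [rewrite mem_index_iota; lia|lia].
Qed.

Lemma srange_uniq N : uniq (srange N).
Proof. by rewrite map_inj_uniq ?iota_uniq // => a b; lia. Qed.

Definition fsum (N : nat) g x : 'cV[R]_2 := \sum_(n <- srange N) inner (v n) g *: v n x.
Definition resid (N : nat) g x : 'cV[R]_2 := g x - fsum N g x.

Lemma fsum_VC N g : VC (fsum N g).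
Proof. by apply: VC_sum => n _; apply: VCZ; exact: v_VC. Qed.

Lemma resid_VC N g : VC g -> VC (resid N g).
Proof. by move=> Cg; apply: VCB => //; exact: fsum_VC. Qed.

Lemma inner_fsum N g (k : int) : inner (fsum N g) (v k) = if (`|k| <= N)%N then inner (v k) g else 0.
Proof.
rewrite /fsum inner_suml; [|by move=> n; apply: VCZ; exact: v_VC|exact: v_VC].
under eq_bigr => n _ do rewrite (innerZl _ (v_VC n) (v_VC k)) v_ortho.
rewrite -mem_srange; case: ifP => kN.
  rewrite (bigD1_seq k) ?srange_uniq //= eqxx mulr1 big1 ?addr0 // => n /negPf ->.
  by rewrite mulr0.
rewrite big_seq big1 // => n nN; case: eqP => [E|_]; last by rewrite mulr0.
by rewrite E kN in nN.
Qed.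

Lemma resid_perp N g : VC g -> perp N (resid N g).
Proof.
move=> Cg n nN; rewrite innerBl //; [|exact: fsum_VC|exact: v_VC].
by rewrite inner_fsum nN innerC subrr.
Qed.

Lemma bessel N g : VC g ->
  inner (resid N g) (resid N g) = inner g g - \sum_(n <- srange N) inner (v n) g ^+ 2.
Proof.
move=> Cg; have Cf := fsum_VC N g; have CR := resid_VC N Cg.
have E0 : inner (resid N g) (fsum N g) = 0.
  rewrite innerC /fsum inner_suml // ?big1_seq // => [n /=|n]; last by apply: VCZ; exact: v_VC.
  rewrite mem_srange => nN; rewrite innerZl //; last exact: v_VC.
  by rewrite (innerC (v n) (resid N g)) resid_perp // mulr0.
rewrite {2}/resid innerBr // E0 subr0 innerC /resid innerBr // innerC; congr (_ - _).
rewrite /fsum inner_suml //; last by move=> n; apply: VCZ; exact: v_VC.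
by apply: eq_bigr => n _; rewrite innerZl //; exact: v_VC.
Qed.

Lemma resid_le N g : VC g -> inner (resid N g) (resid N g) <= inner g g.
Proof.
by move=> Cg; rewrite bessel // gerBl; apply: sumr_ge0 => n _; exact: sqr_ge0.
Qed.

Lemma lam_large (m : R) : exists N : nat, forall n : int, (N < `|n|)%N -> m < `|lam n|.
Proof.
have [_ _ [C [M H]]] := hlam.
set th := theta alpha beta p r in H.
exists (M + Num.trunc ((`|m| + `|C| + `|th| / 2) / (pi / 2)))%N => n nN.
have pp : (0 : R) < pi / 2 by rewrite divr_gt0 // pi_gt0.
have nM : (M < `|n|)%N by lia.
have := H n nM tt I => Hn.
have n1 : (1 : R) <= `|n|%:R by rewrite ler1n; lia.
have nE : `|n%:~R| = `|n|%:R :> R by rewrite -intr_norm natr_absz.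
have Cn : C / `|n%:~R| <= `|C|.
  rewrite nE ler_pdivrMr; last by lra.
  apply: le_trans (ler_norm C) _; have := normr_ge0 C; nra.
have big : `|m| + `|C| + `|th| / 2 < pi / 2 * `|n|%:R.
  rewrite [ltRHS]mulrC -ltr_pdivrMr //; apply: lt_le_trans (truncnS_gt _) _.
  by rewrite ler_nat; exact: leq_ltn_trans (leq_addl M _) nN.
have t1 : `|pi * n%:~R / 2 - th / 2| - `|lam n| <= `|C|.
  apply: le_trans Cn; apply: le_trans Hn; rewrite (distrC (lam n)); exact: lerB_dist.
have t2 : pi / 2 * `|n|%:R - `|th| / 2 <= `|pi * n%:~R / 2 - th / 2|.
  apply: le_trans (lerB_dist _ _).
  rewrite normrM (normrM th) normrM nE (ger0_norm (ltW (pi_gt0 R))).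
  by rewrite (ger0_norm (_ : 0 <= 2^-1)) ?invr_ge0 //; lra.
have := ler_norm m; lra.
Qed.

Lemma Tg_ext h k x : (forall t, I11 t -> h t = k t) -> Tg 0 h x = Tg 0 k x.
Proof.
move=> hk; apply/colP => i; rewrite !mxE; apply: integral11_ext => s sI.
by rewrite hk.
Qed.

Lemma resid_Tg N h x : VC h -> I11 x -> resid N (Tg 0 h) x = Tg 0 (resid N h) x.
Proof.
move=> Ch xI; apply/esym.
have [H B] := Tg_spec reg0 Ch.
pose y t := Tg 0 h t - \sum_(n <- srange N) inner (v n) h *: ((lam n)^-1 *: v n t).
have -> : resid N (Tg 0 h) x = y x.
  congr (_ - _); apply: eq_bigr => n _.
  by rewrite innerC inner_Tg_v // (innerC h) scalerA mulrC.
have {H B} [Hy By] : dsys p r 0 y (resid N h) /\ bcs y.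
  rewrite /y /resid /fsum.
  elim: (srange N) => [|n s [IH1 IH2]].
    split; first by apply: (dsys_ext H) => t _; rewrite big_nil subr0.
    by rewrite /bcs !big_nil !subr0.
  have [Hn Bn] := v_dsys n.
  have Hn0 : dsys p r 0 (fun t => (lam n)^-1 *: v n t) (v n).
    apply: (dsys_ext (dsysZ (lam n)^-1 (dsys_shift 0 Hn))) => // t _.
    by rewrite add0r subr0 scalerA mulVf ?scale1r // lam_neq0.
  split.
    apply: (dsys_ext (dsysB IH1 (dsysZ (inner (v n) h) Hn0))) => t _;
    by rewrite big_cons opprD addrA addrAC.
  have B2 := bcs_lin (- (inner (v n) h * (lam n)^-1)) IH2 Bn.
  move: B2; rewrite /bcs !big_cons !scalerA !scaleNr => B2.
  have E a b c : a - (b + c) = a - c - b by rewrite opprD addrA addrAC.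
  by rewrite !E.
exact: (Tg_eq reg0 (resid_VC N Ch) Hy By).
Qed.

(** The remainder of T h is T applied to the remainder of h, which T_gap makes
    small. *)
Lemma complete_dom h : VC h -> forall e : R, 0 < e -> exists N0, forall N, (N0 <= N)%N ->
  inner (resid N (Tg 0 h)) (resid N (Tg 0 h)) <= e.
Proof.
move=> Ch e e0; set H := inner h h.
have H0 : 0 <= H := inner_ge0 h.
have H1 : 0 < (H + 1) / e by rewrite divr_gt0 // ltr_wpDl.
have [N0 HN0] := lam_large (Num.sqrt ((H + 1) / e)).
exists N0 => N N0N; have CR := resid_VC N Ch.
rewrite (inner_ext2 (fun x => resid_Tg N Ch)).
have m0 : 0 < Num.sqrt ((H + 1) / e) by rewrite sqrtr_gt0.
have Hm n : (N < `|n|)%N -> Num.sqrt ((H + 1) / e) < `|lam n|.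
  by move=> nN; apply: HN0; exact: leq_ltn_trans nN.
have PR : perp N (resid N h) by exact: resid_perp.
apply: le_trans (T_gap m0 Hm CR PR) _.
rewrite sqr_sqrtr ?(ltW H1) // invf_div mulrAC ler_pdivrMr ?ltr_wpDl // mulrC.
by rewrite [leRHS]mulrC ler_wpM2r ?(ltW e0) //; apply: le_trans (resid_le _ Ch) _; rewrite lerDl.
Qed.

Lemma resid_lin N g k c x : VC g -> VC k ->
  resid N (fun t => g t - c *: k t) x = resid N g x - c *: resid N k x.
Proof.
move=> Cg Ck; have E : fsum N (fun t => g t - c *: k t) x = fsum N g x - c *: fsum N k x.
  rewrite /fsum scaler_sumr -sumrB; apply: eq_bigr => n _.
  have Cv := v_VC n; rewrite (innerBr Cg (VCZ c Ck) Cv) (innerZr c Ck Cv).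
  by rewrite scalerBl scalerA.
by rewrite /resid E; apply/matrixP => i j; rewrite !mxE; ring.
Qed.

Lemma integral_ramp (e eps : R) : e ^+ 2 = 1 -> 0 < eps -> eps <= 1 ->
  C0 (ramp e eps) /\ integral11 (ramp e eps) = eps / 2.
Proof.
move=> e1 eps0 eps1; have Cd : C0 (dcutoff e eps) by exact: dcutoff_C0.
have E x : ramp e eps x = (eps / 2 * e) * dcutoff e eps x.
  rewrite /dcutoff (_ : _ * _ * _ = e ^+ 2 * ramp e eps x); first by rewrite e1 mul1r.
  by field; rewrite gt_eqF.
split; first by apply/C0_cont/ramp_cont.
rewrite (integral11_ext (v := fun x => (eps / 2 * e) * dcutoff e eps x)) //.
rewrite integral11Z // (integral11_HD (cutoff_HD e1 eps0)) //.
have c1 : cutoff e eps e = 1 by exact: cutoff_end.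
have c2 : cutoff e eps (- e) = 0 by apply: cutoff_far => //; rewrite mulrN -expr2 e1; lra.
have [ee|ee] := end_cases e1; move: c1 c2; rewrite ee ?opprK => -> ->; ring.
Qed.

Lemma inner_cutoff (e eps : R) b : e ^+ 2 = 1 -> 0 < eps -> eps <= 1 ->
  VC (fun x => cutoff e eps x *: b) /\
  inner (fun x => cutoff e eps x *: b) (fun x => cutoff e eps x *: b) <= eps * sqn b.
Proof.
move=> e1 eps0 eps1; have Cc := cutoff_C0 e1 eps0.
have CV : VC (fun x => cutoff e eps x *: b).
  by split; [apply: (C0_ext (C0M Cc (C0c (b 0 0))))|apply: (C0_ext (C0M Cc (C0c (b 1 0))))] => x _;
   rewrite mxE.
split => //; have [Cr' Ir] := integral_ramp e1 eps0 eps1.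
rewrite inner_sqn; apply: (@le_trans _ _ (integral11 (fun x => sqn b * ramp e eps x))).
  apply: integral11_le.
  - by move: (VC_inner CV CV) => /C0_ext; apply=> x _; rewrite /sqn !expr2.
  - by apply: C0M => //; exact: C0c.
  - move=> x xI; have r0 := ramp_ge0 e eps x; have r1 := ramp_le1 e1 eps0 xI.
    have -> : sqn (cutoff e eps x *: b) = sqn b * (ramp e eps x * ramp e eps x ^+ 3).
      by rewrite /sqn /cutoff !mxE; ring.
    rewrite ler_wpM2l ?sqn_ge0 // -[leRHS]mulr1 ler_wpM2l //.
    by rewrite exprn_ile1.
rewrite integral11Z // Ir; have := sqn_ge0 b; nra.
Qed.

Lemma inner_sum_le u w : VC u -> VC w ->
  inner (fun x => u x - (-1) *: w x) (fun x => u x - (-1) *: w x) <= 2 * (inner u u + inner w w).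
Proof.
move=> Cu Cw; have := inner_ge0 (fun x => u x - 1 *: w x).
rewrite (inner_quad 1 Cu Cw) (inner_quad (-1) Cu Cw); lra.
Qed.

Lemma split_boundary g h u1 k1 u2 k2 : VC h -> VC k1 -> VC k2 ->
  dsys p r 0 g h -> dsys p r 0 u1 k1 -> dsys p r 0 u2 k2 ->
  u1 1 = g 1 -> u1 (-1) = 0 -> u2 (-1) = g (-1) -> u2 1 = 0 ->
  forall x, I11 x -> Tg 0 (fun x => h x - (k1 x + k2 x)) x = g x - 1 *: (u1 x - (-1) *: u2 x).
Proof.
move=> Ch Ck1 Ck2 Hg H1 H2 e1 e2 e3 e4.
have Cd : VC (fun x => h x - (k1 x + k2 x)) by apply: VCB => //; exact: VCD.
apply: (@Tg_eq 0 _ (fun x => g x - 1 *: (u1 x - (-1) *: u2 x)) reg0 Cd).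
  apply: (dsys_ext (dsysB Hg (dsysD H1 H2))) => // x _.
  by rewrite scale1r scaleN1r opprK.
rewrite /bcs e1 e2 e3 e4 !scale1r scaleN1r scaler0 opprK add0r subr0 !subrr.
by split; rewrite /bform !mxE; ring.
Qed.

(** Subtracting cut-off copies of the boundary values gives a function in the
    range of the solution operator, at small L^2 distance. *)
Lemma approx_dom g h : VC h -> dsys p r 0 g h -> forall d : R, 0 < d ->
  exists hd u, [/\ VC hd, VC u, forall x, I11 x -> Tg 0 hd x = g x - 1 *: u x & inner u u <= d].
Proof.
move=> Ch Hg d d0; have Cg := dsys_VC Hg.
pose S := sqn (g 1) + sqn (g (-1)); have S0 : 0 <= S by rewrite addr_ge0 // sqn_ge0.
have [eps [eps0 eps1 epsd]] : exists eps : R, [/\ 0 < eps, eps <= 1 & 2 * (eps * S) <= d].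
  exists (Num.min 1 (d / (2 * (S + 1)))); split.
  - by rewrite lt_min ltr01 divr_gt0 // mulr_gt0 // ltr_wpDl.
  - by rewrite ge_min lexx.
  - apply: (@le_trans _ _ (2 * (d / (2 * (S + 1)) * S))).
      by rewrite ler_wpM2l // ler_wpM2r // ge_min lexx orbT.
    rewrite mulrCA mulrAC ler_pdivrMr ?mulr_gt0 ?ltr_wpDl // mulrCA; nra.
have P1 : (1 : R) ^+ 2 = 1 by rewrite expr1n.
have N1 : (-1 : R) ^+ 2 = 1 by rewrite sqrrN expr1n.
have [Cu1 Iu1] := inner_cutoff (g 1) P1 eps0 eps1.
have [Cu2 Iu2] := inner_cutoff (g (-1)) N1 eps0 eps1.
have hu1 := hcut_dsys 0 (g 1) P1 eps0; have hu2 := hcut_dsys 0 (g (-1)) N1 eps0.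
have Ch1 := hcut_VC 0 (g 1) P1 eps0; have Ch2 := hcut_VC 0 (g (-1)) N1 eps0.
exists (fun x => h x - (hcut 0 1 eps (g 1) x + hcut 0 (-1) eps (g (-1)) x)).
exists (fun x => cutoff 1 eps x *: g 1 - (-1) *: (cutoff (-1) eps x *: g (-1))).
split.
- by apply: VCB => //; exact: VCD.
- by apply: VCB => //; exact: VCZ.
- apply: (split_boundary Ch Ch1 Ch2 Hg hu1 hu2).
  + by rewrite cutoff_end // scale1r.
  + by rewrite cutoff_far ?scale0r //; lra.
  + by rewrite cutoff_end // scale1r.
  + by rewrite cutoff_far ?scale0r //; lra.
- apply: le_trans (inner_sum_le Cu1 Cu2) (le_trans _ epsd).
  by rewrite ler_wpM2l // /S mulrDr lerD.
Qed.

Lemma complete_C1 g h : VC h -> dsys p r 0 g h -> forall e : R, 0 < e ->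
  exists N0, forall N, (N0 <= N)%N -> inner (resid N g) (resid N g) <= e.
Proof.
move=> Ch Hg e e0; have Cg := dsys_VC Hg.
have e4 : 0 < e / 4 by rewrite divr_gt0.
have [hd [u [Chd Cu Eg Iu]]] := approx_dom Ch Hg e4.
have [N0 HN0] := complete_dom Chd e4.
exists N0 => N /HN0 HN.
have CR := resid_VC N Cg; have CRu := resid_VC N Cu.
have Eres x : I11 x -> resid N g x - 1 *: resid N u x = resid N (Tg 0 hd) x.
  move=> xI; rewrite -(resid_lin N 1 x Cg Cu) /resid (Eg x xI); congr (_ - _).
  apply: eq_bigr => n _; congr (_ *: _); apply: inner_ext => // t tI; by rewrite Eg.
have L (a b c d : R) : d <= e / 4 -> a <= e / 4 -> b <= a -> c <= 2 * d + 2 * b -> c <= e.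
  by lra.
apply: (L _ _ _ _ HN Iu (resid_le N Cu)).
by have := inner_split 1 CR CRu; rewrite (inner_ext2 Eres) expr1n mulr1.
Qed.

Lemma parseval g h : VC h -> dsys p r 0 g h ->
  (fun M => \sum_(n <- srange M) inner (v n) g ^+ 2) @ \oo --> inner g g.
Proof.
move=> Ch Hg; apply/cvgrPdist_le => e e0.
have [N0 HN0] := complete_C1 Ch Hg e0.
exists N0 => // N /= /HN0; have Cg := dsys_VC Hg.
by rewrite -bessel // ger0_norm // inner_ge0.
Qed.

(** The main part of the source hcut is the derivative of the cut-off, an
    approximate unit mass at e; the other terms are bounded on an interval of
    length eps. Continuity of the kernel at e is relative to the interval minus
    x, whence the condition eps <= 1 - e x. *)
Lemma integral11_delta (e : R) (g0 g1 : R -> R) (l : R) b (x : R) :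
  e ^+ 2 = 1 -> -1 < x < 1 ->
  (@lebesgue_measure R).-integrable I11 (EFin \o g0) ->
  (@lebesgue_measure R).-integrable I11 (EFin \o g1) ->
  g0 s @[s --> within (I11 `\ x) (nbhs e)] --> g0 e ->
  g1 s @[s --> within (I11 `\ x) (nbhs e)] --> g1 e ->
  forall eta : R, 0 < eta -> exists eps : R, [/\ 0 < eps, eps <= 1, eps <= 1 - e * x &
   `|integral11 (fun s => g0 s * hcut l e eps b s 0 0 + g1 s * hcut l e eps b s 1 0)
     - e * (g0 e * b 1 0 - g1 e * b 0 0)| <= eta].
Proof.
move=> e1 xI Ig0 Ig1 Cg0 Cg1 eta eta0.
have ex0 : 0 < 1 - e * x by have [ee|ee] := end_cases e1; rewrite ee; lra.
have Cpl : C0 (fun x => p x + l) by apply: C0D => //; exact: C0c.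
have Crl : C0 (fun x => r x + l) by apply: C0D => //; exact: C0c.
have [Mp Mp0 HMp] := C0_bounded Cpl; have [Mr Mr0 HMr] := C0_bounded Crl.
pose M := Mp * `|b 0 0| + Mr * `|b 1 0|.
have M0 : 0 <= M by rewrite addr_ge0 // mulr_ge0 // ltW.
pose B := `|b 0 0| + `|b 1 0|; have B0 : 0 <= B by rewrite addr_ge0.
pose S := `|g0 e| + `|g1 e|; have S0 : 0 <= S by rewrite addr_ge0.
pose t := eta / (2 * (B + 1)).
have t0 : 0 < t by rewrite divr_gt0 // mulr_gt0 // ltr_wpDl.
have tB : t * B <= eta / 2.
  have : t * (2 * (B + 1)) = eta by rewrite /t divfK // gt_eqF // mulr_gt0 // ltr_wpDl.
  lra.
have [d d0 Hd] : exists2 d : R, 0 < d & forall s, I11 s -> s != x -> `|s - e| < d ->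
    `|g0 s - g0 e| <= t /\ `|g1 s - g1 e| <= t.
  move/cvgrPdist_le : Cg0 => /(_ t t0); move/cvgrPdist_le : Cg1 => /(_ t t0).
  rewrite /within /= => -[d1 /= d10 H1] [d2 /= d20 H2].
  exists (Num.min d1 d2); first by rewrite lt_min d10.
  move=> s sI sx; rewrite lt_min => /andP[sd1 sd2].
  have sx' : (I11 `\ x) s by split => //; exact/eqP.
  rewrite (distrC (g0 s) (g0 e)) (distrC (g1 s) (g1 e)).
  by split; [apply: H2|apply: H1] => //=; rewrite distrC.
pose eps := Num.min (Num.min 1 (1 - e * x)) (Num.min d (eta / (M * (S + 2 * t) + 1))).
have MS : 0 <= M * (S + 2 * t) by rewrite mulr_ge0 // addr_ge0 // mulr_ge0 // ltW.
have eps0 : 0 < eps by rewrite !lt_min ltr01 ex0 d0 divr_gt0 // ltr_wpDl.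
have [eps1 epsx epsd epse] : [/\ eps <= 1, eps <= 1 - e * x, eps <= d & eps <= eta / (M * (S + 2 * t) + 1)].
  by rewrite /eps !ge_min !lexx !orbT.
exists eps; split => //.
have [Cr' Ir] := integral_ramp e1 eps0 eps1.
pose kap s := 2 / eps * ramp e eps s.
have Ck : C0 kap by apply: C0M => //; exact: C0c.
have Ik : integral11 kap = 1.
  by rewrite integral11Z // Ir; field; rewrite gt_eqF.
have [Ch0 Ch1] := hcut_VC l b e1 eps0.
have mI : measurable (I11 : set (measurableTypeR R)) by exact: measurable_itv.
pose f s := g0 s * hcut l e eps b s 0 0 + g1 s * hcut l e eps b s 1 0.
have If : (@lebesgue_measure R).-integrable I11 (EFin \o f).
  exact: (integrableD mI (integrableM_C0 Ig0 Ch0) (integrableM_C0 Ig1 Ch1)).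
pose A := e * (g0 e * b 1 0 - g1 e * b 0 0).
have IA : (@lebesgue_measure R).-integrable I11 (EFin \o (fun s => A * kap s)).
  by apply: C0_integrable; apply: C0M => //; exact: C0c.
have EA : integral11 (fun s => A * kap s) = A by rewrite integral11Z // Ik mulr1.
rewrite -[X in _ - X]EA /integral11 -RintegralB //.
have IB : (@lebesgue_measure R).-integrable I11 (EFin \o (fun s => f s - A * kap s)).
  exact: (integrableB mI If IA).
apply: le_trans (le_normr_Rintegral mI IB) _.
pose K := t * B + eps / 2 * (M * (S + 2 * t)).
have K2 : K <= eta.
  have : eps * (M * (S + 2 * t) + 1) <= eta by rewrite -ler_pdivlMr // ltr_wpDl.
  rewrite /K; lra.
apply: (@le_trans _ _ (integral11 (fun s => K * kap s))); last first.
  by rewrite integral11Z // Ik mulr1.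
have CK : C0 (fun s => K * kap s) by apply: C0M => //; exact: C0c.
apply: le_Rintegral => //; [exact: integrable_norm|exact: C0_integrable|].
move=> s sI.
have k0 : 0 <= kap s by rewrite mulr_ge0 ?ramp_ge0 // divr_ge0 // ltW.
have [far|near] := leP eps (1 - e * s).
  have r0 : ramp e eps s = 0 by exact: ramp_far.
  rewrite /f /hcut !mxE /= /dcutoff /cutoff /kap r0 expr0n /= !(mulr0, mul0r, subr0, oppr0, addr0).
  by rewrite normr0.
have sx : s != x by apply/eqP => sx; move: near; rewrite sx ltNge epsx.
have se : `|s - e| < d.
  apply: lt_le_trans epsd; have /I11P sI' := sI.
  have [ee|ee] := end_cases e1; move: near; rewrite ee ltr_norml; lra.
have [G0 G1] := Hd s sI sx se.
have rl : cutoff e eps s <= eps / 2 * kap s.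
  rewrite /kap mulrA (_ : eps / 2 * (2 / eps) = 1); last by field; rewrite gt_eqF.
  rewrite mul1r /cutoff expr2 -[leRHS]mulr1 ler_wpM2l ?ramp_ge0 //; exact: ramp_le1.
have c0 : 0 <= cutoff e eps s by exact: sqr_ge0.
have -> : f s - A * kap s = e * kap s * ((g0 s - g0 e) * b 1 0 - (g1 s - g1 e) * b 0 0)
   - cutoff e eps s * (g0 s * ((p s + l) * b 0 0) + g1 s * ((r s + l) * b 1 0)).
  by rewrite /f /A /hcut !mxE /= /dcutoff /kap; ring.
have ne : `|e| = 1 by have [->|->] := end_cases e1; rewrite ?normrN normr1.
have Hg0 : `|g0 s| <= S + t.
  rewrite -[g0 s](subrK (g0 e)); apply: le_trans (ler_normD _ _) _.
  rewrite /S; have := normr_ge0 (g1 e); lra.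
have Hg1 : `|g1 s| <= S + t.
  rewrite -[g1 s](subrK (g1 e)); apply: le_trans (ler_normD _ _) _.
  rewrite /S; have := normr_ge0 (g0 e); lra.
apply: le_trans (ler_normB _ _) _; rewrite /K [leRHS]mulrDl; apply: lerD.
  rewrite normrM [`|e * _|]normrM ne mul1r (ger0_norm k0) mulrC ler_wpM2r //.
  apply: le_trans (ler_normB _ _) _; rewrite !normrM /B mulrDr addrC.
  by apply: lerD; rewrite ler_wpM2r.
rewrite normrM (ger0_norm c0) [leRHS]mulrAC.
apply: (@le_trans _ _ (cutoff e eps s * (M * (S + 2 * t)))); last first.
  by rewrite ler_wpM2r.
rewrite ler_wpM2l //; apply: le_trans (ler_normD _ _) _; rewrite !normrM.
have P0 : `|p s + l| * `|b 0 0| <= Mp * `|b 0 0| by rewrite ler_wpM2r // HMp.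
have P1 : `|r s + l| * `|b 1 0| <= Mr * `|b 1 0| by rewrite ler_wpM2r // HMr.
rewrite /M mulrDl; apply: lerD; rewrite mulrC; apply: ler_pM => //; rewrite ?mulr_ge0 //; lra.
Qed.

Lemma zsol_indep l e eps b x : regular l -> e ^+ 2 = 1 -> 0 < eps -> eps <= 1 -> I11 x ->
  zsol l e eps b x = zsol l e 1 b x.
Proof.
move=> nl e1 eps0 eps1.
have [H1 B1] := zsol_spec b nl e1 eps0 eps1.
have [H2 B2] := zsol_spec b nl e1 ltr01 (lexx 1).
exact: (bdata_uniq nl VC0 e1 H1 B1 H2 B2).
Qed.

(** The cut-off solution vanishes near x for small eps, so there zsol is minus
    the integral of the kernel against a source that tends to a point mass at
    e. *)
Lemma green_end l e b x i : regular l -> e ^+ 2 = 1 -> -1 < x < 1 ->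
  e * (G l x e i 0 * b 1 0 - G l x e i 1 * b 0 0) = - zsol l e 1 b x i 0.
Proof.
move=> nl e1 xI; have xI' : I11 x by apply/I11P; lra.
have [Gc Gi _] := hG nl.
have eI : (I11 `\ x) e.
  split; first by have [->|->] := end_cases e1; [exact: I11_1|exact: I11_N1].
  by move=> /= ex; move: xI; rewrite -ex; have [->|->] := end_cases e1; rewrite ltxx ?andbF.
have Ge j : G l x s i j @[s --> within (I11 `\ x) (nbhs e)] --> G l x e i j.
  by have /subspace_continuousP/(_ e eI)/cvg_mx := Gc x xI'; exact.
apply/eqP; rewrite -subr_eq0 -normr_le0; apply/ler_addgt0Pr => eta eta0; rewrite add0r.
have [eps [eps0 eps1 epsx]] := integral11_delta l b e1 xI (Gi x xI' i 0) (Gi x xI' i 1) (Ge 0) (Ge 1) eta0.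
have -> : integral11 (fun s => G l x s i 0 * hcut l e eps b s 0 0 + G l x s i 1 * hcut l e eps b s 1 0)
   = - zsol l e 1 b x i 0.
  rewrite -(zsol_indep b nl e1 eps0 eps1 xI') /zsol cutoff_far // scale0r sub0r mxE opprK mxE.
  apply: integral11_ext => s _; rewrite [RHS]mxE big_ord_recl big_ord1.
  by congr (_ + G l x s i _ * hcut l e eps b s _ 0); exact/val_inj.
by rewrite distrC.
Qed.

Definition Titer (k : nat) h := iter k (Tg 0) h.

Lemma Titer_VC (k : nat) h : VC h -> VC (Titer k h).
Proof. by move=> Ch; elim: k => [|k IH] //=; exact: Tg_VC. Qed.

Lemma Tg0_bound : exists2 K : R, 0 < K & forall h, VC h ->
  (forall x, I11 x -> sqn (Tg 0 h x) <= K * inner h h) /\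
  (forall (k : nat) x, I11 x -> sqn (Titer k.+1 h x) <= (2 * K) ^+ k.+1 * inner h h).
Proof.
have [K K0 HK] := resolvent_bound reg0.
have B h : VC h -> forall x, I11 x -> sqn (Tg 0 h x) <= K * inner h h.
  by move=> Ch x xI; have [H1 H2] := Tg_spec reg0 Ch; exact: HK H1 H2 x xI.
exists K => // h Ch; split; first exact: B.
have N (k : nat) : inner (Titer k h) (Titer k h) <= (2 * K) ^+ k * inner h h.
  elim: k => [|k IH]; first by rewrite mul1r.
  have CT := Titer_VC k Ch.
  apply: le_trans (inner_le_sup (Tg_VC reg0 CT) (B _ CT)) _.
  have K2 : 0 <= 2 * K by rewrite mulr_ge0 // ltW.
  by rewrite [leLHS]mulrA exprS -[leRHS]mulrA ler_wpM2l.
move=> k x xI; apply: le_trans (B _ (Titer_VC k Ch) x xI) _.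
have K2 : 0 <= 2 * K by rewrite mulr_ge0 // ltW.
rewrite exprS -mulrA; apply: (@le_trans _ _ (K * ((2 * K) ^+ k * inner h h))).
  by rewrite ler_wpM2l // ltW.
by rewrite ler_wpM2r ?mulr_ge0 ?exprn_ge0 ?inner_ge0 //; lra.
Qed.

(** Eigenfunctions are eigenvectors of T with eigenvalue 1 / lambda, and T is
    bounded. *)
Lemma regular_near0 : exists2 d : R, 0 < d & forall l, `|l| < d -> regular l.
Proof.
have [K K0 HK] := Tg0_bound.
have s0 : 0 < Num.sqrt (2 * K) by rewrite sqrtr_gt0 mulr_gt0.
exists (Num.sqrt (2 * K))^-1; first by rewrite invr_gt0.
move=> l ld ev; have [_ /(_ l)[/(_ ev)[n En] _] _] := hlam.
have := inner_le_sup (Tg_VC reg0 (v_VC n)) (HK _ (v_VC n)).1.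
rewrite (inner_ext2 (@Tg_v n)) innerZl ?innerZr //; try exact: v_VC; last exact: VCZ (v_VC n).
rewrite v_ortho eqxx !mulr1 -expr2 exprVn En => H.
have l0 : l != 0 by rewrite -En lam_neq0.
have l2 : 0 < l ^+ 2 by rewrite exprn_even_gt0.
have : l ^+ 2 < (2 * K)^-1.
  rewrite -(real_normK (num_real l)) -[X in _ < X^-1](sqr_sqrtr (ltW (mulr_gt0 _ K0))) //.
  by rewrite -exprVn ltrXn2r // ?nnegrE ?invr_ge0 ?(ltW s0).
rewrite -[ltRHS]mul1r ltr_pdivlMr ?mulr_gt0 // => h1.
have h2 : 1 <= 2 * K * l ^+ 2 by rewrite -ler_pdivrMr // div1r.
lra.
Qed.

(** Iteration of z_l = z_0 + l T z_l. *)
Lemma zsol_expand l e b n x : regular l -> e ^+ 2 = 1 -> I11 x ->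
  zsol l e 1 b x = \sum_(0 <= k < n) l ^+ k *: Titer k (zsol 0 e 1 b) x
     + l ^+ n *: Titer n (zsol l e 1 b) x.
Proof.
move=> nl e1.
have [H0 B0] := zsol_spec b reg0 e1 ltr01 (lexx 1).
have [Hl Bl] := zsol_spec b nl e1 ltr01 (lexx 1).
have Cl := dsys_VC Hl.
have [HT BT] := Tg_spec reg0 Cl.
set z0 := zsol 0 e 1 b in H0 B0 *; set z := zsol l e 1 b in Hl Bl Cl HT BT *.
clearbody z0 z.
have C0 := dsys_VC H0.
have step t : I11 t -> z t = z0 t + l *: Tg 0 z t.
  apply: (bdata_uniq reg0 (VCZ l Cl) e1 (b := b) (z := fun t => z0 t + l *: Tg 0 z t)) => //.
  - by apply: (dsys_ext (dsys_shift 0 Hl)) => // s _; rewrite add0r subr0.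
  - by apply: (dsys_ext (dsysD H0 (dsysZ l HT))) => // s _; rewrite add0r.
  - have [H3 H4] := bcs_end e1 BT; case: B0 => B1 B2.
    by split; rewrite bform_lin ?H3 ?H4 ?B1 ?B2 mulr0 addr0.
have stepk (k : nat) t : I11 t -> Titer k z t = Titer k z0 t + l *: Titer k.+1 z t.
  elim: k t => [|k IH] t tI; first exact: step.
  rewrite /Titer !iterS -/(Titer k z) -/(Titer k z0) -/(Titer k.+1 z).
  rewrite (Tg_ext _ IH); apply: Tg_lin => //; [exact: Titer_VC|exact: (Titer_VC k.+1)].
move=> xI; elim: n => [|n IH]; first by rewrite big_nil add0r expr0 scale1r.
rewrite big_nat_recr //= IH -addrA; congr (_ + _).
by rewrite (stepk n x xI) scalerDr scalerA exprSr.
Qed.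

Lemma sqn_coord a i (M : R) : 0 <= M -> sqn a <= M ^+ 2 -> `|a i 0| <= M.
Proof.
move=> M0 H; apply: sqr_le_le => //; rewrite real_normK ?num_real //.
apply: le_trans H; move: i; apply: I2P; rewrite /sqn ?lerDl ?lerDr; exact: sqr_ge0.
Qed.

(** Boundary vectors dual to the entries: pairing the kernel with wb j isolates
    column j. *)
Definition wb (j : 'I_2) : 'cV[R]_2 := \col_i if j == 0 then (if i == 1 then 1 else 0) else (if i == 0 then -1 else 0).

Lemma bdir_wb (g : R) : bdir g 0 0 * bform g (wb 0) + bdir g 1 0 * bform g (wb 1) = 1.
Proof. rewrite -(cos2Dsin2 g) /bform /wb /bdir !mxE /=; ring. Qed.

Lemma green_end_entry l e (x : R) i j : regular l -> e ^+ 2 = 1 -> -1 < x < 1 ->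
  G l x e i j = - e * zsol l e 1 (wb j) x i 0.
Proof.
move=> nl e1 xI; have := green_end (wb j) i nl e1 xI.
move=> /(congr1 ( *%R e)); rewrite mulrA -expr2 e1 mul1r mulrN mulNr => <-.
by move: j; apply: I2P; rewrite !mxE /=; ring.
Qed.

Lemma green_coefE (k : nat) e (x : R) i j : e ^+ 2 = 1 -> -1 < x < 1 ->
  green_coef G k x e i j = - e * Titer k (zsol 0 e 1 (wb j)) x i 0.
Proof.
move=> e1 xI; have xI' : I11 x by apply/I11P; lra.
have [K K0 HK] := Tg0_bound; have [d d0 Hd] := regular_near0.
pose kap := Num.sqrt (2 * K).
have K2 : 0 <= 2 * K by rewrite mulr_ge0 // ltW.
have kap0 : 0 < kap by rewrite sqrtr_gt0 mulr_gt0.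
have kap2 : kap ^+ 2 = 2 * K by rewrite sqr_sqrtr.
have bound h m i' : VC h -> `|Titer m.+1 h x i' 0| <= kap ^+ m.+1 * Num.sqrt (inner h h).
  move=> Ch; apply: sqn_coord; first by rewrite mulr_ge0 ?exprn_ge0 ?sqrtr_ge0 // ltW.
  rewrite exprMn sqr_sqrtr ?inner_ge0 // -exprM mulnC exprM kap2.
  exact: (HK h Ch).2.
have Cz l j' : regular l -> VC (zsol l e 1 (wb j')).
  by move=> nl; have [H _] := zsol_spec (wb j') nl e1 ltr01 (lexx 1); exact: dsys_VC H.
pose a i' j' m := - e * Titer m (zsol 0 e 1 (wb j')) x i' 0.
have ne : `|- e| = 1 by rewrite normrN; have [->|->] := end_cases e1; rewrite ?normrN normr1.
pose F (j2 : 'I_2) := Num.sqrt (inner (zsol 0 e 1 (wb j2)) (zsol 0 e 1 (wb j2)))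
   + \sum_(i' < 2) `|zsol 0 e 1 (wb j2) x i' 0|.
have F0 j2 : 0 <= F j2 by rewrite addr_ge0 ?sqrtr_ge0 ?sumr_ge0.
pose D := \sum_(j' < 2) F j'.
have Ha i' j' m : `|a i' j' m| <= D * kap ^+ m.
  have D1 : Num.sqrt (inner (zsol 0 e 1 (wb j')) (zsol 0 e 1 (wb j'))) <= D
     /\ `|zsol 0 e 1 (wb j') x i' 0| <= D.
    have S0 (j2 : 'I_2) : 0 <= \sum_(i' < 2) `|zsol 0 e 1 (wb j2) x i' 0| by apply: sumr_ge0.
    have S1 : `|zsol 0 e 1 (wb j') x i' 0| <= \sum_(i' < 2) `|zsol 0 e 1 (wb j') x i' 0|.
      by rewrite (bigD1 i') //= lerDl sumr_ge0.
    have S2 : F j' <= D by rewrite /D (bigD1 j') //= lerDl sumr_ge0.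
    rewrite /F in S2.
    have := sqrtr_ge0 (inner (zsol 0 e 1 (wb j')) (zsol 0 e 1 (wb j'))).
    by have := S0 j'; split; lra.
  rewrite /a normrM ne mul1r; case: m => [|m]; first by rewrite mulr1; exact: D1.2.
  apply: le_trans (bound _ m i' (Cz 0 j' reg0)) _; rewrite mulrC.
  by rewrite ler_wpM2r ?D1.1 // exprn_ge0 // ltW.
pose rho := Num.min d kap^-1.
have rho0 : 0 < rho by rewrite lt_min d0 invr_gt0.
have HF l : `|l| < rho -> forall i' j', pseries (a i' j') l @ \oo --> G l x e i' j'.
  rewrite lt_min => /andP[ld lk] i' j'; have nl := Hd l ld.
  rewrite green_end_entry //.
  have lk1 : `|l| * kap < 1 by rewrite -ltr_pdivlMr // div1r.
  have E n : pseries (a i' j') l n =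
     - e * (zsol l e 1 (wb j') x i' 0 - l ^+ n * Titer n (zsol l e 1 (wb j')) x i' 0).
    rewrite {1}(zsol_expand (wb j') n nl e1 xI') [X in X - _]mxE summxE [X in _ + X - _]mxE addrK.
    rewrite /pseries /series /= mulr_sumr; apply: eq_bigr => m _.
    by rewrite mxE /a; ring.
  rewrite (funext E).
  rewrite -[X in _ --> X](_ : - e * (zsol l e 1 (wb j') x i' 0 - 0) = _); last by rewrite subr0.
  apply: cvgM; first exact: cvg_cst.
  apply: cvgB; first exact: cvg_cst.
  rewrite -cvg_shiftS.
  have G0 : geometric (Num.sqrt (inner (zsol l e 1 (wb j')) (zsol l e 1 (wb j')))) (`|l| * kap) @ \oo --> 0.
    by apply: cvg_geometric; rewrite ger0_norm // mulr_ge0 // ltW.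
  rewrite -cvg_shiftS in G0.
  apply/norm_cvg0P; apply: squeeze_cvgr (cvg_cst 0) G0; apply: nearW => n /=.
  rewrite normr_ge0 /= normrM normrX exprMn.
  apply: (@le_trans _ _ (`|l| ^+ n.+1 * (kap ^+ n.+1 * Num.sqrt (inner (zsol l e 1 (wb j')) (zsol l e 1 (wb j')))))).
    by apply: ler_wpM2l; [exact: exprn_ge0|exact: (bound _ n i' (Cz l j' nl))].
  by rewrite le_eqVlt; apply/orP; left; apply/eqP; ring.
rewrite /green_coef mxE (derive1n_mx_pseries kap0 rho0 Ha HF) mulKf //.
Qed.

Variables (kp km : int -> R).
Hypotheses (hkp : forall n, v n 1 = kp n *: bdir beta)
  (hkm : forall n, v n (-1) = km n *: bdir alpha).

Definition kend e n := if e == 1 then kp n else km n.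

Lemma v_dsys0 n : dsys p r 0 (v n) (fun x => lam n *: v n x).
Proof.
by apply: (dsys_ext (dsys_shift 0 (v_dsys n).1)) => // x _; rewrite add0r subr0.
Qed.

Lemma bracket_v z n : bracket (z 1) (v n 1) - bracket (z (-1)) (v n (-1)) =
  kp n * bform beta (z 1) - km n * bform alpha (z (-1)).
Proof. by rewrite hkp hkm !bracket_bdir. Qed.

(** Lagrange's identity with an eigenfunction: each step trades a power of
    lambda_n for a boundary value and one application of A. *)
Lemma inner_v_byparts y h n : VC h -> dsys p r 0 y h ->
  lam n * inner (v n) y = inner (v n) h - (kp n * bform beta (y 1) - km n * bform alpha (y (-1))).
Proof.
move=> Ch Hy; have Cy := dsys_VC Hy; have Cv := v_VC n.
have := lagrange Ch (VCZ _ Cv) Hy (v_dsys0 n).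
rewrite bracket_v (innerZr _ Cv Cy) (innerC h) (innerC y) => <-; ring.
Qed.

Lemma inner_zsol e b n : e ^+ 2 = 1 ->
  inner (zsol 0 e 1 b) (v n) = - e * kend e n * bform (angle e) b / lam n.
Proof.
move=> e1; have [H [B1 B2]] := zsol_spec b reg0 e1 ltr01 (lexx 1).
move: H B1 B2; move: (zsol 0 e 1 b) => z H B1 B2.
have := inner_v_byparts n VC0 H; rewrite (innerC _ (fun=> 0)) inner0l sub0r.
rewrite innerC => Hn; apply: (mulfI (lam_neq0 n)).
rewrite Hn mulrCA divff ?mulr1 ?lam_neq0 //; move: B1 B2.
have [->|->] := end_cases e1; rewrite ?opprK /kend ?eqxx ?angle1 ?angleN1 ?lt_eqF ?ltN11 // => -> ->; ring.
Qed.

Lemma inner_Titer (k : nat) h n : VC h -> inner (Titer k h) (v n) = (lam n)^-1 ^+ k * inner h (v n).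
Proof.
move=> Ch; elim: k => [|k IH]; first by rewrite expr0 mul1r.
by rewrite inner_Tg_v ?IH ?exprS ?mulrA //; exact: Titer_VC.
Qed.

(** The derivative of order k of the Green matrix at the end e, divided by k!,
    applied to the direction of the boundary condition there (up to sign). *)
Definition endfun e (k : nat) x : 'cV[R]_2 :=
  \sum_(j < 2) bdir (angle e) j 0 *: Titer k (zsol 0 e 1 (wb j)) x.

Lemma zsol_VC e b : e ^+ 2 = 1 -> VC (zsol 0 e 1 b).
Proof. by move=> e1; have [H _] := zsol_spec b reg0 e1 ltr01 (lexx 1); exact: dsys_VC H. Qed.

(** C^1 functions with continuous image under A, without boundary conditions; f
    and Pfun belong to this class, where Parseval's identity is available. *)
Definition smooth y := exists2 h, VC h & dsys p r 0 y h.

Lemma smooth_lin y z c : smooth y -> smooth z -> smooth (fun x => y x + c *: z x).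
Proof.
move=> [h Ch Hy] [k Ck Hz]; exists (fun x => h x + c *: k x); first exact: VCD Ch (VCZ c Ck).
exact: dsysD Hy (dsysZ c Hz).
Qed.

Lemma smooth0 : smooth (fun=> 0).
Proof. exists (fun=> 0); [exact: VC0|exact: dsys0]. Qed.

Lemma smooth_ext y z : smooth y -> (forall x, I11 x -> y x = z x) -> smooth z.
Proof. by move=> [h Ch Hy] yz; exists h => //; exact: (dsys_ext Hy). Qed.

Lemma smooth_sum (I : Type) (s : seq I) (c : I -> R) (F : I -> R -> 'cV[R]_2) :
  (forall i, smooth (F i)) -> smooth (fun x => \sum_(i <- s) c i *: F i x).
Proof.
move=> H; elim: s => [|i s IH]; first by apply: (smooth_ext smooth0) => x _; rewrite big_nil.
by apply: (smooth_ext (smooth_lin (c i) IH (H i))) => x _; rewrite big_cons addrC.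
Qed.

Lemma endfun_smooth e (k : nat) : e ^+ 2 = 1 -> smooth (endfun e k).
Proof.
move=> e1; apply: smooth_sum => j; have Cz := zsol_VC (wb j) e1; case: k => [|k].
  have [H _] := zsol_spec (wb j) reg0 e1 ltr01 (lexx 1).
  by exists (fun=> 0); [exact: VC0|].
exists (Titer k (zsol 0 e 1 (wb j))); first exact: Titer_VC.
by have [H _] := Tg_spec reg0 (Titer_VC k Cz).
Qed.

Lemma smooth_VC y : smooth y -> VC y.
Proof. by move=> [h _ /dsys_VC]. Qed.

Lemma inner_endfun e (k : nat) n : e ^+ 2 = 1 ->
  inner (endfun e k) (v n) = - e * kend e n * (lam n)^-1 ^+ k.+1.
Proof.
move=> e1; rewrite inner_suml; [|by move=> j; apply: VCZ; apply: Titer_VC; exact: zsol_VC|exact: v_VC].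
rewrite (eq_bigr (fun j => - e * kend e n * (lam n)^-1 ^+ k.+1 * (bdir (angle e) j 0 * bform (angle e) (wb j)))).
  rewrite -mulr_sumr big_ord_recl big_ord1 (_ : lift ord0 ord0 = 1); last exact/val_inj.
  by rewrite (_ : ord0 = 0) // bdir_wb mulr1.
move=> j _; have Cz := zsol_VC (wb j) e1.
rewrite (innerZl _ (Titer_VC k Cz) (v_VC n)) inner_Titer // inner_zsol // exprS; ring.
Qed.

Lemma green_coef_bdir (k : nat) e g x : e ^+ 2 = 1 -> -1 < x < 1 ->
  green_coef G k x e *m (g *: bdir (angle e)) = - e * g *: endfun e k x.
Proof.
move=> e1 xI; apply/matrixP => i j; rewrite (ord1 j) mxE /endfun.
rewrite [RHS]mxE summxE mulr_sumr; apply: eq_bigr => j' _.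
by rewrite green_coefE // !mxE; ring.
Qed.

Definition Pfun q (g : 'rV[R]_q * 'rV[R]_q) x : 'cV[R]_2 :=
  \sum_(k < q) ((- g.1 0 k) *: endfun 1 k x + (- g.2 0 k) *: endfun (-1) k x).

Lemma Ptilde_Pfun q (g : 'rV[R]_q * 'rV[R]_q) x : -1 < x < 1 ->
  Ptilde alpha beta G g x = Pfun g x.
Proof.
move=> xI; apply: eq_bigr => k _.
have P1 : (1 : R) ^+ 2 = 1 by rewrite expr1n.
have N1 : (-1 : R) ^+ 2 = 1 by rewrite sqrrN expr1n.
have := green_coef_bdir k (g.1 0 k) P1 xI; rewrite angle1 => ->.
have := green_coef_bdir k (g.2 0 k) N1 xI; rewrite angleN1 => ->.
by rewrite opprK mul1r mulN1r !scaleNr.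
Qed.

Lemma Pfun_smooth q (g : 'rV[R]_q * 'rV[R]_q) : smooth (Pfun g).
Proof.
have P1 : (1 : R) ^+ 2 = 1 by rewrite expr1n.
have N1 : (-1 : R) ^+ 2 = 1 by rewrite sqrrN expr1n.
have H := smooth_lin 1 (smooth_sum (index_enum 'I_q) (fun k : 'I_q => - g.1 0 k) (fun k : 'I_q => endfun_smooth k P1))
   (smooth_sum (index_enum 'I_q) (fun k : 'I_q => - g.2 0 k) (fun k : 'I_q => endfun_smooth k N1)).
by apply: (smooth_ext H) => x _; rewrite scale1r /Pfun big_split.
Qed.

Lemma inner_Pfun q (g : 'rV[R]_q * 'rV[R]_q) n : inner (Pfun g) (v n) =
  (lam n)^-1 * \sum_(k < q) (lam n)^-1 ^+ k * (kp n * g.1 0 k - km n * g.2 0 k).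
Proof.
have P1 : (1 : R) ^+ 2 = 1 by rewrite expr1n.
have N1 : (-1 : R) ^+ 2 = 1 by rewrite sqrrN expr1n.
have C1 (k : 'I_q) := smooth_VC (endfun_smooth k P1).
have C2 (k : 'I_q) := smooth_VC (endfun_smooth k N1).
have Cv := v_VC n.
rewrite /Pfun inner_suml //; last by move=> k; exact: VCD (VCZ _ (C1 k)) (VCZ _ (C2 k)).
rewrite mulr_sumr; apply: eq_bigr => k _.
have {C1}C1 := C1 k; have {C2}C2 := C2 k.
have I1 := inner_endfun k n P1; have I2 := inner_endfun k n N1.
move: C1 C2 I1 I2; move: (endfun 1 k) (endfun (-1) k) => y z C1 C2 I1 I2.
rewrite (innerDl (VCZ (- g.1 0 k) C1) (VCZ (- g.2 0 k) C2) Cv).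
rewrite (innerZl _ C1 Cv) (innerZl _ C2 Cv) I1 I2.
have -> : kend 1 n = kp n by rewrite /kend eqxx.
have -> : kend (-1) n = km n by rewrite /kend lt_eqF // ltN11.
rewrite exprS; ring.
Qed.

Definition tends0 (u : int -> R) := forall e : R, 0 < e -> exists N : nat,
  forall n : int, (N < `|n|)%N -> `|u n| <= e.

Lemma big_srangeS (F : int -> R) N :
  \sum_(n <- srange N.+1) F n = \sum_(n <- srange N) F n + (F (N.+1%:Z) + F (- N.+1%:Z)).
Proof.
rewrite /srange !big_map (_ : (2 * N.+1).+1 = (2 * N).+3)%N; last lia.
rewrite big_nat_recr //= [X in X + _]big_nat_recl //=.
rewrite (_ : (2 * N).+2%:Z - N.+1%:Z = N.+1%:Z); last lia.
rewrite (_ : 0%:Z - N.+1%:Z = - N.+1%:Z); last lia.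
rewrite (eq_bigr (fun m : nat => F (m%:Z - N%:Z))); first ring.
by move=> m _; congr F; lia.
Qed.

(** The squares of the coefficients have bounded partial sums. *)
Lemma inner_v_tends0 g : VC g -> tends0 (fun n => inner (v n) g).
Proof.
move=> Cg e e0; pose S M := \sum_(n <- srange M) inner (v n) g ^+ 2.
have Sub : ubound (range S) (inner g g).
  by move=> _ [M _ <-]; have := inner_ge0 (resid M g); rewrite bessel // subr_ge0.
have HS : has_sup (range S) by split; [exists (S 0%N); exists 0%N|exists (inner g g)].
have e2 : 0 < e ^+ 2 by rewrite exprn_gt0.
have [_ [M _ <-] HM] := sup_adherent e2 HS.
have Smon : {homo S : a b / (a <= b)%N >-> a <= b}.
  apply: homo_leq => [//|b a c|N]; first exact: le_trans.
  by rewrite /S big_srangeS lerDl addr_ge0 // sqr_ge0.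
exists M => n nM; apply: sqr_le_le; first exact: ltW.
rewrite real_normK ?num_real //.
case En : `|n|%N nM => [//|N] nM.
have S1 : S N.+1 <= sup (range S) by apply: ub_le_sup; [exists (inner g g)|exists N.+1].
have S2 : S M <= S N by apply: Smon; rewrite -ltnS.
have : inner (v n) g ^+ 2 <= S N.+1 - S N.
  rewrite /S big_srangeS addrAC subrr add0r.
  have [->|->] : n = N.+1%:Z \/ n = - N.+1%:Z by lia.
    by rewrite lerDl sqr_ge0.
  by rewrite lerDr sqr_ge0.
lra.
Qed.

Lemma norm_intr (n : int) : `|n%:~R| = `|n|%N%:R :> R.
Proof. by rewrite -intr_norm natr_absz. Qed.

Lemma v_bounded : exists C : R, exists M : nat, 0 < C /\ forall n : int, (M < `|n|)%N ->
  forall x i, I11 x -> `|v n x i 0| <= C.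
Proof.
have [_ _ [C0 [M0 H0]] [C1 [M1 H1]]] := hv.
exists (`|K0| + `|C0| + `|C1| + 1), (M0 + M1)%N; split.
  by rewrite ltr_wpDl // !addr_ge0.
move=> n nM x i xI.
have n1 : 1 <= `|n%:~R| :> R by rewrite norm_intr ler1n; lia.
have n0 : 0 < `|n%:~R| :> R by lra.
have CD (C : R) : C / `|n%:~R| <= `|C|.
  rewrite ler_pdivrMr //; have := ler_norm C; have := normr_ge0 C; nra.
have {}H0 : `|v n x 0 0 - K0 * cos (xi p r (lam n) x - alpha)| <= `|C0|.
  by apply: le_trans (CD C0); apply: H0 => //; lia.
have {}H1 : `|v n x 1 0 - K0 * sin (xi p r (lam n) x - alpha)| <= `|C1|.
  by apply: le_trans (CD C1); apply: H1 => //; lia.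
have cb (a t : R) : `|t| <= 1 -> `|a * t| <= `|a|.
  by move=> t1; rewrite normrM -[leRHS]mulr1 ler_wpM2l.
have := normr_ge0 C0; have := normr_ge0 C1; have := normr_ge0 (K0 : R).
move: i; apply: I2P.
  rewrite -{1}[v n x 0 0](subrK (K0 * cos (xi p r (lam n) x - alpha))).
  have h1 := cb K0 _ (cos_max (xi p r (lam n) x - alpha)).
  have h2 := ler_normD (v n x 0 0 - K0 * cos (xi p r (lam n) x - alpha)) (K0 * cos (xi p r (lam n) x - alpha)).
  lra.
rewrite -{1}[v n x 1 0](subrK (K0 * sin (xi p r (lam n) x - alpha))).
have h1 := cb K0 _ (sin_max (xi p r (lam n) x - alpha)).
have h2 := ler_normD (v n x 1 0 - K0 * sin (xi p r (lam n) x - alpha)) (K0 * sin (xi p r (lam n) x - alpha)).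
lra.
Qed.

Lemma primitive_at (u : R -> R) : C0 u -> exists2 U, HD U u & U (-1) = 0.
Proof.
move=> /C0_primitive[U HU]; exists (fun x => U x - U (-1)); last by rewrite subrr.
by apply: (HD_ext (HDB HU (HDc (U (-1))))) => // x _; rewrite subr0.
Qed.

(** The system expresses lambda_n v_n, up to bounded terms, as the derivative
    of a component of v_n. *)
Lemma small_primitive (a w c : R -> R) l C Mc : l != 0 -> C0 c -> C0 w ->
  HD a (fun x => l * w x - c x * w x) ->
  (forall x, I11 x -> `|a x| <= C) -> (forall x, I11 x -> `|w x| <= C) ->
  (forall x, I11 x -> `|c x| <= Mc) ->
  exists2 W, HD W w & forall x, I11 x -> `|W x| <= C * (1 + 2 * Mc) / `|l|.
Proof.
move=> l0 Cc Cw Ha aC wC cM.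
have [P HP P0] := primitive_at (C0M Cc Cw).
exists (fun x => l^-1 * (a x + P x)).
  apply: (HD_ext (HDZ l^-1 (HDD Ha HP))) => // x _.
  by rewrite subrK mulKf.
move=> x xI; rewrite normrM normfV mulrC ler_wpM2r ?invr_ge0 //.
have C0' : 0 <= C by apply: le_trans (normr_ge0 _) (aC 1 I11_1).
have Mc0 : 0 <= Mc by apply: le_trans (normr_ge0 _) (cM 1 I11_1).
have /I11P /andP[x1 x2] := xI.
have Px : `|P x| <= Mc * C * (x - -1).
  rewrite -[P x]subr0 -P0; apply: (HD_lip HP _ (lexx _) x1 x2) => t tI.
  have tI' : I11 t by apply/I11P; lra.
  by rewrite normrM ler_pM ?cM ?wC.
apply: le_trans (ler_normD _ _) _; have := aC x xI.
have : Mc * C * (x - -1) <= Mc * C * 2 by rewrite ler_wpM2l ?mulr_ge0 //; lra.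
lra.
Qed.

(** The system turns lambda_n times the integrand into h0 v1' - h1 v0' up to a
    term without lambda_n, and AC_stieltjes applies because primitives of the
    components of v_n are O(1/lambda_n). *)
Lemma riemann_lebesgue h : VC h -> (forall i, abs_continuous (fun x => h x i 0)) ->
  tends0 (fun n => lam n * inner (v n) h + (kp n * bform beta (h 1) - km n * bform alpha (h (-1)))).
Proof.
move=> [Ch0 Ch1] ACh e e0.
have [C [M [Cgt0 HC]]] := v_bounded.
have eC : 0 < e / (4 * C) by rewrite divr_gt0 // mulr_gt0.
have [M0 M00 HM0] := AC_stieltjes Ch0 (ACh 0) eC.
have [M1 M10 HM1] := AC_stieltjes Ch1 (ACh 1) eC.
have [Mp Mp0 HMp] := C0_bounded Cp; have [Mr Mr0 HMr] := C0_bounded Cr.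
pose D := C * (1 + 2 * Mp) + C * (1 + 2 * Mr).
pose k x : 'cV[R]_2 := \col_i if i == 0 then p x * h x 0 0 else r x * h x 1 0.
have Ck : VC k.
  by split; [apply: (C0_ext (C0M Cp Ch0))|apply: (C0_ext (C0M Cr Ch1))] => x _; rewrite mxE.
have e4 : 0 < e / 4 by rewrite divr_gt0.
have [N1 HN1] := inner_v_tends0 Ck e4.
have [N2 HN2] := lam_large (4 * (M0 + M1) * D / e).
exists (M + N1 + N2)%N => n nN.
have nM : (M < `|n|)%N by lia.
have {}HN1 := HN1 n (ltac:(lia)); have {}HN2 := HN2 n (ltac:(lia)).
have {}HC := HC n nM.
have [v0' v1'] := v_dsys0 n; have [Cv0 Cv1] := v_VC n; have l0 := lam_neq0 n.
set v0 := (fun x => v n x 0 0) in v0' Cv0; set v1 := (fun x => v n x 1 0) in v1' Cv1.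
have d0 : HD v0 (fun x => - (lam n * v1 x + r x * v1 x)).
  by apply: (HD_ext v0') => // x _; rewrite mxE addr0.
have d1 : HD v1 (fun x => lam n * v0 x + p x * v0 x).
  by apply: (HD_ext v1') => // x _; rewrite mxE addr0.
have Cd0 : C0 (fun x => - (lam n * v1 x + r x * v1 x)).
  by apply: C0N; apply: C0D; apply: C0M => //; exact: C0c.
have Cd1 : C0 (fun x => lam n * v0 x + p x * v0 x).
  by apply: C0D; apply: C0M => //; exact: C0c.
have Bv0 x : I11 x -> `|v0 x| <= C by move=> xI; exact: HC.
have Bv1 x : I11 x -> `|v1 x| <= C by move=> xI; exact: HC.
have [W0 HW0 BW0] : exists2 W, HD W v0 & forall x, I11 x -> `|W x| <= C * (1 + 2 * Mp) / `|lam n|.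
  apply: (@small_primitive v1 v0 (fun x => - p x)) => //; first exact: C0N.
    by apply: (HD_ext d1) => // x _; ring.
  by move=> x xI; rewrite normrN HMp.
have [W1 HW1 BW1] : exists2 W, HD W v1 & forall x, I11 x -> `|W x| <= C * (1 + 2 * Mr) / `|lam n|.
  apply: (@small_primitive (fun x => - v0 x) v1 (fun x => - r x)) => //; first exact: C0N.
  - by apply: (HD_ext (HDN d0)) => // x _; ring.
  - by move=> x xI; rewrite normrN Bv0.
  - by move=> x xI; rewrite normrN HMr.
have E0 := HM0 v1 _ W1 C _ d1 Cd1 HW1 Bv1 BW1.
have E1 := HM1 v0 _ W0 C _ d0 Cd0 HW0 Bv0 BW0.
have CC : C * (e / (4 * C)) = e / 4 by field; rewrite gt_eqF.
rewrite CC in E0 E1.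
set I0 := integral11 _ in E0; set I1 := integral11 _ in E1.
have EI : lam n * inner (v n) h = I0 - I1 - inner (v n) k.
  rewrite innerE -integral11Z; last exact: VC_inner (v_VC n) _.
  have CA := C0M Ch0 Cd1; have CB := C0M Ch1 Cd0.
  rewrite /I0 /I1 innerE -(integral11B CA CB) -(integral11B (C0B CA CB) (VC_inner (v_VC n) Ck)).
  by apply: integral11_ext => x _; rewrite /k !mxE /= /v0 /v1; ring.
have EB : kp n * bform beta (h 1) - km n * bform alpha (h (-1)) =
   - (h 1 0 0 * v1 1 - h (-1) 0 0 * v1 (-1)) + (h 1 1 0 * v0 1 - h (-1) 1 0 * v0 (-1)).
  by rewrite /v0 /v1 hkp hkm /bform /bdir !mxE /=; ring.
have small : M0 * (C * (1 + 2 * Mr) / `|lam n|) + M1 * (C * (1 + 2 * Mp) / `|lam n|) <= e / 4.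
  have ln0 : 0 < `|lam n| by rewrite normr_gt0.
  have D0 : 0 <= C * (1 + 2 * Mp) by rewrite mulr_ge0 ?(ltW Cgt0) // addr_ge0 // mulr_ge0 // ltW.
  have D1 : 0 <= C * (1 + 2 * Mr) by rewrite mulr_ge0 ?(ltW Cgt0) // addr_ge0 // mulr_ge0 // ltW.
  rewrite !mulrA -mulrDl ler_pdivrMr //.
  have : 4 * (M0 + M1) * D <= `|lam n| * e by rewrite -ler_pdivrMr // ltW.
  have : M0 * (C * (1 + 2 * Mr)) <= M0 * D by rewrite ler_wpM2l // /D; lra.
  have : M1 * (C * (1 + 2 * Mp)) <= M1 * D by rewrite ler_wpM2l // /D; lra.
  rewrite !mulrA; lra.
rewrite EI EB.
set a := h 1 0 0 * v1 1 - _ in E0 *; set b := h 1 1 0 * v0 1 - _ in E1 *.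
have -> : I0 - I1 - inner (v n) k + (- a + b) = (I0 - a) - (I1 - b) - inner (v n) k by ring.
apply: le_trans (ler_normB _ _) _.
have := ler_normB (I0 - a) (I1 - b); lra.
Qed.

Lemma tends0_inv (u : int -> R) (C : R) M : (forall n : int, (M < `|n|)%N -> `|u n| <= C / `|n%:~R|) -> tends0 u.
Proof.
move=> H e e0; have := archi_boundP (divr_ge0 (normr_ge0 C) (ltW e0)).
move: (Num.Def.archi_bound _) => K HK.
exists (M + K)%N => n nM; apply: le_trans (H n _) _; first lia.
rewrite norm_intr; have n0 : 0 < `|n|%N%:R :> R by rewrite ltr0n; lia.
rewrite ler_pdivrMr // mulrC -ler_pdivrMr //.
apply: le_trans (_ : `|C| / e <= _); first by rewrite ler_wpM2r ?invr_ge0 ?ler_norm // ltW.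
by apply: le_trans (ltW HK) _; rewrite ler_nat; lia.
Qed.

Lemma cos_lip (a b : R) : `|cos a - cos b| <= `|a - b|.
Proof.
wlog ab : a b / b <= a.
  by move=> H; case: (leP b a) => [/H //|/ltW/H ab]; rewrite distrC [leRHS]distrC.
have D x : x \in `]b, a[ -> is_derive x 1 (@cos R) (- sin x) by move=> _; exact: is_derive_cos.
have [|c _ ->] := MVT_segment ab D.
  by apply: continuous_subspaceT => x; exact: continuous_cos.
by rewrite normrM normrN ler_piMl // sin_max.
Qed.

Lemma sin_lip (a b : R) : `|sin a - sin b| <= `|a - b|.
Proof.
wlog ab : a b / b <= a.
  by move=> H; case: (leP b a) => [/H //|/ltW/H ab]; rewrite distrC [leRHS]distrC.
have D x : x \in `]b, a[ -> is_derive x 1 (@sin R) (cos x) by move=> _; exact: is_derive_sin.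
have [|c _ ->] := MVT_segment ab D.
  by apply: continuous_subspaceT => x; exact: continuous_sin.
by rewrite normrM ler_piMl // cos_max.
Qed.

Definition esign (n : int) : R := if (2 %| n)%Z then 1 else -1.

Lemma trig_shift (n : int) (a : R) :
  cos (a + pi * n%:~R) = esign n * cos a /\ sin (a + pi * n%:~R) = esign n * sin a.
Proof.
have nat_case (m : nat) (c : R) : cos (c + pi * m%:R) = esign m * cos c /\ sin (c + pi * m%:R) = esign m * sin c.
  elim: m => [|m [IH1 IH2]]; first by rewrite mulr0 addr0 /esign /= !mul1r.
  have E : esign m.+1 = - esign m.
    rewrite /esign (_ : (2 %| m.+1%:Z)%Z = ~~ (2 %| m%:Z)%Z); last lia.
    by case: (m%:Z \in dvdz 2) => /=; rewrite ?opprK.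
  by rewrite -natr1 mulrDr mulr1 addrA cosDpi sinDpi IH1 IH2 E !mulNr.
case: n => m; first exact: nat_case.
have [h1 h2] := nat_case m.+1 (a + pi * (Negz m)%:~R).
have E : esign (Negz m) = esign m.+1.
  by rewrite /esign (_ : (2 %| Negz m)%Z = (2 %| m.+1%:Z)%Z) //; lia.
have E2 : esign m.+1 * esign m.+1 = 1.
  by rewrite /esign; case: ifP => _; rewrite ?mulrNN mulr1.
have A : a + pi * (Negz m)%:~R + pi * m.+1%:R = a.
  by rewrite NegzE mulrNz -pmulrn mulrN subrK.
by move: h1 h2; rewrite A => -> ->; rewrite E !mulrA E2 !mul1r.
Qed.

(** Recovers a scalar from its two components along a unit vector. *)
Lemma trig_split (x g s t : R) : `|x * cos g| <= s -> `|x * sin g| <= t -> `|x| <= s + t.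
Proof.
move=> h1 h2; rewrite -[x]mulr1 -(cos2Dsin2 g) mulrDr !expr2 !mulrA.
apply: le_trans (ler_normD _ _) _; apply: lerD; rewrite normrM -[leRHS]mulr1; apply: ler_pM => //.
  exact: cos_max.
exact: sin_max.
Qed.

Lemma half_int_N1 : half_int p r (-1) = 0.
Proof. by rewrite /half_int set_itv1 Rintegral_set1 mulr0. Qed.

Lemma km_asymp : tends0 (fun n => km n - K0).
Proof.
have [_ _ [C0 [M0 H0]] [C1 [M1 H1]]] := hv.
apply: (@tends0_inv _ (C0 + C1) (M0 + M1)%N) => n nM; rewrite mulrDl.
have {}H0 := H0 n (ltac:(lia)) _ I11_N1; have {}H1 := H1 n (ltac:(lia)) _ I11_N1.
rewrite hkm /xi half_int_N1 addr0 addNr mulr0 sub0r ?cosN ?sinN /bdir !mxE /= in H0 H1.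
apply: (trig_split (g := alpha)); first by rewrite mulrBl.
rewrite -normrN -mulrN; apply: le_trans H1; rewrite le_eqVlt; apply/orP; left; apply/eqP.
by congr `|_|; ring.
Qed.

(** At the right end the phase is pi n - beta up to O(1/n), which is where the
    sign depending on parity comes from. *)
Lemma kp_asymp : tends0 (fun n => kp n - K0 * esign n).
Proof.
have [_ _ [C0 [M0 H0]] [C1 [M1 H1]]] := hv.
have [_ _ [D [MD HD]]] := hlam.
have K1 : `|K0 : R| <= 1.
  rewrite /K0 ger0_norm ?invr_ge0 ?sqrtr_ge0 // invf_le1 ?sqrtr_gt0 //.
  by rewrite -[leLHS]sqrtr1 ler_wsqrtr // ler1n.
apply: (@tends0_inv _ ((C0 + 2 * D) + (C1 + 2 * D)) (M0 + M1 + MD)%N) => n nM; rewrite mulrDl.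
have {}H0 := H0 n (ltac:(lia)) _ I11_1; have {}H1 := H1 n (ltac:(lia)) _ I11_1.
have {}HD := HD n (ltac:(lia)) tt I.
set d := lam n - _ in HD.
have E : xi p r (lam n) 1 - alpha = (- beta + 2 * d) + pi * n%:~R.
  by rewrite /xi /d /theta; field.
have [T1 T2] := trig_shift n (- beta + 2 * d).
rewrite E T1 hkp /bdir !mxE /= in H0; rewrite E T2 hkp /bdir !mxE /= in H1.
have s1 : `|esign n| = 1 by rewrite /esign; case: ifP => _; rewrite ?normrN normr1.
have L1 := cos_lip (- beta + 2 * d) (- beta); have L2 := sin_lip (- beta + 2 * d) (- beta).
rewrite addrAC subrr add0r normrM (ger0_norm (ler0n _ 2)) cosN in L1.
rewrite addrAC subrr add0r normrM (ger0_norm (ler0n _ 2)) sinN opprK in L2.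
have W t : `|t| <= 2 * `|d| -> `|K0 * esign n * t| <= 2 * D / `|n%:~R|.
  move=> ht; rewrite !normrM s1 mulr1; apply: (@le_trans _ _ (1 * (2 * `|d|))); first by apply: ler_pM.
  by rewrite mul1r -mulrA ler_wpM2l.
apply: (trig_split (g := beta)); rewrite [leRHS]mulrDl.
  rewrite (_ : _ * cos beta = (kp n * cos beta - K0 * (esign n * cos (- beta + 2 * d))) +
     K0 * esign n * (cos (- beta + 2 * d) - cos beta)); last ring.
  by apply: le_trans (ler_normD _ _) _; apply: lerD => //; exact: W.
rewrite (_ : _ * sin beta = - (kp n * - sin beta - K0 * (esign n * sin (- beta + 2 * d))) -
   K0 * esign n * (sin (- beta + 2 * d) + sin beta)); last ring.
by apply: le_trans (ler_normB _ _) _; rewrite normrN; apply: lerD => //; exact: W.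
Qed.

(** Gives N / lambda_n = (2/pi) (N/n) (1 + o(1)). *)
Lemma lam_ratio : tends0 (fun n => n%:~R / lam n - 2 / pi).
Proof.
have [_ _ [D [MD HD]]] := hlam; have p0 := pi_gt0 R; have p1 : (pi : R) != 0 by rewrite gt_eqF.
have alg (P l X t : R) : P != 0 -> l != 0 -> X / l - 2 / P = - (2 / P * (l - (P * X / 2 - t / 2) - t / 2)) / l.
  by move=> P0 l0; field; rewrite P0 l0.
move=> e e0; have [N HN] := lam_large (2 / pi * (D + `|theta alpha beta p r / 2|) / e).
exists (MD + N)%N => n nM; have {}HD := HD n (ltac:(lia)) tt I; have {}HN := HN n (ltac:(lia)).
have l0 := lam_neq0 n; have ln0 : 0 < `|lam n| by rewrite normr_gt0.
have n1 : 1 <= `|n%:~R| :> R by rewrite norm_intr ler1n; lia.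
have n0 : 0 < `|n%:~R| :> R by lra.
have {}HD : `|lam n - (pi * n%:~R / 2 - theta alpha beta p r / 2)| <= D.
  have D0 : 0 <= D by have := le_trans (normr_ge0 _) HD; rewrite pmulr_lge0 ?invr_gt0.
  by apply: le_trans HD _; rewrite ler_pdivrMr // ler_peMr.
have -> : n%:~R / lam n - 2 / pi = - (2 / pi * ((lam n - (pi * n%:~R / 2 - theta alpha beta p r / 2)) - theta alpha beta p r / 2)) / lam n.
  exact: alg.
rewrite normrM normfV ler_pdivrMr // normrN normrM [`|2 / pi|]ger0_norm ?divr_ge0 ?(ltW p0) //.
apply: (@le_trans _ _ (2 / pi * (D + `|theta alpha beta p r / 2|))).
  rewrite ler_wpM2l ?divr_ge0 ?(ltW p0) //; apply: le_trans (ler_normB _ _) _; lra.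
by rewrite [leRHS]mulrC -ler_pdivrMr // ltW.
Qed.

(** A costs one derivative; the products with p and r have one derivative to
    spare. *)
Lemma dirac_step (k : nat) y : Ck k.+1 p -> Ck k.+1 r -> (forall i, ACk k.+1 (fun x => y x i 0)) ->
  dsys p r 0 y (dirac_op p r y) /\ forall i, ACk k (fun x => dirac_op p r y x i 0).
Proof.
move=> Ckp Ckr Hy; have /ACkSP[y0 D0 A0] := Hy 0; have /ACkSP[y1 D1 A1] := Hy 1.
pose y' x : 'cV[R]_2 := \col_i (if i == 0 then y0 x else y1 x).
have Hy' : VHD y y'.
  by split; [apply: (HD_ext D0)|apply: (HD_ext D1)] => // t _; rewrite mxE.
have Dy x : I11 x -> derive_on y x = y' x by exact: VHD_eq_derive_on.
have E0 x : I11 x -> dirac_op p r y x 0 0 = y1 x - p x * y x 0 0.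
  by move=> xI; rewrite dirac_op0 Dy // mxE.
have E1 x : I11 x -> dirac_op p r y x 1 0 = - y0 x - r x * y x 1 0.
  by move=> xI; rewrite dirac_op1 Dy // mxE.
split.
  split; [apply: (HD_ext D0) => // x xI; rewrite E1 //|apply: (HD_ext D1) => // x xI; rewrite E0 //]; ring.
have C0y i : Ck k.+1 (fun x => y x i 0) by have [] := Hy i.
apply: I2P.
  apply: (ACk_ext (u := fun x => y1 x + - (p x * y x 0 0))) => [|x xI]; last by rewrite E0.
  have M0 := CkM Ckp (C0y 0).
  exact: ACkD A1 (ACkN (Ck_ACk M0)).
apply: (ACk_ext (u := fun x => - y0 x + - (r x * y x 1 0))) => [|x xI]; last by rewrite E1.
have M1 := CkM Ckr (C0y 1).
exact: ACkD (ACkN A0) (ACkN (Ck_ACk M1)).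
Qed.

(** q integrations by parts against the eigenfunction, and the Riemann-Lebesgue
    lemma for the last remainder. *)
Lemma coef_expand (q : nat) (f : R -> 'cV[R]_2) : Ck q p -> Ck q r ->
  (forall i, ACk q (fun x => f x i 0)) -> exists2 rho, tends0 rho &
  forall n, inner (v n) f = (lam n)^-1 * (\sum_(k < q) (lam n)^-1 ^+ k *
      (kp n * bvalue p r f beta 1 k - km n * bvalue p r f alpha (-1) k) +
    (lam n)^-1 ^+ q * (kp n * bvalue p r f beta 1 q - km n * bvalue p r f alpha (-1) q + rho n)).
Proof.
move=> Ckp Ckr Hf; pose F j := iter j (dirac_op p r) f.
have HF (j : nat) : (j <= q)%N -> forall i, ACk (q - j)%N (fun x => F j x i 0).
  elim: j => [|j IH] jq; first by rewrite subn0.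
  have Eq : (q - j = (q - j.+1).+1)%N by lia.
  have := IH (ltnW jq); rewrite Eq => Hj.
  have le : ((q - j.+1).+1 <= q)%N by lia.
  by have [_] := dirac_step (Ck_le le Ckp) (Ck_le le Ckr) Hj.
have DF (j : nat) : (j < q)%N -> dsys p r 0 (F j) (F j.+1).
  move=> jq; have Eq : (q - j = (q - j.+1).+1)%N by lia.
  have := HF j (ltnW jq); rewrite Eq => Hj.
  have le : ((q - j.+1).+1 <= q)%N by lia.
  by have [] := dirac_step (Ck_le le Ckp) (Ck_le le Ckr) Hj.
have CF (j : nat) : (j <= q)%N -> VC (F j).
  move=> jq; have C i : C0 (fun x => F j x i 0).
    by have [/Ck_le-/(_ 0 (leq0n _))/Ck0] := HF j jq i.
  by split; exact: C.
have bE (g e : R) (k : nat) : bvalue p r f g e k = - bform g (F k e).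
  by rewrite /bvalue /bform -/(F k) opprD mulNr.
have part (j : nat) n : (j <= q)%N -> inner (v n) f = (lam n)^-1 * (\sum_(k < j) (lam n)^-1 ^+ k *
      (kp n * bvalue p r f beta 1 k - km n * bvalue p r f alpha (-1) k)) + (lam n)^-1 ^+ j * inner (v n) (F j).
  elim: j => [|j IH] jq; first by rewrite big_ord0 mulr0 add0r mul1r.
  rewrite IH ?(ltnW jq) // big_ord_recr /= mulrDr -addrA; congr (_ + _).
  have := inner_v_byparts n (CF j.+1 jq) (DF j jq); rewrite !bE => H.
  rewrite -[inner (v n) (F j)](mulKf (lam_neq0 n)) H exprS; ring.
have ACF i : abs_continuous (fun x => F q x i 0).
  by have := HF q (leqnn q) i; rewrite subnn => /ACk0[].
eexists; first exact: riemann_lebesgue (CF q (leqnn q)) ACF.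
move=> n; rewrite (part q n (leqnn q)) mulrDr; congr (_ + _).
transitivity ((lam n)^-1 * ((lam n)^-1 ^+ q * (lam n * inner (v n) (F q)))).
  by rewrite [RHS]mulrCA mulKf ?lam_neq0.
by rewrite !bE; congr (_ * (_ * _)); ring.
Qed.

(** The end points are a null set; the correction is only identified on the
    open interval. *)
Lemma integral11_open (u w : R -> R) : C0 w -> (forall x, -1 < x < 1 -> u x = w x) ->
  integral11 u = integral11 w.
Proof.
move=> Cw uw; rewrite /integral11 /Rintegral; congr fine.
have /measurable_EFinP mI := measurable_int _ (C0_integrable Cw).
have sub : (`](-1), 1[ : set R) `<=` I11.
  by move=> x; rewrite /= in_itv /= => /andP[h1 h2]; apply/I11P; rewrite !ltW.
have uw' : {in `](-1), 1[, u =1 w} by move=> x; rewrite in_itv /= => /uw.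
apply: eq_integral_itv_bounded => //; last exact: (measurable_funS (measurable_itv _) sub mI).
apply: (eq_measurable_fun w) => [x|]; last exact: (measurable_funS (measurable_itv _) sub mI).
by rewrite inE /= => /uw' ->.
Qed.

Lemma inner_open y z y' z' : VC y' -> VC z' -> (forall x, -1 < x < 1 -> y x = y' x) ->
  (forall x, -1 < x < 1 -> z x = z' x) -> inner y z = inner y' z'.
Proof.
move=> Cy Cz Ey Ez; rewrite [RHS]innerE; apply: (integral11_open (VC_inner Cy Cz)) => x xI.
rewrite Ey // Ez // mxE big_ord_recl big_ord1 !mxE.
by congr (_ + y' x _ _ * z' x _ _); exact/val_inj.
Qed.

Lemma inner_Ptilde q (g : 'rV[R]_q * 'rV[R]_q) n : inner (Ptilde alpha beta G g) (v n) = inner (Pfun g) (v n).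
Proof.
apply: inner_open => // [||x]; [exact: smooth_VC (Pfun_smooth g)|exact: v_VC|exact: Ptilde_Pfun].
Qed.

Lemma keg_error_resid q f (n : 'I_(2 * q) -> int) N x : -1 < x < 1 -> VC f ->
  keg_error alpha beta lam v kp km G f n N x =
  resid N (fun t => f t - Pfun (keg_solution lam v kp km f n) t) x.
Proof.
move=> xI Cf; rewrite /keg_error /keg_approx /resid /fsum Ptilde_Pfun //.
move: (keg_solution _ _ _ _ _ _) => g; rewrite opprD addrA; congr (_ - _).
rewrite /srange big_map; apply: eq_bigr => m _; congr (_ *: _).
by rewrite inner_Ptilde [X in _ - X]innerC (innerBr Cf (smooth_VC (Pfun_smooth g)) (v_VC _)).
Qed.

Lemma error_norm q f (n : 'I_(2 * q) -> int) N (F : int -> R) : smooth f ->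
  (forall m, F m = inner (v m) f - inner (Pfun (keg_solution lam v kp km f n)) (v m)) ->
  (fun M => \sum_(0 <= j < M) (F (N.+1 + j)%:Z ^+ 2 + F (- (N.+1 + j)%:Z) ^+ 2)) @ \oo -->
  L2norm (keg_error alpha beta lam v kp km G f n N) ^+ 2.
Proof.
move=> Sf FE0; have Cf := smooth_VC Sf.
have E x : -1 < x < 1 -> _ := fun xI => keg_error_resid n N xI Cf.
rewrite /L2norm; move: E FE0; move: (keg_error _ _ _ _ _ _ _ _ _ _) (keg_solution _ _ _ _ _ _) => err g E FE0.
have SP := Pfun_smooth g; have CP := smooth_VC SP.
have [h Ch Hg] := smooth_lin (-1) Sf SP.
have {}Hg : dsys p r 0 (fun t => f t - Pfun g t) h.
  by apply: (dsys_ext Hg) => // t _; rewrite scaleN1r.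
have Cg := dsys_VC Hg.
have FE m : inner (v m) (fun t => f t - Pfun g t) = F m.
  by rewrite FE0 (innerBr Cf CP (v_VC m)) (innerC (Pfun g)).
have -> : Num.sqrt (inner err err) ^+ 2 = inner (fun t => f t - Pfun g t) (fun t => f t - Pfun g t)
    - \sum_(m <- srange N) F m ^+ 2.
  have CR := resid_VC N Cg.
  rewrite (inner_open CR CR E E) sqr_sqrtr ?inner_ge0 // bessel //.
  by congr (_ - _); apply: eq_bigr => m _; rewrite FE.
have PV := parseval Ch Hg.
have SE M : \sum_(0 <= j < M) (F (N.+1 + j)%:Z ^+ 2 + F (- (N.+1 + j)%:Z) ^+ 2) =
   \sum_(m <- srange (M + N)) F m ^+ 2 - \sum_(m <- srange N) F m ^+ 2.
  elim: M => [|M IH]; first by rewrite big_nil subrr.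
  by rewrite big_nat_recr //= IH !addSn (addnC N M) big_srangeS addrAC.
rewrite (funext SE); apply: cvgB; last exact: cvg_cst.
rewrite (cvg_shiftn N (fun M => \sum_(m <- srange M) F m ^+ 2)).
by under eq_fun do under eq_bigr do rewrite -FE.
Qed.

Lemma tends0_tail (u : int -> R) : tends0 u -> tail_close (fun _ n => u n) (fun _ _ => 0).
Proof.
move=> H; split; first by exists 0; apply: nearW => N n _; rewrite normr0.
move=> e e0; have [M HM] := H e e0; exists M => // N /= MN n nN.
by rewrite subr0; apply: HM; exact: leq_ltn_trans nN.
Qed.

Lemma tends0_tail_to (u w : int -> R) : tends0 (fun n => u n - w n) -> (exists C, forall n, `|w n| <= C) ->
  tail_close (fun _ n => u n) (fun _ n => w n).
Proof.
move=> H [C HC]; split; first by exists C; apply: nearW => N n _.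
move=> e e0; have [M HM] := H e e0; exists M => // N /= MN n nN.
by apply: HM; exact: leq_ltn_trans nN.
Qed.

Lemma tail_close_ratio : tail_close (fun N n => N%:R / n%:~R) (fun N n => N%:R / n%:~R : R).
Proof.
split=> [|e e0]; last by apply: nearW => N n _; rewrite subrr normr0 ltW.
exists 1; apply: nearW => N n nN; rewrite normrM normfV norm_intr [`|N%:R|]ger0_norm //.
by rewrite ler_pdivrMr ?ltr0n ?mul1r ?ler_nat ?(ltnW nN) // (leq_ltn_trans _ nN).
Qed.

Section Keg.
Variables (q : nat) (f : R -> 'cV[R]_2) (n : nat -> 'I_(2 * q) -> int) (c : 'I_(2 * q) -> R)
  (E : {set 'I_(2 * q)}).
Hypotheses (Ckp : Ck q p) (Ckr : Ck q r) (Hf : forall i, ACk q (fun x => f x i 0))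
  (Hn : forall M : nat, \forall N \near \oo, forall s, (M < `|n N s|)%N)
  (Hc : forall s, (fun N => (n N s)%:~R / N%:R : R) @ \oo --> c s) (Hc0 : forall s, c s != 0)
  (HE : \forall N \near \oo, forall s, esign (n N s) = psign E s)
  (Eq : #|E| = q) (Oq : #|~: E| = q) (EX : {in E &, injective c}) (OX : {in ~: E &, injective c}).

Let gp (k : nat) := bvalue p r f beta 1 k.
Let gm (k : nat) := bvalue p r f alpha (-1) k.

(** N^q times the bracket in c_n - P~_n = x_n [ ... ], in the scaled unknowns w
    k = N^(q-k) (g_k - g~_k). *)
Definition defect (rho : int -> R) (w w' : 'I_q -> R) (N : nat) (m : int) : R :=
  \sum_(k < q) (N%:R / lam m) ^+ k * (kp m * w k - km m * w' k) +
  (N%:R / lam m) ^+ q * (kp m * gp q - km m * gm q + rho m).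

Lemma tends0_along (u : int -> R) s : tends0 u -> (fun N => u (n N s)) @ \oo --> 0.
Proof.
move=> H; apply/cvgrPdist_le => e e0; have [M HM] := H e e0.
by apply: filterS (Hn M) => N HN; rewrite sub0r normrN; apply: HM.
Qed.

Lemma K0_neq0 : K0 != 0 :> R.
Proof. by rewrite invr_eq0 gt_eqF // sqrtr_gt0. Qed.

Lemma node_cvg s : (fun N => N%:R / lam (n N s)) @ \oo --> 2 / pi / c s.
Proof.
have H1 : (fun N => (n N s)%:~R / lam (n N s)) @ \oo --> 2 / pi.
  by apply/subr_cvg0; exact: tends0_along lam_ratio.
have H2 : (fun N => ((n N s)%:~R / N%:R)^-1 : R) @ \oo --> (c s)^-1 by apply: cvgV.
apply: cvg_trans (cvgM H1 H2); apply: near_eq_cvg.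
apply: filterS2 (Hn 0%N) (nbhs_infty_gt 0) => N HN N0 /=.
have n0 : (n N s)%:~R != 0 :> R by rewrite intr_eq0; have := HN s; case: (n N s) => -[].
by rewrite invf_div mulrC mulrA mulfVK.
Qed.

Lemma kp_along s : (fun N => kp (n N s)) @ \oo --> K0 * psign E s.
Proof.
apply/subr_cvg0; apply: cvg_trans (tends0_along s kp_asymp); apply: near_eq_cvg.
by apply: filterS HE => N HN /=; rewrite HN.
Qed.

Lemma km_along s : (fun N => km (n N s)) @ \oo --> K0.
Proof. by apply/subr_cvg0; exact: tends0_along km_asymp. Qed.

(** The unscaling (key) is a bijection between solutions of the given system
    and of the scaled one, to which block_cvg applies. *)
Lemma keg_defect : exists rho : int -> R, exists y y' : nat -> 'I_q -> R, exists z z' : 'I_q -> R,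
  [/\ tends0 rho, (forall k : 'I_q, (fun N => y N k) @ \oo --> z k), (forall k : 'I_q, (fun N => y' N k) @ \oo --> z' k),
   (forall s, \sum_(k < q) (2 / pi / c s) ^+ k * (z k - psign E s * z' k) +
      (gp q - psign E s * gm q) * (2 / pi / c s) ^+ q = 0) &
   \forall N \near \oo, forall m,
     N%:R ^+ q.+1 * (inner (v m) f - inner (Pfun (keg_solution lam v kp km f (n N))) (v m)) =
     N%:R / lam m * defect rho (y N) (y' N) N m].
Proof.
have [rho Hrho Hexp] := coef_expand Ckp Ckr Hf.
pose X N s := N%:R / lam (n N s).
pose rhs N s := - (X N s ^+ q * (kp (n N s) * gp q - km (n N s) * gm q + rho (n N s))).
have inj (S : {set 'I_(2 * q)}) : {in S &, injective c} -> {in S &, injective (fun s => 2 / pi / c s)}.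
  move=> SX s t sS tS /mulfI H; apply: SX => //; apply: invr_inj; apply: H.
  by rewrite mulf_neq0 ?invr_eq0 ?gt_eqF ?pi_gt0.
have [|y [y' [z [z' [Hz Hy Hy' Hsol]]]]] := @block_cvg R q X (fun N s => kp (n N s)) (fun N s => km (n N s)) rhs
  (fun s => 2 / pi / c s) (fun s => - ((2 / pi / c s) ^+ q * (K0 * psign E s * gp q - K0 * gm q + 0)))
  K0 E K0_neq0 Eq Oq (inj _ EX) (inj _ OX) node_cvg kp_along km_along.
  move=> s; apply: cvgN; apply: cvgM; first by apply: cvg_exp; exact: node_cvg.
  apply: cvgD; last exact: tends0_along.
  by apply: cvgB; apply: cvgM; [exact: kp_along|exact: cvg_cst|exact: km_along|exact: cvg_cst].
exists rho, y, y', z, z'; split => //.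
  move=> s; have := Hz s; rewrite addr0.
  have ps : psign E s * psign E s = 1 :> R by rewrite /psign; case: ifP; rewrite ?mulrNN mulr1.
  have -> : K0 * psign E s * gp q - K0 * gm q = K0 * psign E s * (gp q - psign E s * gm q).
    move: ps; move: (psign E s : R) (gp q) (gm q) (K0 : R) => e g h K ee.
    by rewrite -[K * h]mulr1 -ee; ring.
  move=> H; apply: (mulfI (_ : K0 * psign E s != 0)).
    by rewrite mulf_neq0 ?K0_neq0 // /psign; case: ifP; rewrite ?oppr_eq0 oner_eq0.
  by rewrite mulr0 mulrDr H [_ * (2 / pi / c s) ^+ q]mulrC mulrCA addNr.
(* a right inverse of the scaling of the defects, valid also before any solution is known *)
pose unscale (w w' : 'I_q -> R) (N : nat) : 'rV[R]_q * 'rV[R]_q :=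
  (\row_k (gp k - w k / N%:R ^+ (q - k)), \row_k (gm k - w' k / N%:R ^+ (q - k))).
have key (w w' : 'I_q -> R) N m : (0 < N)%N ->
    N%:R ^+ q.+1 * (inner (v m) f - (lam m)^-1 * \sum_(k < q) (lam m)^-1 ^+ k *
       (kp m * (unscale w w' N).1 0 k - km m * (unscale w w' N).2 0 k)) =
    N%:R / lam m * defect rho w w' N m.
  move=> N0; have n0 : N%:R != 0 :> R by rewrite pnatr_eq0 -lt0n.
  have -> : defect rho w w' N m = N%:R ^+ q * (\sum_(k < q) (lam m)^-1 ^+ k * (kp m * gp k - km m * gm k) +
     (lam m)^-1 ^+ q * (kp m * gp q - km m * gm q + rho m) - \sum_(k < q) (lam m)^-1 ^+ k *
       (kp m * (unscale w w' N).1 0 k - km m * (unscale w w' N).2 0 k)).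
    rewrite addrAC -sumrB mulrDr mulr_sumr /defect; congr (_ + _); last by rewrite exprMn mulrA.
    apply: eq_bigr => k _; rewrite !mxE exprMn /=.
    rewrite -{3}(subnKC (ltnW (ltn_ord k))) exprD; field.
    by rewrite expf_neq0.
  rewrite Hexp /gp /gm exprS.
  move: (\sum_(_ < _) _) (\sum_(_ < _) _) => S1 S2; ring.
have system N (w w' : 'I_q -> R) : (0 < N)%N -> keg_system lam v kp km f (n N) (unscale w w' N)
    <-> forall s, two_block (X N) (fun s => kp (n N s)) (fun s => km (n N s)) w w' s = rhs N s.
  move=> N0; have n0 : N%:R != 0 :> R by rewrite pnatr_eq0 -lt0n.
  have D s : defect rho w w' N (n N s) =
      two_block (X N) (fun s => kp (n N s)) (fun s => km (n N s)) w w' s - rhs N s.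
    by rewrite /rhs opprK.
  split=> H s.
    apply/eqP; rewrite -subr_eq0 -D; have := key w w' N (n N s) N0.
    by rewrite -(H s) subrr mulr0 => /esym/eqP; rewrite !mulf_eq0 invr_eq0 (negPf n0) (negPf (lam_neq0 _)).
  apply/eqP; rewrite -subr_eq0; have := key w w' N (n N s) N0; rewrite D H subrr mulr0 => /eqP.
  by rewrite mulf_eq0 expf_eq0 (negPf n0) andbF.
apply: filterS2 Hsol (nbhs_infty_gt 0) => N HN N0 m; rewrite -(key _ _ _ _ N0) inner_Pfun.
have n0 : N%:R != 0 :> R by rewrite pnatr_eq0 -lt0n.
have solN : keg_system lam v kp km f (n N) (unscale (y N) (y' N) N).
  by apply/(system N (y N) (y' N) N0)/HN.
have := xgetPex (0, 0) (ex_intro _ _ solN); rewrite -/(keg_solution lam v kp km f (n N)).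
move: (keg_solution _ _ _ _ _ _) => [g g'] Hg.
pose w (k : 'I_q) := (gp k - g 0 k) * N%:R ^+ (q - k); pose w' (k : 'I_q) := (gm k - g' 0 k) * N%:R ^+ (q - k).
have gE : (g, g') = unscale w w' N.
  by rewrite /unscale; congr (_, _); apply/rowP => k; rewrite mxE /w /w' mulfK ?expf_neq0 // subKr.
move: Hg; rewrite gE => /(system N w w' N0)/HN[wE w'E].
congr (_ * (_ - _ * _)); apply: eq_bigr => k _; rewrite !mxE wE w'E; done.
Qed.

Lemma tail_node : tail_close (fun N m => N%:R / lam m) (fun N m => 2 / pi * (N%:R / m%:~R)).
Proof.
have H : tail_close (fun _ m => m%:~R / lam m) (fun _ _ => 2 / pi).
  by apply: tends0_tail_to lam_ratio _; exists `|2 / pi|.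
apply: (tail_close_ext (tail_closeM H tail_close_ratio)) => [N m mN|//].
have m0 : m%:~R != 0 :> R by rewrite intr_eq0; case: m mN => -[].
by rewrite mulrC mulrA mulfVK.
Qed.

Lemma tail_defect rho (y y' : nat -> 'I_q -> R) (z z' : 'I_q -> R) : tends0 rho ->
  (forall k : 'I_q, (fun N => y N k) @ \oo --> z k) ->
  (forall k : 'I_q, (fun N => y' N k) @ \oo --> z' k) ->
  tail_close (fun N m => defect rho (y N) (y' N) N m) (fun N m =>
    \sum_(k < q) (2 / pi * (N%:R / m%:~R)) ^+ k * (K0 * esign m * z k + -1 * (K0 * z' k)) +
    (2 / pi * (N%:R / m%:~R)) ^+ q * (K0 * esign m * gp q + -1 * (K0 * gm q) + 0)).
Proof.
move=> Hrho Hy Hy'.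
have Hkp : tail_close (fun _ m => kp m) (fun _ m => K0 * esign m).
  apply: (tends0_tail_to kp_asymp); exists `|K0| => m; rewrite normrM.
  by rewrite [`|esign m|](_ : _ = 1) ?mulr1 // /esign; case: ifP; rewrite ?normrN normr1.
have Hkm : tail_close (fun _ m => km m) (fun _ _ => K0).
  by apply: (tends0_tail_to km_asymp); exists `|K0|.
have lin (a b : nat -> R) (a0 b0 : R) : a @ \oo --> a0 -> b @ \oo --> b0 ->
   tail_close (fun N m => kp m * a N + -1 * (km m * b N)) (fun N m => K0 * esign m * a0 + -1 * (K0 * b0)).
  move=> /tail_close_cvg Ha /tail_close_cvg Hb.
  exact: tail_closeD (tail_closeM Hkp Ha) (tail_closeM (tail_close_cst _) (tail_closeM Hkm Hb)).
have T1 : tail_close (fun N m => \sum_(k < q) (N%:R / lam m) ^+ k * (kp m * y N k + -1 * (km m * y' N k)))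
   (fun N m => \sum_(k < q) (2 / pi * (N%:R / m%:~R)) ^+ k * (K0 * esign m * z k + -1 * (K0 * z' k))).
  by apply: tail_close_sum => k; apply: tail_closeM; [exact: tail_closeX tail_node|exact: lin].
have cst (b : R) : (fun _ : nat => b) @ \oo --> b by exact: cvg_cst.
have T2 := tail_closeM (tail_closeX q tail_node)
  (tail_closeD (lin _ _ _ _ (cst (gp q)) (cst (gm q))) (tends0_tail Hrho)).
apply: (tail_close_ext (tail_closeD T1 T2)) => [N m _|//]; rewrite /defect mulN1r; congr (_ + _).
by apply: eq_bigr => k _; rewrite mulN1r.
Qed.

(** The limit of N^(2q+2) F_n^2 / u^2 as a polynomial in u = N/n, for even
    (true) and odd (false) n. *)
Definition limit_poly (b : bool) : {poly R} :=
  ((2 / pi * K0 * (2 / pi) ^+ q * (if b then gp q - gm q else gp q + gm q)) ^+ 2)%:P *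
  \prod_(s in if b then E else ~: E) ('X - (c s)^-1%:P) ^+ 2.

Lemma horner_limit_poly (b : bool) (x : R) : (limit_poly b).[x] =
  (2 / pi * K0 * (2 / pi) ^+ q * (if b then gp q - gm q else gp q + gm q)) ^+ 2 *
  \prod_(s in if b then E else ~: E) (x - (c s)^-1) ^+ 2.
Proof.
rewrite hornerM hornerC horner_prod; congr (_ * _).
by apply: eq_bigr => s _; rewrite horner_exp hornerXsubC.
Qed.

Lemma keg_limit : (0 < q)%N ->
  (fun N : nat => N%:R ^+ (2 * q + 1) * L2norm (keg_error alpha beta lam v kp km G f (n N) N) ^+ 2) @ \oo -->
  2 ^+ (2 * q) / pi ^+ (2 * q + 2) * ((gp q - gm q) ^+ 2 * Jint c E + (gp q + gm q) ^+ 2 * Jint c (~: E)).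
Proof.
move=> q0; have [rho [y [y' [z [z' [Hrho Hy Hy' Hz HF]]]]]] := keg_defect.
have p0 : (pi : R) != 0 by rewrite gt_eqF ?pi_gt0.
have inj (S : {set 'I_(2 * q)}) : {in S &, injective c} -> {in S &, injective (fun s => 2 / pi / c s)}.
  move=> SX s t sS tS /mulfI H; apply: SX => //; apply: invr_inj; apply: H.
  by rewrite mulf_neq0 ?invr_eq0.
pose a N m := (m%:~R / lam m * defect rho (y N) (y' N) N m) ^+ 2.
have Ha : tail_close a (fun N m => (limit_poly (2 %| m)%Z).[N%:R / m%:~R]).
  have H1 : tail_close (fun _ m => m%:~R / lam m) (fun _ _ => 2 / pi).
    by apply: tends0_tail_to lam_ratio _; exists `|2 / pi|.
  apply: (tail_close_ext (tail_closeX 2 (tail_closeM H1 (tail_defect Hrho Hy Hy')))) => // N m mN.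
  rewrite horner_limit_poly; move: (N%:R / m%:~R) => u.
  have fact (S : {set 'I_(2 * q)}) : #|S| = q ->
     \prod_(s in S) (2 / pi * u - 2 / pi / c s) = (2 / pi) ^+ q * \prod_(s in S) (u - (c s)^-1).
    move=> Sq; under eq_bigr do rewrite -mulrBr.
    by rewrite big_split /= prodr_const Sq.
  rewrite prodrXl -exprMn /esign; case: ifP => _.
    have I : \sum_(k < q) (2 / pi * u) ^+ k * (z k - z' k) + (gp q - gm q) * (2 / pi * u) ^+ q =
        (gp q - gm q) * ((2 / pi) ^+ q * \prod_(s in E) (u - (c s)^-1)).
      rewrite -(fact _ Eq); apply: (monic_interp Eq (inj _ EX)) => s sE.
      by have := Hz s; rewrite /psign sE mul1r; under eq_bigr do rewrite mul1r.
    have -> : \sum_(k < q) (2 / pi * u) ^+ k * (K0 * 1 * z k + -1 * (K0 * z' k)) =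
        K0 * \sum_(k < q) (2 / pi * u) ^+ k * (z k - z' k).
      by rewrite mulr_sumr; apply: eq_bigr => k _; ring.
    congr (_ ^+ 2); transitivity (2 / pi * K0 *
      (\sum_(k < q) (2 / pi * u) ^+ k * (z k - z' k) + (gp q - gm q) * (2 / pi * u) ^+ q)); first by ring.
    by rewrite I; ring.
  have I : \sum_(k < q) (2 / pi * u) ^+ k * (z k + z' k) + (gp q + gm q) * (2 / pi * u) ^+ q =
      (gp q + gm q) * ((2 / pi) ^+ q * \prod_(s in ~: E) (u - (c s)^-1)).
    rewrite -(fact _ Oq); apply: (monic_interp Oq (inj _ OX)) => s; rewrite inE => sE.
    have := Hz s; rewrite /psign (negPf sE) mulN1r opprK.
    by under eq_bigr do rewrite mulN1r opprK.
  have -> : \sum_(k < q) (2 / pi * u) ^+ k * (K0 * -1 * z k + -1 * (K0 * z' k)) =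
      - K0 * \sum_(k < q) (2 / pi * u) ^+ k * (z k + z' k).
    by rewrite mulr_sumr; apply: eq_bigr => k _; ring.
  (* the sign of the odd right boundary factors disappears in the square *)
  rewrite -[LHS]sqrrN; congr (_ ^+ 2); transitivity (2 / pi * K0 *
    (\sum_(k < q) (2 / pi * u) ^+ k * (z k + z' k) + (gp q + gm q) * (2 / pi * u) ^+ q)); first by ring.
  by rewrite I; ring.
have JE (S : {set 'I_(2 * q)}) (C : R) :
    integral11 (fun x => C * \prod_(s in S) (x - (c s)^-1) ^+ 2) = C * Jint c S.
  apply: integral11Z; apply: (C0_ext (HD_C0 (@HD_poly R (\prod_(s in S) ('X - (c s)^-1%:P) ^+ 2)))) => x _.
  by rewrite horner_prod; apply: eq_bigr => s _; rewrite horner_exp hornerXsubC.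
have -> : 2 ^+ (2 * q) / pi ^+ (2 * q + 2) * ((gp q - gm q) ^+ 2 * Jint c E + (gp q + gm q) ^+ 2 * Jint c (~: E))
  = (integral11 (fun x => (limit_poly true).[x]) + integral11 (fun x => (limit_poly false).[x])) / 2.
  have IE (b : bool) := integral11_ext (fun x (_ : I11 x) => horner_limit_poly b x).
  rewrite !IE !JE !exprMn.
  have -> : K0 ^+ 2 = 2^-1 :> R by rewrite exprVn sqr_sqrtr.
  have E2 (t : R) : t ^+ (2 * q) = t ^+ q ^+ 2 by rewrite mulnC exprM.
  rewrite !exprVn exprD !E2.
  have : (pi : R) ^+ q != 0 by rewrite expf_neq0.
  move: (Jint _ _) (Jint _ _) (2 ^+ q) p0 => j1 j2 x; move: (pi ^+ q) (gp q) (gm q) => P a1 a2.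
  move: (pi) => P0 n1 n2; field.
  by rewrite n1 n2.
have Sf : smooth f.
  case: (q) q0 Ckp Ckr Hf => // k _ Cp1 Cr1 Hf1; have [D A] := dirac_step Cp1 Cr1 Hf1.
  exists (dirac_op p r f) => //; have C i : C0 (fun x => dirac_op p r f x i 0).
    by have [/Ck_le-/(_ 0 (leq0n _))/Ck0] := A i.
  by split; exact: C.
apply: (tail_sum_limit Ha); apply: filterS2 HF (nbhs_infty_gt 0) => N HN N0.
pose F m := inner (v m) f - inner (Pfun (keg_solution lam v kp km f (n N))) (v m).
have H := @error_norm q f (n N) N F Sf (fun m => erefl).
have n0 : N%:R != 0 :> R by rewrite pnatr_eq0 -lt0n.
have E1 (k : nat) m : (0 < k)%N -> m%:~R ^+ 2 = k%:R ^+ 2 :> R ->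
    N%:R / k%:R ^+ 2 * a N m = N%:R ^+ (2 * q + 1) * F m ^+ 2.
  move=> k0 mk; have k1 : k%:R != 0 :> R by rewrite pnatr_eq0 -lt0n.
  apply: (mulfI n0); rewrite [RHS]mulrA -exprS (_ : (2 * q + 1).+1 = q.+1 * 2)%N; last by rewrite addn1 mulnC.
  rewrite exprM -[RHS]exprMn HN /a !exprMn mk; move: (defect _ _ _ _ _) => D.
  by field; rewrite k1 lam_neq0.
have ET M : \sum_(0 <= j < M) N%:R / (N.+1 + j)%:R ^+ 2 * (a N (N.+1 + j)%:Z + a N (- (N.+1 + j)%:Z)) =
    N%:R ^+ (2 * q + 1) * \sum_(0 <= j < M) (F (N.+1 + j)%:Z ^+ 2 + F (- (N.+1 + j)%:Z) ^+ 2).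
  by rewrite mulr_sumr; apply: eq_bigr => j _; rewrite !mulrDr !E1 // mulrNz sqrrN.
by rewrite (funext ET); apply: cvgM; [exact: cvg_cst|exact: H].
Qed.

End Keg.
End Eigen.
End Resolvent.

Theorem theorem4p1 (R : realType) (q : nat) (alpha beta : R) (p r : R -> R)
    (f : R -> 'cV[R]_2)
    (lam : int -> R) (v : int -> R -> 'cV[R]_2) (kp km : int -> R)
    (G : R -> R -> R -> 'M[R]_2)
    (alpha0 : R) (n : nat -> 'I_(2 * q) -> int) (c : 'I_(2 * q) -> R)
    (E O : {set 'I_(2 * q)})
    (hq : (1 <= q)%N)
    (halpha : 0 <= alpha <= pi) (hbeta : 0 <= beta <= pi)
    (hp : Ck q p) (hr : Ck q r)
    (hf : Ck q f) (hfq : abs_continuous (iter q derive_on f))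
    (h0 : ~ dirac_eigenvalue alpha beta p r 0)
    (hlam : eigenvalue_enum alpha beta p r lam)
    (hv : eigenfunction_system alpha beta p r lam v)
    (hkp : forall m, v m 1 = kp m *: bdir beta)
    (hkm : forall m, v m (-1) = km m *: bdir alpha)
    (hG : green_matrix alpha beta p r G)
    (halpha0 : 0 < alpha0 < 1)
    (hn : \forall N \near \oo,
       [/\ injective (n N),
           (forall s, n N s != 0) &
           forall s, alpha0 * N%:R <= `|n N s|%:~R <= (N%:R : R)])
    (hc : forall s, (fun N => (n N s)%:~R / N%:R : R) @ \oo --> c s)
    (hc0 : forall s, c s != 0)
    (hE : \forall N \near \oo, forall s, (s \in E) = (2 %| n N s)%Z)
    (hO : \forall N \near \oo, forall s, (s \in O) = ~~ (2 %| n N s)%Z)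
    (hEq : #|E| = q) (hOq : #|O| = q)
    (hcE : {in E &, injective c}) (hcO : {in O &, injective c}) :
  let A := bvalue p r f beta 1 q in
  let B := - bvalue p r f alpha (-1) q in
  (fun N : nat => N%:R ^+ (2 * q + 1) *
     L2norm (keg_error alpha beta lam v kp km G f (n N) N) ^+ 2) @ \oo -->
  2 ^+ (2 * q) / pi ^+ (2 * q + 2) *
    ((A + B) ^+ 2 * Jint c E + (A - B) ^+ 2 * Jint c O).
Proof.
move=> A B.
have Cp : C0 p by apply/Ck0; exact: Ck_le hp.
have Cr : C0 r by apply/Ck0; exact: Ck_le hr.
have Hf i : ACk q (fun x => f x i 0) by exact: ACk_coord hf hfq.
have OE : O = ~: E.
  have [N [HE HO]] := filter_ex (filterI hE hO).
  by apply/setP => s; rewrite inE HE HO.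
have Hn (M : nat) : \forall N \near \oo, forall s, (M < `|n N s|)%N.
  have /andP[a0 _] := halpha0.
  have := archi_boundP (divr_ge0 (ler0n _ M.+1) (ltW a0)).
  move: (Num.Def.archi_bound _) => K HK.
  apply: filterS2 hn (nbhs_infty_ge K) => N [_ _ HN] KN s.
  have /andP[h _] := HN s; rewrite -(ltr_nat R).
  have h1 : M.+1%:R <= alpha0 * N%:R.
    rewrite mulrC -ler_pdivrMr //; apply: le_trans (ltW HK) _; by rewrite ler_nat.
  apply: lt_le_trans (le_trans h1 _); first by rewrite ltr_nat.
  by apply: le_trans h _; rewrite -abszE -pmulrn.
have HE : \forall N \near \oo, forall s, esign (n N s) = psign E s :> R.
  by apply: filterS hE => N HN s; rewrite /esign /psign HN.
rewrite /A /B opprK OE in hO hOq hcO *.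
exact: (keg_limit Cp Cr hG h0 hlam hv hkp hkm hp hr Hf Hn hc hc0 HE hEq hOq hcE hcO hq).
Qed.
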